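(* Let $T>0$, $M>0$, $l\in\{1,2,\ldots\}$, $\Omega=[0,T]^l$, let $r\ge 1$ be an integer and $\gamma>0$ a real number, and let $s$ be the integer $s=r+\gamma$ if $\gamma$ is an integer and $s=r+[\gamma]+1$ if $\gamma$ is not an integer. Let $Q^{*}_{r,\gamma}(\Omega,M)$ be the class of functions defined in the context, and let $v=s/(s-\gamma)$. Then $$d_n\bigl(Q^{*}_{r,\gamma}(\Omega,M),C(\Omega)\bigr)\asymp\delta_n\bigl(Q^{*}_{r,\gamma}(\Omega,M),C(\Omega)\bigr)\asymp\varepsilon_n,$$ where $\varepsilon_n\asymp n^{-s}$ if $l=1$, and, if $l\ge 2$, $$\varepsilon_n\asymp\begin{cases} n^{-(s-\gamma)/(l-1)}, & v>\frac{l}{l-1},\\ n^{-s/l}(\ln n)^{s/l}, & v=\frac{l}{l-1},\\ n^{-s/l}, & v<\frac{l}{l-1}.\end{cases}$$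
   Context: The class $Q^{*}_{r,\gamma}(\Omega,M)$, $\Omega=[0,T]^l$, consists of the functions $f(t_1,\ldots,t_l)$ defined on $\Omega$ such that, for multi-indices $k=(k_1,\ldots,k_l)$ with $|k|=k_1+\cdots+k_l$, $$\left|\frac{\partial^{|k|}f(t)}{\partial t_1^{k_1}\cdots\partial t_l^{k_l}}\right|\le M,\quad 0\le|k|\le r,\ t\in\Omega,$$ $$\left|\frac{\partial^{|k|}f(t)}{\partial t_1^{k_1}\cdots\partial t_l^{k_l}}\right|\le\frac{M}{(\rho(t,\Gamma_0))^{|k|-r-\zeta}},\quad r<|k|\le s,\ t\in\Omega\setminus\Gamma_0.$$ Here $s=r+\gamma$ and $\zeta=0$ if $\gamma$ is an integer; if $\gamma$ is not an integer, write $\gamma=[\gamma]+\mu$ with $0<\mu<1$ ($[\gamma]$ is the integer part) and put $s=r+[\gamma]+1$, $\zeta=1-\mu$. $\Gamma_0$ is the intersection of the boundary of $\Omega$ with the union of the coordinate planes $\{t_i=0\}$ (for $l=1$, $\Gamma_0$ is the point $t=0$), and $\rho(t,\Gamma_0)=\min_i|t_i|$. $C(\Omega)$ is the Banach space of continuous functions on $\Omega$ with the maximum norm. For a Banach space $B$ and a set $X\subset B$, the Kolmogorov $n$-width is $$d_n(X,B)=\inf_{L^n}\sup_{x\in X}\inf_{u\in L^n}\|x-u\|,$$ the outer infimum being over all $n$-dimensional linear subspaces $L^n$ of $B$. The Babenko $n$-width is $$\delta_n(X,B)=\inf_{\Pi:X\to\mathbb{R}^n}\ \sup_{x\in X}\operatorname{diam}\Pi^{-1}(\Pi(x)),$$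 the infimum being over all continuous mappings $\Pi:X\to\mathbb{R}^n$ (continuity and diameter taken with respect to the norm of $B$). For positive sequences, $a_n\asymp b_n$ means that there are constants $c_1,c_2>0$ independent of $n$ with $c_1b_n\le a_n\le c_2b_n$ for all sufficiently large $n$. *)

(* Defs.v *)
From HB Require Import structures.
From mathcomp Require Import all_boot all_order all_algebra.
From mathcomp Require Import all_classical all_reals all_analysis.

Set Implicit Arguments.
Unset Strict Implicit.
Unset Printing Implicit Defensive.

Import Order.TTheory GRing.Theory Num.Theory.
Import numFieldNormedType.Exports.

Local Open Scope classical_set_scope.
Local Open Scope ring_scope.

Definition cube (R : realType) (l : nat) (T : R) : set 'rV[R]_l :=
  [set t | forall i, 0 <= t ord0 i <= T].
Arguments cube {R} l T.

Definition continuousb (R : realType) (l : nat) (T : R) :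
  {pred (cube l T -> R)} := fun f => `[< continuous f >].
Arguments continuousb {R} l T.

(* Elements of C_cube are functions on the points of the cube only, seen as a
   type with the subspace topology. *)
Record C_cube (R : realType) (l : nat) (T : R) := CCube {
  C_cube_fun :> cube l T -> R;
  C_cube_continuous : C_cube_fun \in continuousb l T }.

Arguments C_cube {R} l T.

Section C_cube_normed_module.
Context (R : realType) (l : nat) (T : R).
Implicit Types f g : C_cube l T.

Lemma continuousb_submod_closed :
  submod_closed (continuousb l T).
Proof.
split.
  apply/asboolP => t; rewrite (_ : 0 = cst 0)//; exact: (@cst_continuous _ R).
move=> a f g /asboolP cf /asboolP cg; apply/asboolP => t.
rewrite (_ : a *: f + g = (fun u => a * f u + g u))//.
apply: (cvgD (F := nbhs t)); last exact: cg.
by apply: cvgM; [exact: cvg_cst | exact: cf].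
Qed.

HB.instance Definition _ := GRing.isSubmodClosed.Build R (cube l T -> R)
  (continuousb l T) continuousb_submod_closed.

HB.instance Definition _ := [isSub for @C_cube_fun R l T].
HB.instance Definition _ := gen_eqMixin (C_cube l T).
HB.instance Definition _ := gen_choiceMixin (C_cube l T).
HB.instance Definition _ := [SubChoice_isSubLmodule of C_cube l T by <:].

Lemma compact_cube : compact (cube l T).
Proof.
rewrite (_ : cube l T = [set t | forall i, (`[0, T]%classic : set R) (t ord0 i)]); last first.
  by apply/seteqP; split => t /= h i; move: (h i); rewrite in_itv.
by apply: (@rV_compact R l (fun=> `[0, T]%classic)) => i; exact: segment_compact.
Qed.

Definition max_norm f : R := sup [set `|f t| | t in [set: cube l T]].

Lemma C_cube_has_ubound f : has_ubound [set `|f t| | t in [set: cube l T]].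
Proof.
case: f => f /= /asboolP cf.
have cg : {within cube l T, continuous (valL_ 0 f)}.
  by apply/subspace_sigL_continuousP; rewrite valLK.
have /compact_bounded [M [_ hM]] := continuous_compact cg compact_cube.
exists (M + 1) => _ [t _ <-]; apply: (hM (M + 1)); first by rewrite ltrDl.
by exists (\val t); [exact: set_valP | rewrite -[in RHS](valLK 0 f)].
Qed.

Lemma le_max_norm f t : `|f t| <= max_norm f.
Proof. by apply: ub_le_sup; [exact: C_cube_has_ubound | exists t]. Qed.

Lemma max_norm_le f (c : R) : 0 <= c -> (forall t, `|f t| <= c) ->
  max_norm f <= c.
Proof.
move=> c0 fc; have [[t _]|no] := pselect ([set: cube l T] !=set0).
  by apply: ge_sup; [exists `|f t|, t | move=> _ [u _ <-]].
rewrite /max_norm (_ : [set _ | _ in _] = set0) ?sup0//.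
by apply/seteqP; split => // y [t _ _]; case: no; exists t.
Qed.

Lemma max_norm_ge0 f : 0 <= max_norm f.
Proof.
have [[t _]|no] := pselect ([set: cube l T] !=set0).
  exact: le_trans (le_max_norm f t).
rewrite /max_norm (_ : [set _ | _ in _] = set0) ?sup0//.
by apply/seteqP; split => // y [t _ _]; case: no; exists t.
Qed.

Lemma max_normD f g : max_norm (f + g) <= max_norm f + max_norm g.
Proof.
apply: max_norm_le; first by rewrite addr_ge0 ?max_norm_ge0.
by move=> t; apply: (le_trans (ler_normD _ _)); rewrite lerD ?le_max_norm.
Qed.

Lemma max_norm0_eq0 f : max_norm f = 0 -> f = 0.
Proof.
move=> f0; apply: val_inj; apply/funext => t; apply/eqP.
by rewrite -normr_le0 -f0 le_max_norm.
Qed.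

Lemma max_normZ_le (a : R) f : max_norm (a *: f) <= `|a| * max_norm f.
Proof.
apply: max_norm_le; first by rewrite mulr_ge0 ?max_norm_ge0.
move=> t; rewrite (_ : (a *: f) t = a * f t)// normrM.
by rewrite ler_wpM2l ?le_max_norm.
Qed.

Lemma max_normZ (a : R) f : max_norm (a *: f) = `|a| * max_norm f.
Proof.
apply/eqP; rewrite eq_le max_normZ_le/=.
have [->|a0] := eqVneq a 0; first by rewrite normr0 mul0r max_norm_ge0.
rewrite -[f in X in X <= _](scalerK a0) -ler_pdivlMl ?normr_gt0//.
by rewrite (le_trans (max_normZ_le _ _))// normfV.
Qed.

HB.instance Definition _ := Lmodule_isNormed.Build R (C_cube l T)
  max_normD max_normZ max_norm0_eq0.

End C_cube_normed_module.

Section widths.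
Context (R : realType) (B : normedModType R).
Local Open Scope ereal_scope.

Definition subspace_of_dim (n : nat) (L : set B) : Prop :=
  exists e : 'I_n -> B,
    (forall a : 'I_n -> R, (\sum_i a i *: e i = 0)%R -> forall i, a i = 0%R) /\
    L = [set (\sum_i a i *: e i)%R | a in [set: 'I_n -> R]].

Definition kolmogorov_width (n : nat) (X : set B) : \bar R :=
  ereal_inf
    [set ereal_sup
           [set ereal_inf [set `|x - u|%:E | u in L] | x in X]
       | L in subspace_of_dim n].

Definition diam (A : set B) : \bar R :=
  ereal_sup [set `|p.1 - p.2|%:E | p in A `*` A].

(* Maps X -> R^n are represented by total maps that are continuous on the
   subspace X: both the continuity and the fibres only involve points of X. *)
Definition babenko_width (n : nat) (X : set B) : \bar R :=
  ereal_inf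
    [set ereal_sup [set diam (X `&` Pi @^-1` [set Pi x]) | x in X]
       | Pi in [set Pi : B -> 'rV[R]_n | {within X, continuous Pi}]].

End widths.

Definition asymp (R : realType) (a b : nat -> \bar R) : Prop :=
  exists c1 c2 : R, [/\ 0 < c1, 0 < c2 &
    \forall n \near \oo, (c1%:E * b n <= a n <= c2%:E * b n)%E].

Section partial_derivatives.
Context (R : realType) (l : nat) (T : R).
Implicit Types (f : cube l T -> R) (t u : cube l T) (k : 'I_l -> nat).

Definition coord t (i : 'I_l) : R := set_val t ord0 i.

(* The increments are taken within the cube, so that the derivative is one-sided
   on the faces orthogonal to the i-th axis. *)
Definition axis_nbhs (i : 'I_l) t : set_system (cube l T) :=
  within [set u | u <> t /\ forall j, j != i -> coord u j = coord t j] (nbhs t).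

Definition diff_quotient (i : 'I_l) f t u : R :=
  (f u - f t) / (coord u i - coord t i).

Definition partial_derivable (i : 'I_l) f t : Prop :=
  cvg (diff_quotient i f t @ axis_nbhs i t).

Definition partial (i : 'I_l) f t : R :=
  lim (diff_quotient i f t @ axis_nbhs i t).

Definition iter_partial (w : seq 'I_l) f : cube l T -> R := foldr partial f w.

Fixpoint iter_partial_derivable (A : set (cube l T)) (w : seq 'I_l) f : Prop :=
  if w is i :: w' then
    iter_partial_derivable A w' f /\
    forall t, A t -> partial_derivable i (iter_partial w' f) t
  else True.

(* d^|k| f / dt_1^k_1 ... dt_l^k_l, in the order in which it is written: the
   derivatives with respect to t_l are taken first.  Existence at every stage is
   [multi_derivable_on]; [partial] alone is total. *)
Definition directions k : seq 'I_l := flatten [seq nseq (k i) i | i <- enum 'I_l].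

Definition multi_partial k := iter_partial (directions k).

Definition multi_derivable_on A k := iter_partial_derivable A (directions k).

Definition mi_order k : nat := (\sum_i k i)%N.

End partial_derivatives.

Section the_class.
Context (R : realType) (l : nat) (T : R).

Definition smoothness (r : nat) (gamma : R) : nat :=
  if gamma \is a Num.nat then (r + Num.truncn gamma)%N
  else (r + Num.truncn gamma).+1.

Definition zeta (gamma : R) : R :=
  if gamma \is a Num.nat then 0
  else 1 - (gamma - (Num.truncn gamma)%:R).

Definition Gamma0 : set 'rV[R]_l :=
  (closure (cube l T) `\` interior (cube l T)) `&`
  \bigcup_(i : 'I_l) [set t | t ord0 i = 0].

(* Starting the minimum from T is harmless: every coordinate is at most T. *)
Definition rho (t : cube l T) : R := \big[Num.min/T]_(i < l) `|coord t i|.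

Definition Qstar (r : nat) (gamma M : R) : set (C_cube l T) :=
  [set f |
    (forall k : 'I_l -> nat, (mi_order k <= r)%N ->
       multi_derivable_on setT k f /\
       forall t, `|multi_partial k f t| <= M) /\
    (forall k : 'I_l -> nat, (r < mi_order k <= smoothness r gamma)%N ->
       multi_derivable_on [set t | ~ Gamma0 (set_val t)] k f /\
       forall t, ~ Gamma0 (set_val t) ->
         `|multi_partial k f t|
           <= M / (rho t `^ ((mi_order k)%:R - r%:R - zeta gamma)))].

End the_class.

Definition width_rate (R : realType) (l s : nat) (gamma : R) (n : nat) : R :=
  let v := s%:R / (s%:R - gamma) in
  let vcrit := l%:R / (l%:R - 1) in
  if l == 1%N then n%:R `^ (- s%:R)
  else if vcrit < v then n%:R `^ (- ((s%:R - gamma) / (l%:R - 1)))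
  else if v == vcrit then
    n%:R `^ (- (s%:R / l%:R)) * ln n%:R `^ (s%:R / l%:R)
  else n%:R `^ (- (s%:R / l%:R)).

(* Main.v *)
From mathcomp Require Import all_boot all_order all_algebra all_fingroup.
From mathcomp Require Import all_classical all_reals all_analysis.
From mathcomp Require Import zify ring lra.
Require Import Defs.
Set Implicit Arguments.
Unset Strict Implicit.
Unset Printing Implicit Defensive.
Import Order.TTheory GRing.Theory Num.Theory.
Import numFieldNormedType.Exports.
(** Write [sigma = s - gamma] and fix a level [J].  Split the cube into the shells
  [2 ^ -(j + 1) <= rho <= 2 ^ - j], [j <= J], and the [j]-th shell into cubes of side about
  [2 ^ - level J j], chosen so that the bound [2 ^ (j gamma)] on the derivatives of order
  [s] and the side compensate to the error [eps J = 2 ^ -(J sigma)].  The number of cubes is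
  of order [volume J = \sum_(j <= J) 2 ^ (l level J j - j)], a geometric sum that is dominated
  by its first term, by its last term, or has [J + 1] equal terms; this is the trichotomy
  of the rates.

  Upper bound: on each cube tensor Lagrange interpolation, glued by a partition of unity,
  needs only the pure derivatives of order [s].  The layer [rho <= 2 ^ - J] is reached by
  extrapolating along the segments towards the corner [(T, ..., T)]: a function of the class
  is within [eps J] of its extrapolation.

  Lower bound: put a bump of height about [eps J] in each of [N > n] disjoint cubes; the
  sums of these bumps with coefficients in [-1, 1] lie in the class.  For the Kolmogorov width,
  a sign vector read off a functional annihilating the subspace gives a bad element.  For
  the Babenko width, a continuous map from the cube of coefficients to [R ^ n] has a fibre
  that joins two opposite faces, by Sperner's lemma. *)

(** * Sperner's lemma on the Kuhn triangulation *)

(** The bound on the derivatives of order [s] degenerates at the faces [t_i = 0], so no finite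
    grading reaches them by interpolation alone. Extrapolation closes the gap: the extrapolations
    from distances [lam] and [lam / 2] differ by a multiple of [lam ^ sigma], and halving [lam]
    repeatedly gives a convergent geometric series because [sigma >= 1]. The segments run to the
    corner [(T, ..., T)] because they then leave all the faces [t_i = 0] at once.

    A single linear operator, built from point values of [f], gives both upper bounds: the span of
    its basis functions serves the Kolmogorov width, the sampling map the Babenko width. As the
    competing subspaces have dimension exactly [n], a shorter spanning family has to be completed,
    hence the infinite dimension of [C_cube].

    For the Babenko lower bound it is enough that two coefficient vectors of one fibre differ by 2
    in one coordinate: the value at the centre of that bump separates the functions. Opposite faces
    of a cube provide this, so Sperner's lemma, followed by a counting argument on grids, takes the
    place of an antipodal theorem. *)

Lemma involution_even (T : finType) (A : {set T}) (f : T -> T) :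
  (forall x, x \in A -> f x \in A) -> (forall x, x \in A -> f (f x) = x) ->
  (forall x, x \in A -> f x != x) -> ~~ odd #|A|.
Proof.
have [n] := ubnP #|A|; elim: n A => // n IH A /ltnSE leA fA ff fx.
have [->|[x xA]] := set_0Vmem A; first by rewrite cards0.
have fxA : f x \in A :\ x by rewrite !inE fx ?fA.
rewrite (cardsD1 x) xA (cardsD1 (f x)) fxA/= negbK; apply: IH.
- by move: leA; rewrite (cardsD1 x) xA (cardsD1 (f x)) fxA /=; apply: leq_trans; rewrite ltnS leqnSn.
- move=> y; rewrite !inE => /and3P[yfx yx yA]; rewrite fA ?andbT//.
  apply/andP; split; last by apply: contra yfx => /eqP <-; rewrite ff.
  by apply: contra yx => /eqP e; rewrite -(ff y) // e ff.
- by move=> y; rewrite !inE => /and3P[_ _]; exact: ff.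
- by move=> y; rewrite !inE => /and3P[_ _]; exact: fx.
Qed.

Section Sperner.
Variable K : nat.
Implicit Types (lam : (nat -> nat) -> nat).

(* The Freudenthal simplex with smallest vertex [b] in which coordinate [i] is
   incremented at time [p i]. *)
Definition simplex N := ({ffun 'I_N -> 'I_K} * {perm 'I_N})%type.

(** Vertices are sequences padded by zeros, so that a simplex and its lift to the next dimension
    share their vertices and a single labelling [lam] serves all dimensions of the induction. *)
Definition vertex N (x : simplex N) (j : nat) : nat -> nat := fun i =>
  if insub i is Some i' then x.1 i' + (x.2 i' < j) else 0.

Lemma vertexE N (x : simplex N) j (i : 'I_N) : vertex x j i = x.1 i + (x.2 i < j).
Proof. by rewrite /vertex valK. Qed.

Lemma vertex_out N (x : simplex N) j i : N <= i -> vertex x j i = 0.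
Proof. by move=> Ni; rewrite /vertex insubF // ltnNge Ni. Qed.

Lemma eq_vertex N N' (x : simplex N) (y : simplex N') j j' :
  (forall i, vertex x j i = vertex y j' i) -> vertex x j = vertex y j'.
Proof. by move=> e; apply/funext. Qed.

Definition full lam N (x : simplex N) :=
  [forall c : 'I_N.+1, exists j : 'I_N.+1, lam (vertex x j) == c].

(** The facet opposite the vertex [z.2] is a door when it carries every label below [N]. *)
Definition door lam N (z : simplex N * 'I_N.+1) :=
  [forall c : 'I_N, exists j : 'I_N.+1, (j != z.2) && (lam (vertex z.1 j) == c)].


Section door_parity.
Variables (lam : (nat -> nat) -> nat) (N : nat) (x : simplex N).
Hypothesis lamN : forall j, lam (vertex x j) <= N.
Let lab (j : nat) := lam (vertex x j).

Lemma doorP (j : 'I_N.+1) : reflect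
  (forall c, c < N -> exists2 m : 'I_N.+1, m != j & lab m = c) (door lam (x, j)).
Proof.
apply: (iffP forallP) => /= [h c cN|h c].
  by have /existsP[m /andP[mj /eqP e]] := h (Ordinal cN); exists m.
by have [m mj e] := h c (ltn_ord c); apply/existsP; exists m; rewrite mj; apply/eqP.
Qed.

Lemma fullP : reflect
  (forall c, c <= N -> exists m : 'I_N.+1, lab m = c) (full lam x).
Proof.
apply: (iffP forallP) => /= [h c cN|h c].
  by have /existsP[m /eqP e] := h (Ordinal (cN : c < N.+1)); exists m.
by have [m e] := h c (ltn_ord c); apply/existsP; exists m; apply/eqP.
Qed.

(** A section of [g] over the labels below [n] is an injection of ['I_n] into itself, hence a
    bijection, and its inverse recovers [g]. *)
Lemma surj_inj n (g : 'I_n -> nat) :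
  (forall c, c < n -> exists i, g i = c) -> injective g.
Proof.
move=> gs; have /fin_all_exists[h hP] : forall c : 'I_n, exists i, g i = c.
  by move=> c; exact: gs.
have /injF_bij[k hk kh] : injective h.
  by move=> c d e; apply: val_inj; rewrite /= -(hP c) -(hP d) e.
by move=> i j e; rewrite -(kh i) -(kh j); congr h; apply: val_inj; rewrite /= -!hP !kh.
Qed.

Lemma door_inj (j : 'I_N.+1) : door lam (x, j) ->
  forall m m' : 'I_N.+1, m != j -> m' != j -> lab m = lab m' -> m = m'.
Proof.
move=> /doorP jd m m'.
rewrite eq_sym => /unlift_some[i -> _]; rewrite eq_sym => /unlift_some[i' -> _] e.
congr lift; apply: (@surj_inj _ (fun i => lab (lift j i))) => //= c cN.
have [k kj <-] := jd _ cN; move: kj; rewrite eq_sym => /unlift_some[k' -> _].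
by exists k'.
Qed.

Lemma full_inj : full lam x -> forall m m' : 'I_N.+1, lab m = lab m' -> m = m'.
Proof.
by move=> /fullP h; apply: (@surj_inj N.+1 (fun i => lab i)) => c; exact: h.
Qed.

(** If a simplex has a door but is not full, the omitted vertex repeats the label of exactly one
    other vertex, and omitting that one gives the other door. The default [j] is not reached in that
    case. *)
Definition partner (j : 'I_N.+1) : 'I_N.+1 :=
  odflt j [pick m : 'I_N.+1 | (m != j) && (lab m == lab j)].

Lemma partnerP j : ~~ full lam x -> door lam (x, j) ->
  partner j != j /\ lab (partner j) = lab j.
Proof.
move=> nf /doorP jd; rewrite /partner; case: pickP => [m /andP[? /eqP]//|no].
have [labj|labj] := ltnP (lab j) N.
  by have [m mj e] := jd _ labj; have := no m; rewrite mj e eqxx.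
case/negP: nf; apply/fullP => c; rewrite leq_eqVlt => /orP[/eqP ->|/jd[m _ <-]].
  by exists j; apply/eqP; rewrite eqn_leq labj lamN.
by exists m.
Qed.

Lemma partner_door j : ~~ full lam x -> door lam (x, j) -> door lam (x, partner j).
Proof.
move=> nf jd; have [pj e] := partnerP nf jd; apply/doorP => c cN.
have /doorP/(_ _ cN)[m mj mc] := jd.
have [mp|] := eqVneq m (partner j); last by exists m.
by exists j; [rewrite eq_sym | rewrite -e -mp].
Qed.

Lemma partnerK j : ~~ full lam x -> door lam (x, j) -> partner (partner j) = j.
Proof.
move=> nf jd; have [pj e] := partnerP nf jd.
have [ppj pe] := partnerP nf (partner_door nf jd).
apply/eqP/negP => /negP h.
by move/eqP: ppj; apply; apply: door_inj h pj _ => //; rewrite pe.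
Qed.

Lemma full_door j : full lam x -> door lam (x, j) = (lab j == N).
Proof.
move=> fx; apply/doorP/eqP => [jd|jN c cN].
  have [labj|labj] := ltnP (lab j) N; last by apply/eqP; rewrite eqn_leq labj lamN.
  by have [m /eqP mj e] := jd _ labj; case: mj; exact: full_inj.
have /fullP/(_ _ (ltnW cN))[m mc] := fx; exists m => //.
by apply: contraTneq cN => mj; rewrite -mc mj jN ltnn.
Qed.

End door_parity.

Definition doors lam N := [set z : simplex N * 'I_N.+1 | door lam z].
Definition fulls lam N := [set x : simplex N | full lam x].

(** The doors of a simplex that is not full are paired by [partner]; a full simplex has exactly one
    door, which omits the vertex labelled [N]. *)
Lemma odd_doors lam N : (forall (x : simplex N) j, lam (vertex x j) <= N) ->
  odd #|doors lam N| = odd #|fulls lam N|.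
Proof.
move=> lamN; rewrite -(cardsID [set z | full lam z.1] (doors lam N)) oddD.
set A := _ :&: _; set B := _ :\: _.
have -> : odd #|B| = false.
  apply/negbTE; apply: (@involution_even _ B (fun z => (z.1, partner lam z.1 z.2))).
  - by move=> [x j]; rewrite !inE /= => /andP[nf d]; rewrite nf partner_door.
  - by move=> [x j]; rewrite !inE /= => /andP[nf d]; rewrite partnerK.
  - move=> [x j]; rewrite !inE /= => /andP[nf d]; rewrite xpair_eqE eqxx /=.
    by have [] := partnerP (@lamN x) nf d.
rewrite addbF; congr odd.
rewrite -(@card_in_imset _ _ fst A); last first.
  move=> [x j] [y k] /setIP[]; rewrite !inE /= => xd xf /andP[+ yf] /= xy.
  rewrite -xy => yd; congr pair.
  move: xd yd; rewrite !full_door// => /eqP xd /eqP yd.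
  by apply: (full_inj xf); rewrite xd yd.
apply: eq_card => x; rewrite !inE; apply/imsetP/idP => [[[y j]]|xf].
  by rewrite !inE /= => /andP[_ ?] ->.
have /fullP/(_ _ (leqnn N))[m mN] := xf.
by exists (x, m) => //; rewrite !inE /= xf full_door // mN eqxx.
Qed.

(** * Pivoting across a facet of the Kuhn triangulation *)

Section pivot.
Variables (n : nat).
Implicit Types (z : simplex n.+1 * 'I_n.+2).

Definition rot_down : {perm 'I_n.+1} := perm (can_inj (@ord_predK n.+1)).
Definition rot_up : {perm 'I_n.+1} := perm (can_inj (@ordSK n.+1)).

Lemma rot_down0 : rot_down ord0 = ord_max.
Proof. by apply: val_inj; rewrite permE /= modn_small. Qed.

Lemma rot_up_max : rot_up ord_max = ord0.
Proof. by apply: val_inj; rewrite permE /= modnn. Qed.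

Lemma rot_downK : (rot_down * rot_up = 1)%g.
Proof. by apply/permP => i; rewrite permM !permE ord_predK. Qed.

Lemma rot_upK : (rot_up * rot_down = 1)%g.
Proof. by apply/permP => i; rewrite permM !permE ordSK. Qed.

Lemma rot_down_val i : i != ord0 -> (rot_down i).+1 = i.
Proof.
rewrite -val_eqE /= -lt0n => i0.
have ni := ltn_ord i; rewrite permE /=.
rewrite (_ : _.-1 = i.-1 + n.+1); last by move: i0; lia.
by rewrite modnDr modn_small ?prednK // ltnW.
Qed.

Definition first (p : {perm 'I_n.+1}) := (p^-1)%g ord0.
Definition final (p : {perm 'I_n.+1}) := (p^-1)%g ord_max.

Definition set_base (b : {ffun 'I_n.+1 -> 'I_K}) i v : {ffun 'I_n.+1 -> 'I_K} :=
  [ffun k => if k == i then insubd (b k) v else b k].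

(** The other simplex on the facet opposite vertex [j]. Omitting the first vertex moves the base one
    step along the first direction, which becomes the last one; omitting the last vertex undoes such
    a move; omitting an inner vertex swaps the two increments around it. The result is meaningful
    off [top] and [bottom] only. *)
Definition pivot z : simplex n.+1 * 'I_n.+2 :=
  let: ((b, p), j) := z in
  if j == ord0 then ((set_base b (first p) (b (first p)).+1, (p * rot_down)%g), ord_max)
  else if j == ord_max then ((set_base b (final p) (b (final p)).-1, (p * rot_up)%g), ord0)
  else ((b, (p * tperm (inord j.-1) (inord j))%g), j).

(** The facets on the boundary of the large cube, where there is nothing to pivot into: on [bottom]
    the coordinate incremented last stays 0, on [top] the one incremented first has already reached
    [K]. *)
Definition bottom z := (z.2 == ord_max) && (z.1.1 (final z.1.2) == 0 :> nat).
Definition top z := (z.2 == ord0) && ((z.1.1 (first z.1.2)).+1 == K).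

Lemma first_down p : final (p * rot_down) = first p.
Proof. by rewrite /final /first invMg permM -rot_down0 permK. Qed.

Lemma final_up p : first (p * rot_up) = final p.
Proof. by rewrite /final /first invMg permM -rot_up_max permK. Qed.

Lemma set_baseK b i v : v < K -> set_base (set_base b i v) i (b i) = b.
Proof.
move=> vK; apply/ffunP => k; rewrite !ffunE; case: eqP => // ->.
by apply: val_inj; rewrite val_insubd ltn_ord.
Qed.

Lemma pivot_first b p (j : 'I_n.+2) : j = ord0 -> ~~ top ((b, p), j) ->
  (b (first p)).+1 < K.
Proof. by move=> ->; rewrite /top eqxx /= => h; rewrite ltn_neqAle h ltn_ord. Qed.

Lemma pivot_final b p (j : 'I_n.+2) : j = ord_max -> ~~ bottom ((b, p), j) ->
  0 < b (final p).
Proof. by move=> ->; rewrite /bottom eqxx /= lt0n. Qed.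

Lemma max_neq0 : (ord_max == ord0 :> 'I_n.+2) = false. Proof. by []. Qed.

Lemma pivotK z : ~~ top z -> ~~ bottom z -> pivot (pivot z) = z.
Proof.
case: z => [[b p] j] nt nb; rewrite /pivot.
case: (eqVneq j ord0) => [j0|j0].
  have h := pivot_first j0 nt.
  rewrite max_neq0 eqxx first_down -mulgA rot_downK mulg1 j0; congr (_, _, _).
  by rewrite ffunE eqxx val_insubd h /= set_baseK.
case: (eqVneq j ord_max) => [jN|jN].
  have h := pivot_final jN nb.
  rewrite eqxx final_up -mulgA rot_upK mulg1 jN; congr (_, _, _).
  rewrite ffunE eqxx val_insubd (leq_ltn_trans (leq_pred _)) ?ltn_ord //.
  by rewrite prednK // set_baseK // (leq_ltn_trans (leq_pred _)).
by rewrite (negbTE j0) (negbTE jN) -mulgA tperm2 mulg1.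
Qed.

Lemma pivot_neq z : ~~ top z -> ~~ bottom z -> pivot z != z.
Proof.
case: z => [[b p] j] nt nb; rewrite /pivot.
case: (eqVneq j ord0) => [->|j0]; first by apply/eqP => -[].
case: (eqVneq j ord_max) => [->|jN]; first by apply/eqP => -[].
apply/eqP => -[]; rewrite -[X in _ = X]mulg1 => /mulgI.
move=> /permP/(_ (inord j)); rewrite tpermR perm1 => /(congr1 val) /=.
have j0' : 0 < j by rewrite lt0n -(inj_eq val_inj) in j0 *.
have jN' : j < n.+1 by rewrite ltn_neqAle -ltnS ltn_ord andbT -(inj_eq val_inj) in jN *.
by rewrite !inordK ?(leq_ltn_trans (leq_pred _)) //; case: (nat_of_ord j) j0' => // k _ /= /n_Sn.
Qed.

Lemma pivot_interior z : ~~ top z -> ~~ bottom z ->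
  ~~ top (pivot z) && ~~ bottom (pivot z).
Proof.
case: z => [[b p] j] nt nb; rewrite /pivot /top /bottom.
case: (eqVneq j ord0) => [j0|j0] /=.
  rewrite eqxx /= first_down ffunE eqxx val_insubd.
  by rewrite (pivot_first j0 nt).
case: (eqVneq j ord_max) => [jN|jN] /=.
  rewrite /= final_up ffunE eqxx val_insubd andbT.
  have h := pivot_final jN nb.
  rewrite (leq_ltn_trans (leq_pred _)) ?ltn_ord // prednK //.
  by rewrite neq_ltn ltn_ord.
by rewrite (negbTE j0) (negbTE jN).
Qed.

Lemma pivot_vertex z (m : 'I_n.+2) : ~~ top z -> ~~ bottom z -> m != z.2 ->
  exists2 m' : 'I_n.+2, m' != (pivot z).2 & vertex (pivot z).1 m' = vertex z.1 m.
Proof.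
case: z => [[b p] j] nt nb /=; rewrite /pivot.
case: (eqVneq j ord0) => [j0|j0] /=.
  have h := pivot_first j0 nt; rewrite j0 => m0.
  have m0' : 0 < m by rewrite lt0n -(inj_eq val_inj) in m0 *.
  have mn : m.-1 < n.+1 by have := ltn_ord m; rewrite -{1}(prednK m0').
  (* The new base is the old vertex 1, so the indices drop by one. *)
  exists (inord m.-1).
    by rewrite -(inj_eq val_inj) /= inordK ?neq_ltn ?mn // leqW.
  apply: eq_vertex => i; have [iN|iN] := ltnP i n.+1; last by rewrite !vertex_out.
  have -> : i = Ordinal iN by []; move: (Ordinal iN) => {iN}i.
  rewrite !vertexE /= inordK ?(leqW mn) // ffunE permM.
  have [->|ip] := eqVneq i (first p).
    rewrite val_insubd h /first permKV rot_down0 /= m0' ltnNge.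
    by rewrite -ltnS mn addn0 addn1.
  congr (_ + _); have pi0 : p i != ord0.
    by apply: contra ip => /eqP e; rewrite /first -e permK.
  by rewrite -(rot_down_val pi0) -{2}(prednK m0') ltnS.
case: (eqVneq j ord_max) => [jN|jN] /=.
  have h := pivot_final jN nb; rewrite jN => mN.
  have mn : m < n.+1 by rewrite ltn_neqAle -ltnS ltn_ord andbT -(inj_eq val_inj) in mN *.
  exists (inord m.+1).
    by rewrite -(inj_eq val_inj) /= inordK.
  apply: eq_vertex => i; have [iN|iN] := ltnP i n.+1; last by rewrite !vertex_out.
  have -> : i = Ordinal iN by []; move: (Ordinal iN) => {iN}i.
  rewrite !vertexE /= inordK // ffunE permM.
  have [->|ip] := eqVneq i (final p).
    rewrite val_insubd (leq_ltn_trans (leq_pred _)) // /final permKV rot_up_max /=.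
    by rewrite addn1 prednK // ltnNge -ltnS mn addn0.
  congr (_ + _); have pi0 : rot_up (p i) != ord0.
    apply: contra ip; rewrite -rot_up_max (inj_eq perm_inj) => /eqP e.
    by rewrite /final -e permK.
  have e : rot_down (rot_up (p i)) = p i by rewrite -permM rot_upK perm1.
  by rewrite -(rot_down_val pi0) e ltnS.
move=> mj; exists m => //.
apply: eq_vertex => i; have [iN|iN] := ltnP i n.+1; last by rewrite !vertex_out.
have -> : i = Ordinal iN by []; move: (Ordinal iN) => {iN}i.
have j0' : 0 < j by rewrite lt0n -(inj_eq val_inj) in j0 *.
have jN' : j < n.+1 by rewrite ltn_neqAle -ltnS ltn_ord andbT -(inj_eq val_inj) in jN *.
have mj' : (m == j :> nat) = false by apply/negbTE.
rewrite !vertexE /= permM; congr (_ + _).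
have jp : j.-1 < n.+1 by rewrite (leq_ltn_trans (leq_pred _)).
by case: tpermP => [->|->|_ _] //; rewrite !inordK //; congr nat_of_bool;
  move: mj' j0'; lia.
Qed.

End pivot.

Section parity.
Variables (D : nat) (lam : (nat -> nat) -> nat).
(** Sperner's boundary conditions on a cube. The first one is also used at indices [i] beyond the
    dimension of a simplex: the padded coordinates vanish there, which bounds the labels by the
    dimension. *)
Hypothesis lam0 : forall x i, i <= D -> x i = 0 -> lam x <= i.
Hypothesis lamK : forall x i, i < D -> x i = K -> lam x != i.

Lemma door_pivot n (z : simplex n.+1 * 'I_n.+2) : ~~ top z -> ~~ bottom z ->
  door lam z -> door lam (pivot z).
Proof.
move=> nt nb; case e : z (nt) (nb) => [x j] xt xb /doorP d.
rewrite [pivot _]surjective_pairing; apply/doorP => c cN.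
have [m mj <-] := d _ cN; have [//|m' m'j e'] := @pivot_vertex n (x, j) m xt xb.
by exists m' => //; rewrite e'.
Qed.

Lemma door_top n (z : simplex n.+1 * 'I_n.+2) : n < D -> door lam z -> ~~ top z.
Proof.
case: z => [[b p] j] nD /doorP d; rewrite /top /=; apply/negP => /andP[/eqP j0 /eqP e].
have [m] := d (first p) (ltn_ord _); rewrite j0 => m0; apply/eqP/lamK.
  exact: leq_trans (ltn_ord _) nD.
rewrite vertexE /= /first permKV /= lt0n.
by rewrite (_ : (m != 0 :> nat)) // addn1.
Qed.

(** A door carries the label [n], while on the face [x (final p) = 0] all labels are at most
    [final p]. *)
Lemma door_bottom n (b : {ffun 'I_n.+1 -> 'I_K}) p (j : 'I_n.+2) : n <= D -> 
  door lam ((b, p), j) -> bottom ((b, p), j) -> final p = ord_max.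
Proof.
move=> nD /doorP d; rewrite /bottom /= => /andP[/eqP jN /eqP e].
have [m] := d n (ltnSn n); rewrite jN => mN mn; apply: val_inj => /=.
apply/eqP; rewrite eqn_leq -ltnS ltn_ord /= -{1}mn lam0 //.
  by apply: leq_trans nD; rewrite -ltnS ltn_ord.
have mn' : m < n.+1 by rewrite ltn_neqAle -ltnS ltn_ord andbT -(inj_eq val_inj) in mN *.
by rewrite vertexE /= /final permKV e /= ltnNge -ltnS mn'.
Qed.

(** The new coordinate starts at 0 and is incremented last, so the lifted simplex has the old one as
    its facet in the face where the new coordinate vanishes. *)
Definition lift_simplex (K0 : 0 < K) n (x : simplex n) : simplex n.+1 :=
  ([ffun i => if unlift ord_max i is Some i' then x.1 i' else Ordinal K0],
   lift_perm ord_max ord_max x.2).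

Lemma lift_vertex (K0 : 0 < K) n (x : simplex n) m : m <= n ->
  vertex (lift_simplex K0 x) m = vertex x m.
Proof.
move=> mn; apply: eq_vertex => i; have [iN|iN] := ltnP i n; last first.
  rewrite (vertex_out _ _ iN); move: iN; rewrite leq_eqVlt => /orP[/eqP <-|iN].
    rewrite (vertexE _ _ (@ord_max n)) /= ffunE unlift_none lift_perm_id /=.
    by rewrite ltnNge mn.
  by rewrite vertex_out.
have -> : i = Ordinal iN by []; move: (Ordinal iN) => {iN}i.
have e : lift ord_max i = i :> nat by rewrite lift_max.
rewrite -{1}e !vertexE /= ffunE liftK lift_perm_lift; congr (_ + (_ < _)).
by rewrite lift_max.
Qed.

Lemma lift_simplex_inj (K0 : 0 < K) n : injective (@lift_simplex K0 n).
Proof.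
move=> [b p] [b' p'] [/ffunP eb ep]; congr pair.
  by apply/ffunP => i; have := eb (lift ord_max i); rewrite !ffunE liftK.
apply/permP => i; have /permP/(_ (lift ord_max i)) := ep.
by rewrite !lift_perm_lift => /lift_inj.
Qed.

Lemma lift_simplex_surj (K0 : 0 < K) n (b : {ffun 'I_n.+1 -> 'I_K}) (p : {perm 'I_n.+1}) :
  b ord_max = 0 :> nat -> p ord_max = ord_max -> exists x, lift_simplex K0 x = (b, p).
Proof.
move=> b0 pN; have pl i : p (lift ord_max i) != ord_max.
  by rewrite -{2}pN (inj_eq perm_inj) eq_sym neq_lift.
have q_inj : injective (fun i => odflt i (unlift ord_max (p (lift ord_max i)))).
  move=> i i' /=; have := pl i; rewrite eq_sym => /unlift_some[k ek ->].
  have := pl i'; rewrite eq_sym => /unlift_some[k' ek' -> /= kk'].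
  by apply: (@lift_inj _ ord_max); apply: (@perm_inj _ p); rewrite ek ek' kk'.
exists ([ffun i => b (lift ord_max i)], perm q_inj); congr pair.
  apply/ffunP => i; rewrite ffunE; case: unliftP => [i' ->|->]; first by rewrite ffunE.
  exact/val_inj.
apply/permP => i; case: (unliftP ord_max i) => [i' ->|->]; last by rewrite lift_perm_id pN.
rewrite lift_perm_lift permE; have := pl i'; rewrite eq_sym => /unlift_some[k ek ->] /=.
by rewrite ek.
Qed.

(** Induction on the dimension. The full simplices are counted modulo 2 by the doors. Interior doors
    are paired by [pivot], no door lies on [top], and the doors on [bottom] are exactly the lifted
    full simplices of the previous dimension. *)
Lemma odd_fulls (K0 : 0 < K) N : N <= D -> odd #|fulls lam N|.
Proof.
elim: N => [|n IH] nD.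
  have -> : fulls lam 0 = [set: simplex 0].
    apply/setP => x; rewrite !inE; apply/fullP => c; rewrite leqn0 => /eqP ->.
    exists ord0; apply/eqP; rewrite -leqn0 lam0 //.
    by rewrite vertex_out.
  by rewrite cardsT card_prod card_ffun !card_ord expn0 mul1n card_Sn.
have lamN m (x : simplex m) j : m <= D -> lam (vertex x j) <= m.
  by move=> mD; apply: lam0 => //; rewrite vertex_out.
rewrite -odd_doors => [|x j]; last exact: lamN.
rewrite -(cardsID [set z | bottom z] (doors lam n.+1)) oddD.
set A := _ :&: _; set B := _ :\: _.
have -> : odd #|B| = false.
  have Btop z : z \in B -> ~~ top z.
    by rewrite !inE => /andP[_]; exact: door_top.
  have Bbot z : z \in B -> ~~ bottom z by rewrite !inE => /andP[].
  apply/negbTE/(@involution_even _ B (@pivot n)) => z zB.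
  - have /andP[_ nb] := pivot_interior (Btop z zB) (Bbot z zB).
    rewrite !inE nb /= door_pivot ?Btop ?Bbot //.
    by move: zB; rewrite !inE => /andP[].
  - by rewrite pivotK ?Btop ?Bbot.
  - by rewrite pivot_neq ?Btop ?Bbot.
rewrite addbF; have := IH (ltnW nD).
rewrite -(@card_imset _ _ (fun x => (lift_simplex K0 x, @ord_max n.+1))); last first.
  by move=> x y e; apply: (@lift_simplex_inj K0); exact: (congr1 fst e).
congr (odd _); apply: eq_card => z; rewrite !inE.
apply/imsetP/andP => [[x + ->]|[]].
  rewrite inE => /fullP xf; split; last first.
    rewrite /bottom eqxx /= (_ : final _ = ord_max).
      by rewrite ffunE unlift_none.
    by apply: (@perm_inj _ (lift_perm ord_max ord_max x.2)); rewrite permKV lift_perm_id.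
  apply/doorP => c cn; have [m <-] := xf _ (cn : c <= n).
  exists (widen_ord (leqnSn _) m); last by rewrite lift_vertex //= -ltnS ltn_ord.
  by rewrite -(inj_eq val_inj) /= neq_ltn ltn_ord.
case: z => [[b p] j] d bz; have pN := door_bottom (ltnW nD) d bz.
move: bz; rewrite /bottom /= => /andP[/eqP jN /eqP b0].
rewrite jN in d *.
have [||x xE] := @lift_simplex_surj K0 n b p.
- by rewrite -pN.
- by rewrite -{1}pN /final permKV.
exists x; rewrite ?xE // inE; apply/fullP => c cn.
have /doorP/(_ _ (cn : c < n.+1))[m mN <-] := d.
have mn' : m < n.+1 by rewrite ltn_neqAle -ltnS ltn_ord andbT -(inj_eq val_inj) in mN *.
by exists (Ordinal mn'); rewrite -xE lift_vertex.
Qed.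

End parity.

End Sperner.

Lemma sperner_cell (K D : nat) (lam : (nat -> nat) -> nat) : 0 < K ->
  (forall x i, i <= D -> x i = 0 -> lam x <= i) ->
  (forall x i, i < D -> x i = K -> lam x != i) ->
  exists b : nat -> nat, (forall i, i < D -> b i < K) /\
    forall c, c <= D -> exists v, [/\ lam v = c, forall i, b i <= v i <= (b i).+1
      & forall i, i < D -> v i <= K].
Proof.
move=> K0 lam0 lamK; have := odd_fulls lam0 lamK K0 (leqnn D).
have [->|[x]] := set_0Vmem (fulls K lam D); first by rewrite cards0.
rewrite inE => /fullP xf _.
exists (fun i => if insub i is Some i' then x.1 i' : nat else 0); split => [i iD|c cD].
  by rewrite insubT /=.
have [m <-] := xf c cD; exists (vertex x m); split => // i.
  rewrite /vertex; case: insubP => [i' _ _|_]; last by [].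
  by case: (_ < _); rewrite ?addn0 ?addn1 leqnn ?leqnSn.
move=> iD; rewrite /vertex insubT /=.
by rewrite (leq_trans (leq_add (leqnn _) (leq_b1 _))) // addn1.
Qed.

Local Open Scope classical_set_scope.
Local Open Scope ring_scope.

(** * Fibres of continuous maps from a cube *)

Lemma coord_le_norm (R : realType) m n (x : 'M[R]_(m, n)) i j : `|x i j| <= `|x|.
Proof.
rewrite [leRHS]/Num.norm /= mx_normrE; apply/bigmax_geP; right => /=.
by exists (i, j).
Qed.

Lemma mx_norm_le (R : realType) m n (x : 'M[R]_(m, n)) (e : R) : 0 <= e ->
  (forall i j, `|x i j| <= e) -> `|x| <= e.
Proof.
move=> e0 h; rewrite [leLHS]/Num.norm /= mx_normrE.
by apply/bigmax_leP; split => // -[i j] _ /=; exact: h.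
Qed.

Lemma uniform_continuity (R : realType) (V W : normedModType R) (f : V -> W) (A : set V)
    (e : R) : continuous f -> compact A -> 0 < e ->
  exists2 d : R, 0 < d & forall x y, A x -> `|x - y| < d -> `|f x - f y| < e.
Proof.
move=> cf /compact_near_coveringP cA e0.
pose P (d : R) (x : V) := forall y, `|x - y| < d -> `|f x - f y| < e.
have : \forall d \near 0^'+, A `<=` P d.
  apply: cA => x _; have e2 : 0 < e / 2 by rewrite divr_gt0.
  have /cvgrPdist_lt/(_ _ e2) := cf x.
  move=> /nbhs_ballP[d /= d0 dP].
  exists (ball x (d / 2), [set a | a < d / 2]); first split => /=.
  - by apply: nbhsx_ballx; rewrite divr_gt0.
  - by apply: nbhs_right_lt; rewrite divr_gt0.
  case=> x' a [/=]; rewrite -ball_normE /= => xx' ad y x'y.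
  have h1 := dP x'; have h2 := dP y.
  rewrite -ball_normE /= in h1 h2.
  have xy : `|x - y| < d.
    rewrite -(subrKA x') (splitr d) (le_lt_trans (ler_normD _ _)) // ltrD //.
    exact: lt_trans ad.
  rewrite -(subrKA (f x)) (splitr e) (le_lt_trans (ler_normD _ _)) // ltrD //.
    by rewrite distrC h1 // (lt_trans xx') // ltr_pdivrMr // ltr_pMr // ltr1n.
  exact: h2.
move=> H; near (0 : R)^'+ => d; exists d => [|x y Ax]; first by [].
have AP : A `<=` P d by near: d.
exact: AP.
Unshelve. all: by end_near.
Qed.

Section poincare_miranda.
Variables (R : realType) (D : nat).
Let I := [set x : 'rV[R]_D | forall k, `|x ord0 k| <= 1].

Let grid K (v : nat -> nat) : 'rV[R]_D :=
  \row_i (-1 + 2 * (minn (v i) K)%:R / K%:R).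

Let grid_in K v : (0 < K)%N -> I (grid K v).
Proof.
move=> K0 k; rewrite mxE.
have h : 0 <= ((minn (v k) K)%:R / K%:R : R) <= 1.
  by rewrite divr_ge0 //= ler_pdivrMr ?ltr0n // mul1r ler_nat geq_minr.
by rewrite ler_norml; move: h; set u := _ / _; rewrite -mulrA -/u => /andP[? ?]; apply/andP; split; lra.
Qed.

(** A grid point is labelled by the least [i] with [g i < 0], or by [D] if there is none. A cell
    with all labels has a vertex where every [g i] is nonnegative and, within distance [d] of it,
    for each [i] a vertex where [g i] is negative; the modulus [e] then bounds [g i] at the first
    vertex. *)
Lemma approx_zero (g : 'I_D -> 'rV[R]_D -> R) (d e : R) : 0 < d ->
  (forall i x, I x -> x ord0 i = -1 -> g i x < 0) ->
  (forall i x, I x -> x ord0 i = 1 -> 0 < g i x) ->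
  (forall i x y, I x -> I y -> `|x - y| < d -> `|g i x - g i y| < e) ->
  exists2 x, I x & forall i, `|g i x| < e.
Proof.
move=> d0 g0 g1 gu; pose K := (Num.truncn (2 / d)).+1.
have K0 : (0 < K)%N by [].
have Kd : 2 / K%:R < d.
  by rewrite ltr_pdivrMr ?ltr0n // mulrC -ltr_pdivrMr // truncnS_gt.
pose neg v := fun i => g i (grid K v) < 0.
pose lam v := find (neg v) (enum 'I_D).
have lam_le v (i : 'I_D) : neg v i -> (lam v <= i)%N.
  by apply: contraTT; rewrite -ltnNge => /(before_find i); rewrite nth_ord_enum => ->.
have lamD v : (lam v <= D)%N by rewrite (leq_trans (find_size _ _)) // size_enum_ord.
have neg_lam v (i : 'I_D) : lam v = i -> neg v i.
  move=> e'; have : has (neg v) (enum 'I_D) by rewrite has_find -/(lam v) e' size_enum_ord.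
  by move=> /(nth_find i); rewrite -/(lam v) e' nth_ord_enum.
have [||b [bK bP]] := @sperner_cell K D lam K0.
- move=> v i; rewrite leq_eqVlt => /orP[/eqP -> _ //|iD vi].
  apply: (lam_le _ (Ordinal iD)); apply: g0; first exact: grid_in.
  by rewrite mxE /= vi min0n mulr0 mul0r addr0.
- move=> v i iD vi; apply/negP => /eqP /(neg_lam _ (Ordinal iD)).
  apply/negP; rewrite /neg -leNgt ltW // g1 //; first exact: grid_in.
  rewrite mxE /= vi minnn mulfK ?pnatr_eq0 //; lra.
have [w [wD wb wK]] := bP D (leqnn D).
exists (grid K w); first exact: grid_in.
move=> i; have [v [/neg_lam vi vb vK]] := bP i (ltnW (ltn_ord i)).
have gw : 0 <= g i (grid K w).
  rewrite leNgt; apply/negP => /lam_le; apply/negP.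
  by rewrite wD -ltnNge ltn_ord.
have : `|grid K v - grid K w| < d.
  apply: le_lt_trans Kd; apply: mx_norm_le => [|k j]; first by rewrite divr_ge0.
  rewrite !mxE opprD addrACA subrr add0r -mulrBl -mulrBr normrM normrM.
  rewrite ger0_norm // (ger0_norm (_ : 0 <= K%:R^-1)) ?invr_ge0 //.
  rewrite ler_wpM2r ?invr_ge0 // ler_piMr //.
  rewrite !(minn_idPl _) ?vK ?wK //.
  have /andP[v1 v2] := vb j; have /andP[w1 w2] := wb j.
  rewrite ler_distl; apply/andP; split.
    by rewrite lerBlDr -[X in _ + X]/(1%:R) -natrD ler_nat addn1 (leq_trans w2).
  by rewrite -[X in _ + X]/(1%:R) -natrD ler_nat addn1 (leq_trans v2).
move=> /(gu i _ _ (grid_in _ K0) (grid_in _ K0)); rewrite distrC ger0_norm ?subr_ge0.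
  by move: gw vi; rewrite /neg => ? ? ?; rewrite ger0_norm //; lra.
by rewrite (le_trans (ltW vi)).
Qed.

End poincare_miranda.

Section distance_to_set.
Variables (R : realType) (V : normedModType R) (S : set V).

Definition set_dist (y : V) : R := inf [set `|y - z| | z in S].

Hypothesis S0 : S !=set0.

Lemma set_dist_le y z : S z -> set_dist y <= `|y - z|.
Proof.
move=> Sz; apply: ge_inf; last by exists z.
by exists 0 => _ [u _ <-].
Qed.

Lemma set_dist_ge y c : (forall z, S z -> c <= `|y - z|) -> c <= set_dist y.
Proof.
move=> h; apply: lb_le_inf; first by case: S0 => z Sz; exists `|y - z|, z.
by move=> _ [z Sz <-]; exact: h.
Qed.

Lemma set_dist_lip y y' : `|set_dist y - set_dist y'| <= `|y - y'|.
Proof.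
have h u u' : set_dist u - `|u - u'| <= set_dist u'.
  apply: set_dist_ge => z Sz; rewrite lerBlDl.
  by rewrite (le_trans (set_dist_le u Sz)) // -(subrKA u' u) ler_normD.
rewrite ler_distl; have := h y y'; have := h y' y; rewrite (distrC y' y) => ? ?.
by apply/andP; split; lra.
Qed.

End distance_to_set.

(* The functions [h_i = dist(., f A_i) - dist(., f B_i)], with [A_i] and [B_i]
   opposite faces, are Lipschitz; if no fibre meets both faces, [h o f] covers a
   neighbourhood of [0] in [R^N] by Poincare-Miranda, but factors through [R^n]. *)
Theorem fibre_joins_faces (R : realType) (n N : nat) (f : 'rV[R]_N -> 'rV[R]_n) :
  (n < N)%N -> continuous f ->
  exists (a b : 'rV[R]_N) (i : 'I_N), [/\ forall k, `|a ord0 k| <= 1, forall k, `|b ord0 k| <= 1,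
    a ord0 i = -1, b ord0 i = 1 & f a = f b].
Proof.
move=> nN cf; apply: contrapT => no.
pose I := [set x : 'rV[R]_N | forall k, `|x ord0 k| <= 1].
pose A i := [set x | I x /\ x ord0 i = -1].
pose B i := [set x | I x /\ x ord0 i = 1].
have cI : compact I.
  rewrite (_ : I = [set t | forall i, (`[-1, 1]%classic : set R) (t ord0 i)]); last first.
    by apply/seteqP; split => t /= h i; move: (h i); rewrite in_itv /= ler_norml.
  by apply: (@rV_compact R N (fun=> `[-1, 1]%classic)) => i; exact: segment_compact.
have coord_cont i : continuous (fun x : 'rV[R]_N => x ord0 i).
  exact: coord_continuous.
have face_compact i (c : R) : compact [set x | I x /\ x ord0 i = c].
  apply: (subclosed_compact _ cI); last by move=> x [].
  apply: closedI; first exact: compact_closed (@norm_hausdorff _ _) cI.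
  exact: (closed_comp (fun x _ => coord_cont i x) (@closed_eq R c)).
have face0 i (c : R) : `|c| <= 1 -> [set x | I x /\ x ord0 i = c] !=set0.
  by move=> c1; exists (const_mx c); split=> [k|]; rewrite mxE.
have /fin_all_exists[del delP] : forall i, exists d : R, 0 < d /\
    forall a b, A i a -> B i b -> d <= `|f a - f b|.
  move=> i; pose F (p : 'rV[R]_N * 'rV[R]_N) := `|f p.1 - f p.2|.
  have [||[a b]] := @compact_EVT_min _ R F (A i `*` B i) _
      (compact_setX (face_compact i _) (face_compact i _)).
  - have [a Aa] := face0 i (-1) (eq_ind_r (fun u => u <= 1) (lexx 1) (normrN1 R)).
    have [b Bb] := face0 i 1 (eq_ind_r (fun u => u <= 1) (lexx 1) (normr1 R)).
    by exists (a, b).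
  - apply: continuous_subspaceT => p; apply: continuous_comp; last exact: norm_continuous.
    apply: continuousB; apply: continuous_comp; last exact: cf.
      exact: cvg_fst.
    exact: cf.
    exact: cvg_snd.
  rewrite inE => -[/= [Ia ai] [Ib bi]] minF.
  exists (F (a, b)); split; last first.
    by move=> a' b' Aa' Bb'; apply: (minF (a', b')); rewrite inE.
  rewrite normr_gt0 subr_eq0; apply/eqP => e; apply: no.
  by exists a, b, i; split.
have [d d0 ddel] : exists2 d : R, 0 < d & forall i, d <= del i.
  exists (\big[Num.min/1]_i del i); last by move=> i; exact: bigmin_le.
  by apply: lt_bigmin => // i _; have [] := delP i.
pose h i y := set_dist (f @` A i) y - set_dist (f @` B i) y.
have fA0 i : f @` A i !=set0 by apply: image_nonempty; apply: face0; rewrite normrN1.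
have fB0 i : f @` B i !=set0 by apply: image_nonempty; apply: face0; rewrite normr1.
have hA i x : A i x -> h i (f x) <= - d.
  move=> Ax; have := @set_dist_le _ _ (f @` A i) (f x) (f x) (imageP f Ax).
  rewrite subrr normr0 => h1.
  have : d <= set_dist (f @` B i) (f x).
    apply: set_dist_ge => // _ [b Bb <-].
    by rewrite (le_trans (ddel i)) //; have [_] := delP i; exact.
  by rewrite /h => ?; lra.
have hB i x : B i x -> d <= h i (f x).
  move=> Bx; have := @set_dist_le _ _ (f @` B i) (f x) (f x) (imageP f Bx).
  rewrite subrr normr0 => h1.
  have : d <= set_dist (f @` A i) (f x).
    apply: set_dist_ge => // _ [a Aa <-].
    by rewrite (le_trans (ddel i)) // distrC; have [_] := delP i; exact.
  by rewrite /h => ?; lra.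
have hlip i y y' : `|h i y - h i y'| <= 2 * `|y - y'|.
  rewrite /h opprD addrACA (le_trans (ler_normD _ _)) // mulr2n mulrDl mul1r lerD //.
    exact: set_dist_lip.
  by rewrite -opprD normrN set_dist_lip.
have [M M0 fM] : exists2 M : R, 0 < M & forall x, I x -> `|f x| <= M.
  have /compact_bounded[M [_ MP]] := continuous_compact (continuous_subspaceT cf) cI.
  exists (`|M| + 1) => [|x Ix]; first by rewrite ltr_wpDl.
  by apply: (MP (`|M| + 1)); [rewrite (le_lt_trans (ler_norm _)) // ltrDl | exists x].
(* A count replaces dimension theory. The [Q ^ N] targets [c q], spaced [d / Q] apart, are each hit
   by [h o f] up to [d / (8 * Q)]. Since [P > 16 * M / d], two points whose images under [f] fall in
   the same of the [m.+1 ^ n] grid cells come from the same target. But [m.+1 ^ n <= P.+1 ^ n * Q ^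
   n < Q * Q ^ n <= Q ^ N], by the choice of [Q]. *)
pose P := (Num.truncn (16 * M / d)).+1; pose Q := (P.+1 ^ n).+1; pose m := (P * Q)%N.
have QR : 0 < Q%:R :> R by rewrite ltr0n.
have mR : 0 < m%:R :> R by rewrite ltr0n.
have e0 : 0 < d / (16 * Q%:R) by rewrite divr_gt0 ?mulr_gt0.
have [eta eta0 etaP] := uniform_continuity cf cI e0.
pose c (q : {ffun 'I_N -> 'I_Q}) i : R := d * (- 2^-1 + (q i)%:R / Q%:R).
have cb q i : - (d / 2) <= c q i <= d / 2.
  have : 0 <= ((q i)%:R / Q%:R : R) <= 1.
    by rewrite divr_ge0 //= ler_pdivrMr // mul1r ler_nat ltnW.
  by rewrite /c; set u := _ / _; move=> /andP[u0 u1]; apply/andP; split; nra.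
have /choice[x xP] : forall q, exists x, I x /\
    forall i, `|h i (f x) - c q i| < d / (8 * Q%:R).
  move=> q; have [|||x Ix xP] :=
    @approx_zero R N (fun i x => h i (f x) - c q i) eta (d / (8 * Q%:R)) eta0.
  - move=> i x Ix xi; have := hA i x (conj Ix xi); have /andP[? ?] := cb q i; lra.
  - move=> i x Ix xi; have := hB i x (conj Ix xi); have /andP[? ?] := cb q i; lra.
  - move=> i x y Ix Iy /(etaP _ _ Ix) fxy; rewrite opprB addrA subrK.
    rewrite (le_lt_trans (hlip _ _ _)) //.
    rewrite (_ : d / (8 * Q%:R) = 2 * (d / (16 * Q%:R))) ?ltr_pM2l //.
    by field; rewrite pnatr_eq0.
  - by exists x.
pose idx (y : 'rV[R]_n) : {ffun 'I_n -> 'I_m.+1} :=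
  [ffun i => inord (Num.truncn ((y ord0 i + M) / (2 * M) * m%:R))].
have idxP y y' : `|y| <= M -> `|y'| <= M -> idx y = idx y' -> `|y - y'| <= 2 * M / m%:R.
  move=> yM y'M /ffunP e; apply: mx_norm_le; first by rewrite divr_ge0 ?mulr_ge0 // ltW.
  move=> k i; rewrite !mxE ord1 {k}; have := e i; rewrite !ffunE => /(congr1 val) /=.
  have bnd (z : 'rV[R]_n) : `|z| <= M -> 0 <= (z ord0 i + M) / (2 * M) * m%:R <= m%:R.
    move=> /(le_trans (coord_le_norm z ord0 i)); rewrite ler_norml => /andP[z1 z2].
    rewrite mulr_ge0 ?divr_ge0 //=; [|lra|lra].
    rewrite ler_piMl // ler_pdivrMr; lra.
  have /andP[y1 y2] := bnd _ yM; have /andP[y1' y2'] := bnd _ y'M.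
  have tr (u : R) : 0 <= u <= m%:R -> (Num.truncn u < m.+1)%N.
    by move=> /andP[u0 um]; rewrite ltnS -(ler_nat R) (le_trans _ um) // truncn_le.
  rewrite !inordK ?tr ?y1 ?y1' // => te.
  have := truncn_itv y1; have := truncn_itv y1'; rewrite te.
  set t : R := _%:R; rewrite -[_.+1%:R]natr1 -/t => /andP[a1 a2] /andP[b1 b2].
  have : `|(y ord0 i + M) / (2 * M) * m%:R - (y' ord0 i + M) / (2 * M) * m%:R| <= 1.
    by rewrite ler_norml; apply/andP; split; lra.
  rewrite -mulrBl -mulrBl opprD addrACA subrr addr0 normrM normrM.
  rewrite (gtr0_norm mR) (gtr0_norm (_ : 0 < (2 * M)^-1)) ?invr_gt0 ?mulr_gt0 //.
  by rewrite -ler_pdivlMr // ler_pdivrMr ?mulr_gt0 // mul1r mulrC.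
have inj : injective (fun q => idx (f (x q))).
  move=> q q' e; have [Ix xq] := xP q; have [Ix' xq'] := xP q'.
  have fxx := idxP _ _ (fM _ Ix) (fM _ Ix') e.
  apply/ffunP => i; apply/val_inj/eqP; rewrite eqn_leq.
  have PM : 16 * M / d < P%:R by exact: truncnS_gt.
  have small : 2 * (2 * M / m%:R) <= d / (4 * Q%:R).
    rewrite /m natrM; have P0 : 0 < P%:R :> R by rewrite ltr0n.
    rewrite (_ : 2 * _ = (16 * M) / (P%:R * (4 * Q%:R))); last first.
      by field; rewrite !pnatr_eq0.
    rewrite invfM mulrA ler_wpM2r ?invr_ge0 ?mulr_ge0 //.
    by rewrite ler_pdivrMr // [leRHS]mulrC -ler_pdivrMr // ltW.
  have key : `|c q i - c q' i| < d / Q%:R.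
    have h1 := xq i; have h2 := xq' i.
    have h3 := le_trans (hlip i (f (x q)) (f (x q'))) (le_trans (ler_wpM2l (ler0n _ 2) fxx) small).
    have e1 : d / (8 * Q%:R) = d / Q%:R / 8 by field; rewrite pnatr_eq0.
    have e2 : d / (4 * Q%:R) = d / Q%:R / 4 by field; rewrite pnatr_eq0.
    have dQ : 0 < d / Q%:R by rewrite divr_gt0.
    move: h1 h2 h3; rewrite e1 e2; move: (h i _) (h i _) (c q i) (c q' i) (d / Q%:R) dQ.
    move=> u v a b t t0.
    rewrite !ltr_norml ler_norml => /andP[a1 a2] /andP[b1 b2] /andP[c1 c2].
    by clear - t0 a1 a2 b1 b2 c1 c2; apply/andP; split; lra.
  have : `|(q i)%:R - (q' i)%:R| < 1 :> R.
    move: key; rewrite /c -mulrBr opprD addrACA subrr add0r -mulrBl normrM normrM.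
    rewrite (gtr0_norm d0) (gtr0_norm (_ : 0 < Q%:R^-1)) ?invr_gt0 //.
    by rewrite ltr_pM2l // gtr_pMl // invr_gt0.
  rewrite ltr_distl => /andP[]; rewrite ltrBlDr -!(natrD _ _ 1) !ltr_nat.
  by rewrite !addn1 !ltnS => -> ->.
have := leq_card _ inj; rewrite !card_ffun !card_ord leqNgt => /negP; apply.
have mQ : (m.+1 <= P.+1 * Q)%N by rewrite /m mulSn -addn1 addnC leq_add2r.
have : (m.+1 ^ n <= (P.+1 * Q) ^ n)%N.
  by case: (n) => // k; rewrite leq_exp2r.
move=> /leq_ltn_trans; apply; rewrite expnMn.
have : (Q ^ n.+1 <= Q ^ N)%N by rewrite leq_pexp2l.
move=> /(leq_trans _); apply; rewrite expnS ltn_pmul2r ?expn_gt0 //.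
Qed.

(** * Bounds on widths *)

Lemma lipschitz_continuous (R : realType) (V W : normedModType R) (F : V -> W) (k : R) :
  0 <= k -> (forall x y, `|F x - F y| <= k * `|x - y|) -> continuous F.
Proof.
move=> k0 h x; apply/cvgrPdist_lt => e e0.
have k1 : 0 < k + 1 by rewrite ltr_wpDl.
have e1 : 0 < e / (k + 1) by rewrite divr_gt0.
near=> y.
rewrite (le_lt_trans (h _ _)) // (@le_lt_trans _ _ ((k + 1) * `|x - y|)) //.
  by rewrite ler_wpM2r // lerDl.
rewrite mulrC -ltr_pdivlMr //.
Unshelve. all: by end_near.
Qed.

Lemma within_continuous_comp (R : realType) (U V W : normedModType R) (X : set V)
    (F : U -> V) (G : V -> W) :
  continuous F -> (forall u, X (F u)) -> {within X, continuous G} -> continuous (G \o F).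
Proof.
move=> cF FX cG u A GA.
have e := nbhs_subspace_in (FX u).
have : within X (nbhs (F u)) (G @^-1` A) by rewrite e; exact: cG GA.
move=> /(cF u) h; change (nbhs u [set v | A (G (F v))]).
exact: (@filterS _ (nbhs u) _ _ _ (fun v (k : X (F v) -> A (G (F v))) => k (FX v)) h).
Qed.

Section clamp.
Variable R : realType.

(** Clamping the coefficients extends the family of bump sums to a continuous map on all of [R ^ N],
    as [fibre_joins_faces] requires, without leaving the class. *)
Definition clamp1 (x : R) : R := Num.max (-1) (Num.min 1 x).

Lemma clamp1_le x : `|clamp1 x| <= 1.
Proof.
rewrite ler_norml /clamp1 le_max lexx /= ge_max ge_min lexx /= andbT; lra.
Qed.

Lemma clamp1_id x : `|x| <= 1 -> clamp1 x = x.
Proof.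
by rewrite ler_norml /clamp1 => /andP[x1 x2]; rewrite (min_idPr x2) (max_idPr x1).
Qed.

Lemma clamp1_lip x y : `|clamp1 x - clamp1 y| <= `|x - y|.
Proof.
wlog xy : x y / x <= y.
  move=> h; have [|/ltW] := leP x y; first exact: h.
  by rewrite distrC (distrC x); exact: h.
rewrite !ler0_norm ?subr_le0 //; rewrite /clamp1.
  by rewrite /Num.max /Num.min; do !case: ifP => //; lra.
by rewrite /Num.max /Num.min; do !case: ifP => //; lra.
Qed.

End clamp.

Lemma clamped_sum_continuous (R : realType) (V : normedModType R) N (Phi : 'I_N -> V) :
  continuous (fun a : 'rV[R]_N => \sum_i clamp1 (a ord0 i) *: Phi i).
Proof.
apply: (@lipschitz_continuous _ _ _ _ (\sum_i `|Phi i|)) => [|x y]; first exact: sumr_ge0.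
rewrite -sumrB mulr_suml (le_trans (ler_norm_sum _ _ _)) // ler_sum // => i _.
rewrite -scalerBl normrZ mulrC ler_wpM2l // (le_trans (clamp1_lip _ _)) //.
by have := coord_le_norm (x - y) ord0 i; rewrite !mxE.
Qed.

Section width_bounds.
Variables (R : realType) (B : normedModType R) (X : set B).

Lemma le_kolmogorov_width n (c : R) :
  (forall e : 'I_n -> B, exists2 x, X x &
     forall a : 'I_n -> R, c <= `|x - \sum_i a i *: e i|) ->
  (c%:E <= kolmogorov_width n X)%E.
Proof.
move=> h; apply: le_ereal_inf_tmp => _ [L [e [_ ->]] <-].
have [x Xx xP] := h e; apply: le_trans (ereal_sup_ubound _); last by exists x.
by apply: le_ereal_inf_tmp => _ [_ [a _ <-] <-]; rewrite lee_fin.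
Qed.

Lemma le_babenko_width n (c : R) :
  (forall Pi : B -> 'rV[R]_n, {within X, continuous Pi} ->
     exists x y, [/\ X x, X y, Pi x = Pi y & c <= `|x - y|]) ->
  (c%:E <= babenko_width n X)%E.
Proof.
move=> h; apply: le_ereal_inf_tmp => _ [Pi /h[x [y [Xx Xy xy cxy]]] <-].
apply: le_trans (ereal_sup_ubound _); last by exists x.
apply: le_trans (ereal_sup_ubound _); last first.
  by exists (x, y) => //; split; split.
by rewrite lee_fin.
Qed.

Lemma babenko_width_le n (c : R) (Pi : B -> 'rV[R]_n) : continuous Pi ->
  (forall x y, X x -> X y -> Pi x = Pi y -> `|x - y| <= c) ->
  (babenko_width n X <= c%:E)%E.
Proof.
move=> cPi h; apply: le_trans (ereal_inf_lbound _) _.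
  by exists Pi => //=; exact: continuous_subspaceT.
apply: ge_ereal_sup => _ [x Xx <-]; apply: ge_ereal_sup.
by move=> _ [[y z] [/= [Xy yx] [Xz zx]] <-]; rewrite lee_fin h // yx zx.
Qed.

Hypothesis infinite_dim : forall n (e : 'I_n -> B), exists u,
  forall a : 'I_n -> R, u <> \sum_i a i *: e i.

Definition independent n (e : 'I_n -> B) :=
  forall a : 'I_n -> R, \sum_i a i *: e i = 0 -> forall i, a i = 0.

Definition in_span n (e : 'I_n -> B) (u : B) :=
  exists a : 'I_n -> R, u = \sum_i a i *: e i.

Lemma independent_extend n (e : 'I_n -> B) u : independent e -> ~ in_span e u ->
  let e' (i : 'I_n.+1) := if unlift ord0 i is Some j then e j else u in
  [/\ independent e', in_span e' u & forall v, in_span e v -> in_span e' v].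
Proof.
move=> ei ue e'; have e'E (a : 'I_n.+1 -> R) :
    \sum_i a i *: e' i = a ord0 *: u + \sum_j a (lift ord0 j) *: e j.
  rewrite big_ord_recl /e' unlift_none; congr (_ + _).
  by apply: eq_bigr => j _; rewrite liftK.
split.
- move=> a; rewrite e'E => h.
  have a0 : a ord0 = 0.
    apply/eqP/negP => /negP a0; apply: ue; exists (fun j => - (a ord0)^-1 * a (lift ord0 j)).
    apply: (scalerI a0); rewrite scaler_sumr.
    move/eqP: h; rewrite addr_eq0 => /eqP ->; rewrite -sumrN; apply: eq_bigr => j _.
    by rewrite scalerA mulrA mulrN divff // mulN1r scaleNr.
  move: h; rewrite a0 scale0r add0r => /ei h i.
  by case: (unliftP ord0 i) => [j ->|->].
- exists (fun i => (i == ord0)%:R); rewrite e'E eqxx scale1r big1 ?addr0 // => j _.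
  by rewrite eq_sym (negbTE (neq_lift _ _)) scale0r.
- move=> v [a ->]; exists (fun i => if unlift ord0 i is Some j then a j else 0).
  rewrite e'E unlift_none scale0r add0r; apply: eq_bigr => j _.
  by rewrite liftK.
Qed.

(** The competing subspaces have dimension exactly [n], so a spanning list that is short or
    dependent is completed by vectors outside the span found so far. *)
Lemma spanning_independent n (s : seq B) : (size s <= n)%N ->
  exists2 e : 'I_n -> B, independent e & forall u, u \in s -> in_span e u.
Proof.
elim: n s => [|n IH] s.
  rewrite leqn0 size_eq0 => /eqP ->; exists (fun=> 0) => //.
  by move=> a _ [].
move=> sn; have [|e ei eP] := IH (behead s); first by rewrite size_behead; case: (size s) sn.
(* [w] is the head of [s] if the span misses it, and otherwise any vector outside the span. *)
have [w wP] : exists w, ~ in_span e w /\ (forall u, u \in s -> ~ in_span e u -> u = w).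
  case: s sn eP => [|u s] _ /= eP.
    by have [w wP] := infinite_dim e; exists w; split => // -[a]; exact: wP.
  have [ue|ue] := pselect (in_span e u).
    have [w wP] := infinite_dim e; exists w; split; first by move=> -[a]; exact: wP.
    by move=> v; rewrite inE => /orP[/eqP ->//|/eP].
  exists u; split => // v; rewrite inE => /orP[/eqP ->//|/eP //].
case: wP => we wP; have [h1 h2 h3] := independent_extend ei we.
eexists; first exact: h1.
move=> u us; have [/h3//|/(wP _ us) ->//] := pselect (in_span e u).
Qed.

Lemma kolmogorov_width_le n (I : finType) (g : I -> B) (c : R) : (#|I| <= n)%N ->
  (forall x, X x -> exists a : I -> R, `|x - \sum_i a i *: g i| <= c) ->
  (kolmogorov_width n X <= c%:E)%E.
Proof.
move=> Nn h; have [|e ei eP] := @spanning_independent n (codom g).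
  by rewrite size_codom.
apply: le_trans (ereal_inf_lbound _) _.
  by exists [set (\sum_i a i *: e i) | a in [set: 'I_n -> R]] => //; exists e.
apply: ge_ereal_sup => _ [x /h[a xa] <-].
apply: (@le_trans _ _ `|x - \sum_i a i *: g i|%:E); last by rewrite lee_fin.
apply: ereal_inf_lbound.
exists (\sum_i a i *: g i) => //.
have /choice[b bP] : forall i, exists b : 'I_n -> R, g i = \sum_k b k *: e k.
  by move=> i; apply: eP; exact: codom_f.
exists (fun k => \sum_i a i * b i k) => //.
under eq_bigr do rewrite scaler_suml.
rewrite exchange_big; apply: eq_bigr => i _ /=.
by rewrite [in RHS]bP scaler_sumr; apply: eq_bigr => k _; rewrite scalerA.
Qed.

End width_bounds.

Section C_cube_width_bounds.
Variables (R : realType) (l : nat) (T : R).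
Local Notation B := (C_cube l T : normedModType R).

Lemma C_cube_sum (I : finType) (a : I -> R) (e : I -> B) t :
  (\sum_i a i *: e i : C_cube l T) t = \sum_i a i * e i t.
Proof. by elim/big_ind2 : _ => // _ x _ y <- <-. Qed.

Lemma C_cube_sub_le (f g : B) t : `|f t - g t| <= `|f - g|.
Proof. exact: (le_max_norm (f - g) t). Qed.

Lemma C_cube_norm_le (f g : B) c : 0 <= c -> (forall t, `|f t - g t| <= c) -> `|f - g| <= c.
Proof. exact: (@max_norm_le _ _ _ (f - g)). Qed.

Lemma babenko_width_points (X : set B) n (I : finType) (p : I -> cube l T) (c : R) :
  (#|I| <= n)%N ->
  (forall f g, X f -> X g -> (forall k, f (p k) = g (p k)) -> `|f - g| <= c) ->
  (babenko_width n X <= c%:E)%E.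
Proof.
move=> Nn h.
apply: (@babenko_width_le _ _ X n c
  (fun f => \row_i (if insub (i : nat) is Some k then f (p (enum_val (k : 'I_#|I|))) else 0))).
  apply: (lipschitz_continuous ler01) => f g; rewrite mul1r; apply: mx_norm_le => // i j; rewrite !mxE.
  case: insubP => [k _ _|_]; first exact: C_cube_sub_le.
  by rewrite subrr normr0.
move=> f g Xf Xg /rowP fg; apply: h => // k.
have := fg (widen_ord Nn (enum_rank k)); rewrite !mxE /=; case: insubP => [k' _ e|].
  by rewrite (_ : k' = enum_rank k) ?enum_rankK //; exact: val_inj.
by rewrite ltn_ord.
Qed.

Section bumps.
Variables (N : nat) (Phi : 'I_N -> B) (z : 'I_N -> cube l T) (b : R).
Hypotheses (b0 : 0 < b) (PhiP : forall i j, Phi i (z j) = b * (i == j)%:R).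

Lemma bump_sum (a : 'I_N -> R) j : (\sum_i a i *: Phi i : C_cube l T) (z j) = a j * b.
Proof.
rewrite C_cube_sum (bigD1 j) //= big1 => [|i ij]; rewrite PhiP ?eqxx ?mulr1 ?addr0 //.
by rewrite (negbTE ij) !mulr0.
Qed.

(** Otherwise the matrix of the values [Phi i (z j)], which is [b%:M] of rank [N], would factor
    through [R ^ n]. *)
Lemma bump_infinite_dim n (e : 'I_n -> B) : (n < N)%N ->
  exists u, forall a : 'I_n -> R, u <> \sum_i a i *: e i.
Proof.
move=> nN; apply: contrapT => no.
have /choice[a aP] : forall c, exists a : 'I_n -> R, Phi c = \sum_i a i *: e i.
  by move=> c; apply: contrapT => h; apply: no; exists (Phi c) => a e'; apply: h; exists a.
pose A := \matrix_(c < N, k < n) a c k; pose E := \matrix_(k < n, c < N) e k (z c).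
have AE : A *m E = b%:M.
  apply/matrixP => c c'; rewrite !mxE -[b *+ _]mulr_natr -PhiP aP C_cube_sum.
  by apply: eq_bigr => k _; rewrite !mxE.
have := mxrankM_maxl A E; rewrite AE -scalemx1 mxrank_scale_nz ?gt_eqF // mxrank1.
by move=> /leq_trans/(_ (rank_leq_col _)); rewrite leqNgt nN.
Qed.

Variable X : set B.
Hypothesis PhiX : forall a : 'I_N -> R, (forall i, `|a i| <= 1) -> X (\sum_i a i *: Phi i).

(* If [y] annihilates the values on [z] of all elements of [L], the signs of [y]
   give an element of [X] at distance at least [b] from [L]. *)
Lemma le_kolmogorov_width_bumps n : (n < N)%N -> (b%:E <= kolmogorov_width n X)%E.
Proof.
move=> nN; apply: le_kolmogorov_width => e.
pose E := \matrix_(k < n, c < N) e k (z c).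
have /rowV0Pn[y /sub_kermxP yE y0] : kermx E^T != 0.
  rewrite -mxrank_eq0 mxrank_ker mxrank_tr -lt0n subn_gt0.
  by rewrite (leq_ltn_trans (rank_leq_row _)).
have [j yj] : exists j, y ord0 j != 0.
  apply: contrapT => no; move/eqP: y0; apply; apply/rowP => j; rewrite mxE.
  by apply: contrapT => yj; apply: no; exists j; exact/eqP.
exists (\sum_i Num.sg (y ord0 i) *: Phi i).
  by apply: PhiX => i; rewrite normr_sg; case: (_ != 0).
move=> a; set F := \sum_i _; set u := \sum_i _.
have yu : \sum_c y ord0 c * u (z c) = 0.
  under eq_bigr do rewrite C_cube_sum mulr_sumr.
  rewrite exchange_big /=; apply: big1 => k _.
  have := congr1 (fun M : 'rV[R]_n => M ord0 k) yE; rewrite !mxE => h.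
  rewrite -[RHS](mulr0 (a k)) -[in RHS]h mulr_sumr; apply: eq_bigr => c _.
  by rewrite !mxE mulrCA.
have S0 : 0 < \sum_c `|y ord0 c|.
  rewrite (bigD1 j) //= ltr_wpDr ?sumr_ge0 // normr_gt0 //.
rewrite -(ler_pM2r S0) mulr_sumr mulr_sumr.
rewrite (_ : \sum_c b * _ = \sum_c y ord0 c * (F (z c) - u (z c))).
  apply: ler_sum => c _; rewrite mulrC.
  rewrite (le_trans (ler_norm _)) // normrM ler_wpM2r //.
  exact: C_cube_sub_le.
under [RHS]eq_bigr do rewrite mulrBr.
rewrite sumrB yu subr0; apply: eq_bigr => c _.
by rewrite bump_sum mulrA [X in X * b]mulrC -normrEsg mulrC.
Qed.

(** Two coefficient vectors of the same fibre on opposite faces differ by 2 in a coordinate [i], so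
    the two functions differ by [2 * b] at [z i]. *)
Lemma le_babenko_width_bumps n : (n < N)%N -> (b%:E <= babenko_width n X)%E.
Proof.
move=> nN; apply: le_babenko_width => Pi cPi.
pose F (a : 'rV[R]_N) : B := \sum_i clamp1 (a ord0 i) *: Phi i.
have FX a : X (F a) by apply: PhiX => i; exact: clamp1_le.
have cF : continuous F by exact: clamped_sum_continuous.
have [a [a' [i [ha ha' ai a'i FF]]]] := fibre_joins_faces nN (within_continuous_comp cF FX cPi).
exists (F a), (F a'); split => //; apply: le_trans (C_cube_sub_le _ _ (z i)).
rewrite !bump_sum !clamp1_id // ai a'i -mulrBl normrM (gtr0_norm b0).
by rewrite ler_peMl ?ltW // ler0_norm; lra.
Qed.

End bumps.
End C_cube_width_bounds.

(** * One-variable Taylor approximation and tensor products *)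

Lemma is_derive_eps (R : realType) (G : R -> R) x d :
  (forall e, 0 < e -> exists2 r, 0 < r & forall h, h != 0 -> `|h| < r ->
     `|(G (h + x) - G x) / h - d| < e) -> is_derive x 1 G d.
Proof.
move=> H; have cv : (fun h => h^-1 *: ((G \o shift x) (h *: 1) - G x)) @ 0^' --> d.
  apply/cvgrPdist_lt => e /H[r r0 rP]; near=> h.
  rewrite distrC /= [h *: 1]mulr1 /GRing.scale /= mulrC rP //.
    by near: h; exact: nbhs_dnbhs_neq.
  by near: h; exact: dnbhs0_lt.
by split; [apply/cvg_ex; exists d | exact: cvg_lim].
Unshelve. all: by end_near.
Qed.

Definition antideriv (R : numFieldType) (p : {poly R}) : {poly R} :=
  \poly_(i < (size p).+1) (p`_i.-1 / i%:R).

Lemma deriv_antideriv (R : numFieldType) (p : {poly R}) : (antideriv p)^`() = p.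
Proof.
apply/polyP => i; rewrite coef_deriv coef_poly ltnS /=.
case: ltnP => ip; last by rewrite mul0rn nth_default.
by rewrite -[_ *+ _]mulr_natr mulfVK // pnatr_eq0.
Qed.

Lemma size_antideriv (R : numFieldType) (p : {poly R}) :
  (size (antideriv p) <= (size p).+1)%N.
Proof. exact: size_poly. Qed.

(** Induction on [s]: approximate the derivative by [q], take the antiderivative of [q] that agrees
    with [G 0] at [a], and apply the mean value theorem to the difference. Each step costs one
    factor [b - a]; the factorial of Taylor's formula is given up. *)
Lemma poly_approx (R : realType) (s : nat) (G : nat -> R -> R) (a b K : R) : a <= b ->
  (forall j x, (j < s)%N -> a <= x <= b -> {for x, continuous (G j)}) ->
  (forall j x, (j < s)%N -> a < x < b -> is_derive x 1 (G j) (G j.+1 x)) ->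
  (forall x, a <= x <= b -> `|G s x| <= K) ->
  exists2 p : {poly R}, (size p <= s)%N &
    forall x, a <= x <= b -> `|G 0%N x - p.[x]| <= K * (b - a) ^+ s.
Proof.
move=> ab; elim: s G => [|s IH] G cG dG GK.
  by exists 0; rewrite ?size_poly0 // => x /GK; rewrite horner0 subr0 expr0 mulr1.
have [j x js| j x js| |q qs qP] := IH (fun j => G j.+1); [exact: cG|exact: dG|exact: GK|].
pose p := antideriv q + (G 0%N a - (antideriv q).[a])%:P.
exists p.
  rewrite /p (leq_trans (size_polyD _ _)) // geq_max (leq_trans (size_antideriv _)) //=.
  exact: leq_trans (size_polyC_leq1 _) _.
have pa : p.[a] = G 0%N a by rewrite hornerD hornerC addrCA subrr addr0.
move=> x /andP[ax xb]; have K0 : 0 <= K by apply: le_trans (GK a _); rewrite ?lexx.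
have [] := @MVT_segment R (G 0%N - horner p) (fun x => G 1%N x - q.[x]) a x ax.
- move=> y; rewrite in_itv /= => /andP[ay yx]; apply: is_deriveB.
    by apply: dG => //; rewrite ay (lt_le_trans yx).
  have -> : q.[y] = p^`().[y] by rewrite derivD derivC addr0 deriv_antideriv.
  exact: is_derive_poly.
- apply: continuous_in_subspaceT => y; rewrite inE /= in_itv /= => /andP[ay yx].
  apply: continuousB; first by apply: cG; rewrite // ay (le_trans yx).
  exact: continuous_horner.
move=> c; rewrite in_itv /= => /andP[ac cx].
rewrite !fctE pa subrr subr0 => ->; rewrite normrM exprSr mulrA ler_pM //.
  by apply: qP; rewrite ac (le_trans cx).
by rewrite ger0_norm ?subr_ge0 // lerB.
Qed.

(** * Restriction to lines parallel to the axes *)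

Section cube_points.
Variables (R : realType) (l : nat) (T : R).
Hypothesis T0 : 0 < T.
Implicit Types (x : 'rV[R]_l) (f : cube l T -> R) (t u : cube l T) (i : 'I_l).

Definition clip (c : R) : R := Num.max 0 (Num.min T c).

Lemma clip_itv c : 0 <= clip c <= T.
Proof. by rewrite /clip le_max lexx /= ge_max (ltW T0) ge_min lexx. Qed.

Lemma clip_id c : 0 <= c <= T -> clip c = c.
Proof. by case/andP=> c0 cT; rewrite /clip (min_idPr cT) (max_idPr c0). Qed.

Lemma clip_lip c d : `|clip c - clip d| <= `|c - d|.
Proof.
wlog cd : c d / c <= d.
  move=> h; have [|/ltW] := leP c d; first exact: h.
  by rewrite distrC (distrC c); exact: h.
have := ltW T0; rewrite !ler0_norm ?subr_le0 //; rewrite /clip.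
  by rewrite /Num.max /Num.min; do !case: ifP => //; lra.
by rewrite /Num.max /Num.min; do !case: ifP => //; lra.
Qed.

Lemma pt_subproof x : cube l T (\row_i clip (x ord0 i)).
Proof. by move=> i; rewrite mxE clip_itv. Qed.

(** A retraction of [R ^ l] onto the cube; [f \o pt T0] extends [f] to all row vectors, so that
    lines can be followed without membership proofs. *)
Definition pt x : cube l T := SigSub (mem_set (pt_subproof x)).

Lemma coord_pt x i : coord (pt x) i = clip (x ord0 i).
Proof. by rewrite /coord /= mxE. Qed.

Lemma coord_itv t i : 0 <= coord t i <= T.
Proof. exact: (set_valP t). Qed.

Lemma cube_eqP t u : (forall i, coord t i = coord u i) -> t = u.
Proof. by move=> h; apply: val_inj; apply/rowP => i; exact: h. Qed.

Lemma val_pt x : cube l T x -> set_val (pt x) = x.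
Proof. by move=> xT; apply/rowP => i; rewrite [LHS]mxE clip_id //; exact: xT. Qed.

Lemma ptK t : pt (set_val t) = t.
Proof. by apply: val_inj; exact: val_pt (set_valP t). Qed.

Definition upd x i c : 'rV[R]_l := \row_j (if j == i then c else x ord0 j).

Lemma coord_upd x i c j : coord (pt (upd x i c)) j =
  if j == i then clip c else coord (pt x) j.
Proof. by rewrite !coord_pt mxE; case: eqP. Qed.

Lemma axis_nbhs_filter i t : Filter (axis_nbhs i t).
Proof. exact: within_filter. Qed.
#[local] Existing Instance axis_nbhs_filter.

Lemma axis_near_ball i t (P : cube l T -> Prop) : (\forall u \near axis_nbhs i t, P u) ->
  exists2 r, 0 < r & forall u, u <> t -> (forall j, j != i -> coord u j = coord t j) ->
    `|coord u i - coord t i| < r -> P u.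
Proof.
move=> /nbhs_ballP[r /= r0 rP]; exists r => // u ut uj ui; apply: rP => //.
rewrite -initial_ballE /= -ball_normE /=.
rewrite (@le_lt_trans _ _ `|coord u i - coord t i|) //.
apply: mx_norm_le => // k j; rewrite ord1 !mxE distrC.
have [->//|ji] := eqVneq j i.
by have := uj j ji; rewrite /coord => ->; rewrite subrr normr0.
Qed.

Lemma axis_cvg_eps f i t L : diff_quotient i f t @ axis_nbhs i t --> L ->
  forall e, 0 < e -> exists2 r, 0 < r & forall u, u <> t ->
    (forall j, j != i -> coord u j = coord t j) -> `|coord u i - coord t i| < r ->
    `|diff_quotient i f t u - L| < e.
Proof.
move=> /cvgrPdist_lt h e /h /axis_near_ball[r r0 rP]; exists r => // u ut uj ui.
by rewrite distrC rP.
Qed.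

Section line.
Variables (f : cube l T -> R) (x : 'rV[R]_l) (i : 'I_l) (c : R).
Hypotheses (c_itv : 0 <= c <= T) (df : partial_derivable i f (pt (upd x i c))).
Let G y := f (pt (upd x i y)).

Let coordc : coord (pt (upd x i c)) i = c.
Proof. by rewrite coord_upd eqxx clip_id. Qed.

Let line_eps (e : R) : 0 < e -> exists2 r, 0 < r & forall y, clip y != c -> `|clip y - c| < r ->
  `|(G y - G c) / (clip y - c) - partial i f (pt (upd x i c))| < e.
Proof.
move=> e0; have [r r0] := axis_cvg_eps df e0; rewrite -/(partial i f _).
move: (partial _ _ _) => L rP; exists r => // y yc ycr.
have := rP (pt (upd x i y)); rewrite /diff_quotient coordc coord_upd eqxx.
apply => //.
- by move=> h; move/eqP: yc; apply; rewrite -coordc -h coord_upd eqxx.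
- by move=> j ji; rewrite !coord_upd (negbTE ji).
Qed.

Lemma line_is_derive : 0 < c < T -> is_derive c 1 G (partial i f (pt (upd x i c))).
Proof.
move=> /andP[c0 cT]; apply: is_derive_eps => e /line_eps[r r0 rP].
exists (Num.min r (Num.min c (T - c))) => [|h h0].
  by rewrite !lt_min r0 c0 subr_gt0.
rewrite !lt_min !ltr_norml => /and3P[hr /andP[h1 h2] /andP[h3 h4]].
have hc : clip (h + c) = h + c by apply: clip_id; apply/andP; split; lra.
have := rP (h + c); rewrite hc addrK => H.
rewrite -ltr_norml; apply: H; last by rewrite ltr_norml.
by rewrite -subr_eq0 addrK.
Qed.

(** Derivability within the cube suffices even at the ends of [[0, T]]: [clip] does not increase
    distances and [G] depends on [clip y] only, so the bounded difference quotient controls both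
    sides. *)
Lemma line_continuous : {for c, continuous G}.
Proof.
apply/cvgrPdist_lt => e e0; have [r r0 rP] := line_eps ltr01.
pose L := `|partial i f (pt (upd x i c))| + 1.
have L0 : 0 < L by rewrite ltr_wpDl.
near=> y; rewrite distrC; have yr : `|y - c| < r.
  by rewrite distrC; near: y; exact: cvgr_dist_lt.
have ye : `|y - c| < e / L.
  by rewrite distrC; near: y; apply: cvgr_dist_lt => //; rewrite divr_gt0.
have yc : `|clip y - c| <= `|y - c| by rewrite -{1}(clip_id c_itv) clip_lip.
have [ycc|ycc] := eqVneq (clip y) c.
  rewrite /G (_ : pt (upd x i y) = pt (upd x i c)) ?subrr ?normr0 //.
  by apply: cube_eqP => j; rewrite !coord_upd ycc (clip_id c_itv).
have := rP y ycc (le_lt_trans yc yr) => h.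
have yc0 : clip y - c != 0 by rewrite subr_eq0.
have hL : `|(G y - G c) / (clip y - c)| < L.
  rewrite /L -(subrK (partial i f (pt (upd x i c))) (_ / _)).
  by rewrite (le_lt_trans (ler_normD _ _)) // addrC ltrD2l.
rewrite -(divfK yc0 (G y - G c)) normrM.
rewrite (@le_lt_trans _ _ (L * `|y - c|)) //; first by rewrite ler_pM // ltW.
by rewrite mulrC -ltr_pdivlMr.
Unshelve. all: by end_near.
Qed.

End line.


Lemma iter_partial_derivable_nseq (A : set (cube l T)) i s f :
  iter_partial_derivable A (nseq s i) f ->
  forall j t, (j < s)%N -> A t -> partial_derivable i (iter_partial (nseq j i) f) t.
Proof.
elim: s => //= s IH [/IH h1 h2] j t; rewrite ltnS leq_eqVlt => /orP[/eqP ->|]; first exact: h2.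
exact: h1.
Qed.

Lemma axis_poly_approx (A : set (cube l T)) f x i s (a b K : R) :
  0 <= a -> a <= b -> b <= T -> iter_partial_derivable A (nseq s i) f ->
  (forall y, a <= y <= b -> A (pt (upd x i y)) /\
     `|iter_partial (nseq s i) f (pt (upd x i y))| <= K) ->
  exists2 p : {poly R}, (size p <= s)%N &
    forall y, a <= y <= b -> `|f (pt (upd x i y)) - p.[y]| <= K * (b - a) ^+ s.
Proof.
move=> a0 ab bT /iter_partial_derivable_nseq df fK.
pose G j y := iter_partial (nseq j i) f (pt (upd x i y)).
apply: (@poly_approx R s G a b K ab).
- move=> j y js yab; apply: line_continuous.
    by case/andP: yab => ? ?; apply/andP; split; lra.
  by apply: df => //; have [] := fK _ yab.
- move=> j y js /andP[ay yb]; apply: line_is_derive; try by apply/andP; split; lra.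
  by apply: df => //; have [] := fK y (introT andP (conj (ltW ay) (ltW yb))).
- by move=> y /fK[].
Qed.

Lemma directions_single i s :
  directions (fun j => if j == i then s else 0%N) = nseq s i.
Proof.
rewrite /directions; have : uniq (enum 'I_l) by exact: enum_uniq.
have : i \in enum 'I_l by rewrite mem_enum.
elim: (enum 'I_l) => // j e IH; rewrite inE => /orP[/eqP <-|ie] /= /andP[je ue].
  rewrite eqxx (_ : flatten _ = [::]) ?cats0 //.
  elim: e je {IH ue} => //= k e IH; rewrite inE negb_or => /andP[ik /IH ->].
  by rewrite eq_sym (negbTE ik).
by rewrite IH //; case: eqP ie je => // -> ->.
Qed.

Lemma mi_order_single i s : mi_order (fun j => if j == i then s else 0%N) = s.
Proof. by rewrite /mi_order -big_mkcond big_pred1_eq. Qed.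

End cube_points.

(** * Tensor products of one-variable functionals *)

Section tensor_functionals.
Variables (R : realType) (l m : nat).
Implicit Types (F : 'rV[R]_l -> R) (x : 'rV[R]_l) (w : seq 'I_l).

(* [fapply c y w F x] applies the functionals [\sum_j c i j * delta_(y i j)] in
   the directions [i] of [w] and evaluates at [x] in the other directions. *)
Fixpoint fapply (c y : 'I_l -> 'I_m -> R) w F x : R :=
  if w is i :: w' then \sum_j c i j * fapply c y w' F (upd x i (y i j)) else F x.

Lemma upd_comm x i k a b : i != k -> upd (upd x i a) k b = upd (upd x k b) i a.
Proof.
move=> ik; apply/rowP => j; rewrite !mxE; have [->|//] := eqVneq j k.
by rewrite eq_sym (negbTE ik).
Qed.

Lemma upd_id x i : upd x i (x ord0 i) = x.
Proof. by apply/rowP => j; rewrite mxE; case: eqP => // ->. Qed.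

Definition in_box (a b : 'I_l -> R) x := forall i, a i <= x ord0 i <= b i.

Lemma in_box_upd a b x i c : in_box a b x -> a i <= c <= b i -> in_box a b (upd x i c).
Proof. by move=> xb cb j; rewrite mxE; case: eqP => // ->. Qed.

(** The multi-indices that vary only in the directions of [w] are encoded as those that agree with
    [nu0] elsewhere; this lets the induction on [w] stay within one finite type. *)
Lemma fapply_expand c y w F x (nu0 : {ffun 'I_l -> 'I_m}) : uniq w ->
  fapply c y w F x =
  \sum_(nu : {ffun 'I_l -> 'I_m} | [forall i, (i \notin w) ==> (nu i == nu0 i)])
     (\prod_(i <- w) c i (nu i)) * F (\row_i (if i \in w then y i (nu i) else x ord0 i)).
Proof.
elim: w x nu0 => [|i w IH] x nu0.
  rewrite (big_pred1 nu0) => [|nu /=]; last first.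
    apply/forallP/eqP => [h|->]; last by move=> k; rewrite eqxx.
    by apply/ffunP => k; apply/eqP; exact: h.
  by move=> _; rewrite big_nil mul1r /=; congr (F _); apply/rowP => k; rewrite mxE.
move=> /= /andP[iw uw]; rewrite [RHS](partition_big (fun nu : {ffun _} => nu i) xpredT) //=.
apply: eq_bigr => j _; rewrite (IH _ [ffun k => if k == i then j else nu0 k]) //.
rewrite mulr_sumr; apply: eq_big => [nu|nu /forallP h].
  apply/forallP/andP => [h|[/forallP h /eqP nuj] k].
    split; last by have := h i; rewrite iw ffunE eqxx.
    apply/forallP => k; rewrite inE negb_or; apply/implyP => /andP[ki kw].
    by have := h k; rewrite kw ffunE (negbTE ki).
  apply/implyP => kw; rewrite ffunE; case: (eqVneq k i) => [->|ki]; first exact/eqP.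
  by have := h k; rewrite inE negb_or ki kw.
have nuj : nu i = j by have := h i; rewrite iw ffunE eqxx => /eqP.
rewrite big_cons nuj mulrA; congr (_ * F _); apply/rowP => k; rewrite !mxE inE.
have [->|ki] := eqVneq k i; first by rewrite (negbTE iw) nuj.
by [].
Qed.

Lemma fapply_enum c y F x (nu0 : {ffun 'I_l -> 'I_m}) :
  fapply c y (enum 'I_l) F x =
  \sum_(nu : {ffun 'I_l -> 'I_m}) (\prod_i c i (nu i)) * F (\row_i y i (nu i)).
Proof.
rewrite (fapply_expand _ _ _ _ nu0) ?enum_uniq //; apply: eq_big => [nu|nu _].
  by apply/forallP => i; rewrite mem_enum.
rewrite big_enum; congr (_ * F _); apply/rowP => i.
by rewrite !mxE mem_enum.
Qed.

Lemma fapplyB c y w F G x :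
  fapply c y w F x - fapply c y w G x = fapply c y w (fun z => F z - G z) x.
Proof.
elim: w x => //= i w IH x; rewrite -sumrB; apply: eq_bigr => j _.
by rewrite -mulrBr IH.
Qed.

Lemma fapply_cst c y w x k : (forall i, \sum_j c i j = 1) ->
  fapply c y w (fun=> k) x = k.
Proof.
move=> c1; elim: w x => //= i w IH x.
by under eq_bigr do rewrite IH; rewrite -mulr_suml c1 mul1r.
Qed.

Section box.
Variables (a b : 'I_l -> R) (Lam : R) (s : nat).
Hypothesis Lam1 : 1 <= Lam.

Let L0 : 0 <= Lam. Proof. exact: le_trans Lam1. Qed.

Definition admissible (c y : 'I_l -> 'I_m -> R) := (forall i, \sum_j `|c i j| <= Lam) /\
  (forall i j, a i <= y i j <= b i).

Definition near_poly i e F := forall x, in_box a b x ->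
  exists2 p : {poly R}, (size p <= s)%N &
    forall t, a i <= t <= b i -> `|F (upd x i t) - p.[t]| <= e.

Let bounded_sum (g h : 'I_m -> R) e : 0 <= e -> \sum_j `|g j| <= Lam ->
  (forall j, `|h j| <= e) -> `|\sum_j g j * h j| <= Lam * e.
Proof.
move=> e0 gL he; rewrite (le_trans (ler_norm_sum _ _ _)) //.
rewrite (@le_trans _ _ (\sum_j `|g j| * e)) //.
  by apply: ler_sum => j _; rewrite normrM ler_wpM2l.
by rewrite -mulr_suml ler_wpM2r.
Qed.

Lemma fapply_bound c y w F e x : admissible c y -> in_box a b x -> 0 <= e ->
  (forall z, in_box a b z -> `|F z| <= e) -> `|fapply c y w F x| <= Lam ^+ size w * e.
Proof.
move=> [cL yb] + e0 Fe; elim: w x => /= [x xb|i w IH x xb]; first by rewrite expr0 mul1r Fe.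
rewrite exprS -mulrA bounded_sum ?mulr_ge0 ?exprn_ge0 // => j.
by apply: IH; exact: in_box_upd.
Qed.

Lemma near_poly_fapply c y w i e F : admissible c y -> 0 <= e -> i \notin w ->
  near_poly i e F -> near_poly i (Lam ^+ size w * e) (fapply c y w F).
Proof.
move=> [cL yb] e0 + Fe; elim: w => [_|k w IH]; first by rewrite expr0 mul1r.
rewrite inE negb_or => /andP[ik iw] x xb.
have /choice[p pP] : forall j, exists p : {poly R}, (size p <= s)%N /\
    forall t, a i <= t <= b i ->
      `|fapply c y w F (upd (upd x k (y k j)) i t) - p.[t]| <= Lam ^+ size w * e.
  by move=> j; have [|p] := IH iw (upd x k (y k j)); [exact: in_box_upd|exists p].
exists (\sum_j c k j *: p j).
  rewrite (leq_trans (size_sum _ _ _)) //; apply/bigmax_leqP => j _.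
  by rewrite (leq_trans (size_scale_leq _ _)) //; have [] := pP j.
move=> t tab; rewrite horner_sum /= -sumrB exprS -mulrA.
under eq_bigr do rewrite hornerZ -mulrBr upd_comm //.
rewrite bounded_sum ?mulr_ge0 ?exprn_ge0 // => j.
by have [_] := pP j; apply.
Qed.

(** The directions are exchanged one at a time. In direction [i] both functionals agree on the
    polynomial close to the line, so only two error terms remain, and the other directions multiply
    them by powers of [Lam]. Hence pure derivatives suffice. The lemma is applied to two
    extrapolations at different scales, and to interpolation against evaluation at a point. *)
Lemma fapply_diff c y c' y' w F e x : admissible c y -> admissible c' y' ->
  (forall i (p : {poly R}), (size p <= s)%N ->
     \sum_j c i j * p.[y i j] = \sum_j c' i j * p.[y' i j]) ->
  0 <= e -> (forall i, near_poly i e F) -> uniq w -> in_box a b x ->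
  `|fapply c y w F x - fapply c' y' w F x| <= 2 * (size w)%:R * Lam ^+ size w * e.
Proof.
move=> A A' cc' e0 Fe; elim: w x => [x _ _|i w IH x /= /andP[iw uw] xb].
  by rewrite subrr normr0 mulr0 !mul0r.
have [p ps pP] := near_poly_fapply A' e0 iw (Fe i) xb.
pose G := fapply c' y' w F.
have -> : \sum_j c i j * fapply c y w F (upd x i (y i j)) -
          \sum_j c' i j * fapply c' y' w F (upd x i (y' i j)) =
   \sum_j c i j * (fapply c y w F (upd x i (y i j)) - G (upd x i (y i j))) +
   (\sum_j c i j * (G (upd x i (y i j)) - p.[y i j]) -
    \sum_j c' i j * (G (upd x i (y' i j)) - p.[y' i j])).
  have E (u v : 'I_m -> R) (z : 'I_m -> R) : \sum_j z j * (u j - v j) =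
      \sum_j z j * u j - \sum_j z j * v j.
    by rewrite -sumrB; apply: eq_bigr => j _; rewrite mulrBr.
  by rewrite !E (cc' i p ps); ring.
case: A A' => [cL yb] [cL' yb'].
set d := Lam ^+ size w * e.
have d0 : 0 <= d by rewrite mulr_ge0 // exprn_ge0.
have h1 : `|\sum_j c i j * (fapply c y w F (upd x i (y i j)) - G (upd x i (y i j)))| <=
    Lam * (2 * (size w)%:R * d).
  apply: bounded_sum => // [|j]; first by rewrite mulr_ge0.
  by rewrite /d !mulrA; apply: IH => //; exact: in_box_upd.
have h2 : `|\sum_j c i j * (G (upd x i (y i j)) - p.[y i j])| <= Lam * d.
  by apply: bounded_sum => // j; exact: pP.
have h3 : `|\sum_j c' i j * (G (upd x i (y' i j)) - p.[y' i j])| <= Lam * d.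
  by apply: bounded_sum => // j; exact: pP.
rewrite (le_trans (ler_normD _ _)) // exprS.
have -> : 2 * (size w).+1%:R * (Lam * Lam ^+ size w) * e =
    Lam * (2 * (size w)%:R * d) + (Lam * d + Lam * d).
  by rewrite /d -natr1; ring.
by rewrite lerD // (le_trans (ler_normB _ _)) // lerD.
Qed.

End box.
End tensor_functionals.

(** * Local polynomial approximation *)

Section lagrange.
Variables (R : realType) (s : nat).
Implicit Types (p : {poly R}) (j k : 'I_s).

(** The nodes stay in the upper half of [[0, 1]]: evaluation at 0 is then a true extrapolation,
    whose nodes keep away from the faces. The same nodes serve for interpolation on the cells. *)
Definition theta j : R := 2^-1 + j%:R / (2 * s%:R).

Lemma theta_itv j : 2^-1 <= theta j <= 1.
Proof.
have sR : 0 < s%:R :> R by rewrite ltr0n (leq_ltn_trans _ (ltn_ord j)).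
have : 0 <= (j%:R / s%:R : R) <= 1.
  by rewrite divr_ge0 //= ler_pdivrMr // mul1r ler_nat ltnW.
rewrite /theta invfM mulrCA; move: (_ / _) => u /andP[? ?].
by apply/andP; split; lra.
Qed.

Lemma theta_inj : injective theta.
Proof.
move=> j k /addrI; have sR : 2 * s%:R != 0 :> R.
  by rewrite mulf_neq0 // pnatr_eq0 -lt0n (leq_ltn_trans _ (ltn_ord j)).
by move=> /(mulIf (invr_neq0 sR))/eqP; rewrite eqr_nat => /eqP/val_inj.
Qed.

Definition lag j : {poly R} :=
  \prod_(k | k != j) ((theta j - theta k)^-1 *: ('X - (theta k)%:P)).

Lemma lag_theta j k : (lag j).[theta k] = (j == k)%:R.
Proof.
rewrite horner_prod; have [->|jk] := eqVneq j k.
  apply: big1 => i ik; rewrite hornerZ hornerXsubC mulVf // subr_eq0.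
  by rewrite eq_sym (inj_eq theta_inj).
by rewrite (bigD1 k) 1?eq_sym //= hornerZ hornerXsubC subrr mulr0 mul0r.
Qed.

Lemma size_lag j : (size (lag j) <= s)%N.
Proof.
rewrite (leq_trans (size_prod_leq _ _)) //.
rewrite leq_subLR (@leq_trans (\sum_(k | k != j) 2).+1) //.
  by rewrite ltnS leq_sum // => k _; rewrite (leq_trans (size_scale_leq _ _)) // size_XsubC.
have s0 : (0 < s)%N by rewrite (leq_ltn_trans _ (ltn_ord j)).
have c : #|[pred k : 'I_s | k != j]| = s.-1 by rewrite cardC1 card_ord.
by rewrite sum_nat_const c; case: (s) s0 => // n _; rewrite /= addnS addnn muln2.
Qed.

Lemma lag_interp p : (size p <= s)%N -> p = \sum_j p.[theta j] *: lag j.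
Proof.
move=> ps; apply/eqP; rewrite -subr_eq0; apply/eqP.
apply: (@roots_geq_poly_eq0 _ _ (codom theta)).
- apply/allP => _ /codomP[k ->]; rewrite rootE hornerD hornerN horner_sum.
  rewrite (bigD1 k) //= big1 => [|j jk]; rewrite hornerZ lag_theta ?eqxx ?mulr1.
    by rewrite addr0 subrr.
  by rewrite (negbTE jk) mulr0.
- by rewrite map_inj_uniq ?enum_uniq //; exact: theta_inj.
rewrite size_codom card_ord (leq_trans (size_polyD _ _)) // geq_max ps size_polyN.
rewrite (leq_trans (size_sum _ _ _)) //; apply/bigmax_leqP => j _.
by rewrite (leq_trans (size_scale_leq _ _)) // size_lag.
Qed.

Lemma lag_exact p (a d u : R) : (size p <= s)%N ->
  \sum_j (lag j).[u] * p.[a + d * theta j] = p.[a + d * u].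
Proof.
move=> ps; pose q := p \Po (a%:P + d *: 'X).
have qE v : q.[v] = p.[a + d * v] by rewrite horner_comp !hornerE.
have qs : (size q <= s)%N.
  have [->|q0] := eqVneq q 0; first by rewrite size_poly0.
  rewrite (leq_trans _ ps) //.
  have d1 : (size (a%:P + d *: 'X)%R <= 2)%N.
    rewrite (leq_trans (size_polyD _ _)) // geq_max.
    rewrite (leq_trans (size_polyC_leq1 _)) //=.
    by rewrite (leq_trans (size_scale_leq _ _)) // size_polyX.
  have [p0|p0] := eqVneq p 0; first by rewrite /q p0 -polyC0 comp_polyC polyC0 size_poly0.
  rewrite (leq_trans (size_comp_poly_leq _ _)) //.
  rewrite -[leqRHS]prednK ?size_poly_gt0 // ltnS.
  rewrite -[leqRHS]muln1 leq_mul2l; apply/orP; right.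
  by move: d1; case: (size _).
rewrite -qE [in RHS](lag_interp qs) horner_sum; apply: eq_bigr => j _.
by rewrite hornerZ qE mulrC.
Qed.

(** A Lebesgue constant of the nodes, taken over all of [[0, 1]] so as to cover the extrapolation to
    0 as well. *)
Lemma lag_bounded : exists2 L : R, 1 <= L &
  forall u, 0 <= u <= 1 -> \sum_j `|(lag j).[u]| <= L.
Proof.
exists (1 + \sum_j \sum_(i < size (lag j)) `|(lag j)`_i|).
  by rewrite lerDl sumr_ge0 // => j _; rewrite sumr_ge0.
move=> u /andP[u0 u1]; rewrite ler_wpDl // ler_sum // => j _.
rewrite horner_coef (le_trans (ler_norm_sum _ _ _)) // ler_sum // => i _.
rewrite normrM ler_piMr // normrX exprn_ile1 //.
by rewrite ger0_norm.
Qed.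

End lagrange.

Section smoothness_facts.
Variables (R : realType) (r : nat) (gamma : R).
Hypotheses (r_ge1 : (1 <= r)%N) (gamma_gt0 : 0 < gamma).
Local Notation s := (smoothness r gamma).

Lemma smoothness_zeta : s%:R - r%:R - zeta gamma = gamma.
Proof.
rewrite /smoothness /zeta; case: ifP => [/truncnK e|_].
  by rewrite natrD e subr0 addrC addKr.
move: (Num.truncn gamma) => n.
have -> : (r + n).+1%:R = r%:R + n%:R + 1 :> R; first by rewrite -natrD natr1.
ring.
Qed.

Lemma zeta_itv : 0 <= zeta gamma < 1.
Proof.
rewrite /zeta; case: ifP => [_|ng]; first by rewrite lexx ltr01.
have /andP[h1 h2] := truncn_itv (ltW gamma_gt0).
have h3 : (Num.truncn gamma)%:R != gamma.
  by apply: contraFneq ng => <-; exact: natr_nat.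
rewrite -natr1 in h2; have h4 : (Num.truncn gamma)%:R < gamma by rewrite lt_neqAle h3.
by apply/andP; split; lra.
Qed.

Lemma smoothness_gap : s%:R - gamma = r%:R + zeta gamma.
Proof. by have := smoothness_zeta; lra. Qed.

(** This makes the extrapolation error at least halve whenever the distance to the faces is
    halved. *)
Lemma smoothness_gap_ge1 : 1 <= s%:R - gamma.
Proof.
rewrite smoothness_gap; have /andP[z0 _] := zeta_itv.
by have : 1 <= r%:R :> R; [rewrite ler1n | lra].
Qed.

Lemma r_lt_smoothness : (r < s)%N.
Proof.
rewrite /smoothness; case: ifP => [/truncnK e|_]; last by rewrite ltnS leq_addr.
by rewrite -addn1 leq_add2l -(ltr_nat R) e.
Qed.

End smoothness_facts.

Section class_bounds.
Variables (R : realType) (l : nat) (T : R) (r : nat) (gamma M : R).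
Hypotheses (T0 : 0 < T) (M0 : 0 < M) (r_ge1 : (1 <= r)%N) (gamma_gt0 : 0 < gamma).
Local Notation s := (smoothness r gamma).
Local Notation Q := (Qstar (l := l) (T := T) r gamma M).

Lemma Qstar_pure (f : C_cube l T) i (d : R) (t : cube l T) : Q f -> 0 < d -> d <= T ->
  (forall k, d <= coord t k) ->
  ~ Gamma0 T (set_val t) /\ `|iter_partial (nseq s i) f t| <= M / (d `^ gamma).
Proof.
move=> [_ Qf] d0 dT dt.
have nG : ~ Gamma0 T (set_val t).
  move=> [_ [k _ /=]] tk; have := dt k; rewrite /coord tk leNgt.
  by rewrite d0.
split=> //; have [|_ /(_ t nG)] := Qf (fun j => if j == i then s else 0%N).
  by rewrite mi_order_single leqnn r_lt_smoothness.
rewrite mi_order_single smoothness_zeta /multi_partial directions_single => /le_trans; apply.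
(* The minimum in [rho] starts from [T], hence the use of [d <= T]. *)
have rd : d <= rho t.
  apply/bigmin_geP; split => // k _.
  by rewrite ger0_norm // (le_trans (ltW d0)).
rewrite ler_wpM2l ?(ltW M0) // lef_pV2 ?posrE ?powR_gt0 //; last exact: lt_le_trans rd.
by apply: ge0_ler_powR; rewrite ?nnegrE // ltW // (lt_le_trans d0).
Qed.

Lemma Qstar_derivable (f : C_cube l T) i : Q f ->
  iter_partial_derivable [set t : cube l T | ~ Gamma0 T (set_val t)] (nseq s i) f.
Proof.
move=> [_ Qf]; have [|+ _] := Qf (fun j => if j == i then s else 0%N).
  by rewrite mi_order_single leqnn r_lt_smoothness.
by rewrite /multi_derivable_on directions_single.
Qed.

Lemma Qstar_near_poly (f : C_cube l T) (a b : 'I_l -> R) (d h : R) i : Q f ->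
  0 < d -> d <= T -> (forall k, d <= a k) -> (forall k, b k <= T) ->
  (forall k, b k - a k <= h) ->
  near_poly a b s i (M / (d `^ gamma) * h ^+ s) (f \o pt T0).
Proof.
move=> Qf d0 dT da bT bah x xb.
have ab k : a k <= b k by have /andP[h1 h2] := xb k; exact: le_trans h2.
have [y yab|p ps pP] := @axis_poly_approx R l T T0 _ f x i s (a i) (b i)
    (M / (d `^ gamma)) (le_trans (ltW d0) (da i)) (ab i) (bT i) (Qstar_derivable i Qf).
  apply: Qstar_pure => // k; rewrite coord_upd.
  case: eqP => [_|_].
    by case/andP: yab => h1 h2; rewrite clip_id; rewrite ?(le_trans (da i)) // (le_trans (ltW d0)) ?(le_trans (da i)) // (le_trans h2).
  have /andP[h1 h2] := xb k.
  by rewrite coord_pt clip_id ?(le_trans (da k)) // (le_trans (ltW d0)) ?(le_trans (da k)) // (le_trans h2).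
exists p => // t tab; apply: le_trans (pP t tab) _.
rewrite ler_wpM2l ?divr_ge0 ?powR_ge0 ?(ltW M0) //.
by rewrite lerXn2r ?nnegrE ?subr_ge0 // (le_trans _ (bah i)) // subr_ge0.
Qed.

End class_bounds.

Lemma pt_continuous (R : realType) (l : nat) (T : R) (T0 : 0 < T) (f : C_cube l T) x (e : R) :
  0 < e -> exists2 d : R, 0 < d & forall y : 'rV[R]_l, `|x - y| < d ->
    `|f (pt T0 x) - f (pt T0 y)| < e.
Proof.
move=> e0; have /asboolP cf := C_cube_continuous f.
have /cvgrPdist_lt/(_ _ e0)/nbhs_ballP[d /= d0 dP] := cf (pt T0 x).
exists d => // y xy; apply: dP; rewrite -initial_ballE /= -ball_normE /=.
apply: le_lt_trans xy; apply: mx_norm_le => // i j; rewrite ord1 !mxE.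
rewrite (le_trans (clip_lip T0 _ _)) //.
by have := coord_le_norm (x - y) ord0 j; rewrite !mxE.
Qed.

Lemma powRV (R : realType) (x a : R) : 0 <= x -> x^-1 `^ a = (x `^ a)^-1.
Proof. by move=> x0; rewrite -(powR_inv1 x0) -powRrM mulN1r powRN. Qed.

Lemma powR_quarter (R : realType) (x a : R) n : 0 < x ->
  x ^+ n / ((x / 4) `^ a) = 4 `^ a * x `^ (n%:R - a).
Proof.
move=> x0; rewrite powRM ?(ltW x0) ?invr_ge0 // powRV // powRB; last first.
  by rewrite (gt_eqF x0) implybT.
by rewrite powR_mulrn ?(ltW x0) // invfM invrK [LHS]mulrA [LHS]mulrC.
Qed.

(** * Extrapolation towards the corner *)

Section extrapolation.
Variables (R : realType) (l : nat) (T : R) (r : nat) (gamma M : R).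
Hypotheses (T0 : 0 < T) (M0 : 0 < M) (r_ge1 : (1 <= r)%N) (gamma_gt0 : 0 < gamma).
Local Notation s := (smoothness r gamma).
Local Notation Q := (Qstar (l := l) (T := T) r gamma M).
Variable (Lam : R).
Implicit Types (lam mu : R) (x : 'rV[R]_l) (f : C_cube l T).
Hypotheses (Lam1 : 1 <= Lam)
  (LamP : forall u, 0 <= u <= 1 -> \sum_(j < s) `|(lag R j).[u]| <= Lam).

(* Nodes between [x] and the corner [(T, ..., T)], at distance of order [lam]
   from the faces [t_i = 0]. *)
Definition enode (lam : R) (x : 'rV[R]_l) (i : 'I_l) (j : 'I_s) : R :=
  x ord0 i + lam * (T - x ord0 i) * theta R j.

Definition ecoef (i : 'I_l) (j : 'I_s) : R := (lag R j).[0].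

Definition extrap (lam : R) (F : 'rV[R]_l -> R) x : R :=
  \sum_(nu : {ffun 'I_l -> 'I_s}) (\prod_i ecoef i (nu i)) * F (\row_i enode lam x i (nu i)).

Let s0 : (0 < s)%N. Proof. exact: leq_ltn_trans (r_lt_smoothness _ gamma_gt0). Qed.
Let j0 : 'I_s := Ordinal s0.
Let nu0 : {ffun 'I_l -> 'I_s} := [ffun=> j0].

(** Every direction is replaced by nodes, so the base point [z] is arbitrary; it is chosen later
    inside the box where the estimates hold, which [x] itself may not be. *)
Lemma extrapE lam F x z : extrap lam F x = fapply ecoef (enode lam x) (enum 'I_l) F z.
Proof. by rewrite (fapply_enum _ _ _ _ nu0). Qed.

Lemma ecoef_exact lam x i (p : {poly R}) : (size p <= s)%N ->
  \sum_j ecoef i j * p.[enode lam x i j] = p.[x ord0 i].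
Proof. by move=> ps; rewrite lag_exact // mulr0 addr0. Qed.

Lemma ecoef_sum i : \sum_j ecoef i j = 1.
Proof.
have := @ecoef_exact 0 0 i 1; rewrite size_poly1 hornerC => /(_ s0) <-.
by apply: eq_bigr => j _; rewrite hornerC mulr1.
Qed.

Lemma enode_bounds lam mu x i j : cube l T x -> 0 <= mu -> mu <= lam ->
  x ord0 i + mu / 2 * (T - x ord0 i) <= enode lam x i j <= x ord0 i + lam * (T - x ord0 i).
Proof.
move=> xT mu0 ml; have /andP[x0 x1] := xT i; have /andP[t0 t1] := theta_itv R j.
rewrite /enode !lerD2l; have d0 : 0 <= T - x ord0 i by rewrite subr_ge0.
move: (T - x ord0 i) (theta R j) d0 t0 t1 => d t d0 t0 t1; apply/andP; split.
  by rewrite [leRHS]mulrAC ler_wpM2r //; nra.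
by rewrite ler_piMr // mulr_ge0 // (le_trans mu0).
Qed.

Lemma enode_low lam x i j : cube l T x -> 0 < lam -> lam <= 1 ->
  lam * T / 2 <= enode lam x i j <= T.
Proof.
move=> xT l0 l1; have /andP[h1 h2] := enode_bounds i j xT (ltW l0) (lexx lam).
have /andP[x0 x1] := xT i; apply/andP; split.
  by apply: le_trans h1; nra.
by apply: le_trans h2 _; nra.
Qed.

(** The factor [2 * l * Lam ^ l] comes from exchanging the functionals in [l] directions, and
    [M * 4 ^ gamma] from the derivative bound at distance [lam * T / 4] from the faces. *)
Definition gap_cst : R := 2 * l%:R * Lam ^+ l * M * 4 `^ gamma.

Lemma gap_cst_ge0 : 0 <= gap_cst.
Proof.
by rewrite !mulr_ge0 ?powR_ge0 ?exprn_ge0 ?(ltW M0) // (le_trans ler01).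
Qed.

(** Both extrapolations reproduce polynomials of degree below [s] in each variable, and their nodes
    share a box of sides at most [lam * T] whose points have all coordinates at least
    [lam * T / 4]. *)
Lemma extrap_half f lam x : Q f -> cube l T x -> 0 < lam -> lam <= 1 ->
  `|extrap lam (f \o pt T0) x - extrap (lam / 2) (f \o pt T0) x| <=
    gap_cst * ((lam * T) `^ (s%:R - gamma)).
Proof.
move=> Qf xT l0 l1; pose d : R := lam * T / 4.
have d0 : 0 < d by rewrite divr_gt0 ?mulr_gt0.
pose a i : R := x ord0 i + lam / 4 * (T - x ord0 i).
pose b i : R := x ord0 i + lam * (T - x ord0 i).
have xi i : 0 <= x ord0 i /\ x ord0 i <= T by have /andP[] := xT i.
have np i : near_poly a b s i (M / (d `^ gamma) * (lam * T) ^+ s) (f \o pt T0).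
  apply: Qstar_near_poly => //.
  - have : lam * T <= T by rewrite ler_piMl // ltW.
    move: (T0); rewrite /d; move: (lam * T) => u; lra.
  - move=> k; have [x0 _] := xi k; have := ler_piMl x0 l1; rewrite /a /d; lra.
  - move=> k; have [_ x1] := xi k; rewrite -subr_ge0 in x1.
    have := ler_piMl x1 l1; rewrite /b; lra.
  - move=> k; have [x0 x1] := xi k; rewrite -subr_ge0 in x1.
    by have := mulr_ge0 (ltW l0) x1; have := mulr_ge0 (ltW l0) x0; rewrite /a /b; lra.
have ec i : \sum_j `|ecoef i j| <= Lam by apply: LamP; rewrite lexx ler01.
have A1 : admissible a b Lam ecoef (enode lam x).
  split => // i j; have l2 : 0 <= lam / 2 by lra.
  have ll : lam / 2 <= lam by lra.
  by have := enode_bounds i j xT l2 ll; rewrite (_ : lam / 2 / 2 = lam / 4); last field.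
have A2 : admissible a b Lam ecoef (enode (lam / 2) x).
  split => // i j; have l2 : 0 <= lam / 2 by lra.
  have /andP[h1 h2] := enode_bounds i j xT l2 (lexx (lam / 2)).
  have [? ?] := xi i; rewrite /a /b; apply/andP; split.
    by apply: le_trans h1; rewrite (_ : lam / 2 / 2 = lam / 4); last field.
  by apply: le_trans h2 _; nra.
have zb : in_box a b (\row_i enode lam x i j0) by move=> i; rewrite mxE; exact: A1.2.
rewrite !(extrapE _ _ _ (\row_i enode lam x i j0)).
have := fapply_diff Lam1 A1 A2 _ _ np (enum_uniq 'I_l) zb.
rewrite size_enum_ord => /(_ _ _)/le_trans; apply.
- by move=> i p ps; rewrite !ecoef_exact.
- by rewrite mulr_ge0 ?exprn_ge0 ?divr_ge0 ?powR_ge0 ?mulr_ge0 ?(ltW M0) ?(ltW l0) ?(ltW T0).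
have lT : 0 < lam * T by rewrite mulr_gt0.
rewrite /gap_cst -[leRHS]mulrA -(powR_quarter _ _ lT) -/d.
by rewrite le_eqVlt; apply/orP; left; apply/eqP; ring.
Qed.

(** Telescoping over successive halvings; [2 - 2 / 2 ^+ n] is the sum of the first [n] powers of one
    half. *)
Lemma extrap_pow2 f lam x n : Q f -> cube l T x -> 0 < lam -> lam <= 1 ->
  `|extrap lam (f \o pt T0) x - extrap (lam / 2 ^+ n) (f \o pt T0) x| <=
    gap_cst * ((lam * T) `^ (s%:R - gamma)) * (2 - 2 / 2 ^+ n).
Proof.
move=> Qf xT l0 l1; elim: n => [|n IH].
  by rewrite expr0 !divr1 !subrr normr0 mulr0.
have ln0 : 0 < lam / 2 ^+ n by rewrite divr_gt0 // exprn_gt0.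
have p2 : 1 <= 2 ^+ n :> R by rewrite exprn_ege1 // ler1n.
have ln1 : lam / 2 ^+ n <= 1.
  by rewrite ler_pdivrMr ?exprn_gt0 // mul1r (le_trans l1).
have := extrap_half Qf xT ln0 ln1.
rewrite -mulrA -invfM -exprSr => h.
rewrite -(subrKA (extrap (lam / 2 ^+ n) (f \o pt T0) x)).
rewrite (le_trans (ler_normD _ _)) //.
have pw : (lam / 2 ^+ n * T) `^ (s%:R - gamma) <= (lam * T) `^ (s%:R - gamma) / 2 ^+ n.
  have lT : 0 <= lam * T by rewrite mulr_ge0 ?ltW.
  rewrite mulrAC [leLHS]powRM ?invr_ge0 ?exprn_ge0 // ler_wpM2l ?powR_ge0 //.
  apply: ge1r_powR; last exact: smoothness_gap_ge1.
  by rewrite invr_gt0 exprn_gt0 //= invf_le1 ?exprn_gt0.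
have := lerD IH (le_trans h (ler_wpM2l gap_cst_ge0 pw)) => /le_trans; apply.
rewrite le_eqVlt; apply/orP; left; apply/eqP.
by rewrite exprS; field; rewrite expf_neq0 // pnatr_eq0.
Qed.

Lemma enode_lim lam x i j n : cube l T x -> 0 < lam ->
  `|enode (lam / 2 ^+ n) x i j - x ord0 i| <= lam * T / 2 ^+ n.
Proof.
move=> xT l0; rewrite /enode addrC addKr; have /andP[x0 x1] := xT i.
have /andP[t0 t1] := theta_itv R j.
have p0 : 0 < 2 ^+ n :> R by rewrite exprn_gt0.
have e0 : 0 <= lam / 2 ^+ n by rewrite divr_ge0 ?ltW.
have tge : 0 <= theta R j by apply: le_trans t0; rewrite invr_ge0.
have dge : 0 <= T - x ord0 i by rewrite subr_ge0.
rewrite ger0_norm; last by rewrite mulr_ge0 // mulr_ge0.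
rewrite [leRHS]mulrAC -[leRHS]mulr1 ler_pM ?(mulr_ge0 e0) //.
by rewrite ler_wpM2l // lerBlDr lerDl.
Qed.

(** The nodes tend to [x] and the coefficients sum to 1, so continuity of [f], also at points of the
    faces, identifies the limit of the extrapolations. *)
Lemma extrap_lim f lam x e : cube l T x -> 0 < lam -> 0 < e ->
  exists n, `|extrap (lam / 2 ^+ n) (f \o pt T0) x - f (pt T0 x)| <= Lam ^+ l * e.
Proof.
move=> xT l0 e0; have [d d0 dP] := pt_continuous T0 f x e0.
have lT : 0 < lam * T by rewrite mulr_gt0.
pose n := (Num.truncn (lam * T / (d / 2))).+1.
have nd : lam * T / 2 ^+ n <= d / 2.
  have h : lam * T / (d / 2) <= 2 ^+ n.
    apply: le_trans (ltW (truncnS_gt _)) _; rewrite -natrX ler_nat ltnW //.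
    exact: ltn_expl.
  rewrite ler_pdivrMr ?exprn_gt0 // [leRHS]mulrC -ler_pdivrMr // divr_gt0 //.
exists n; pose z := \row_i enode (lam / 2 ^+ n) x i j0.
pose a i : R := x ord0 i - d / 2; pose b i : R := x ord0 i + d / 2.
have nb i j : a i <= enode (lam / 2 ^+ n) x i j <= b i.
  by have := le_trans (enode_lim i j n xT l0) nd; rewrite ler_distl.
rewrite (extrapE _ _ _ z) -[X in _ - X](fapply_cst (enode (lam / 2 ^+ n) x) (enum 'I_l) z _ ecoef_sum).
rewrite fapplyB -[X in Lam ^+ X](size_enum_ord l).
apply: (@fapply_bound _ _ _ a b _ Lam1) => //.
- by split=> // i; apply: LamP; rewrite lexx ler01.
- by move=> i; rewrite mxE.
- exact: ltW.
move=> y yb; rewrite distrC ltW // dP //.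
rewrite (@le_lt_trans _ _ (d / 2)) //; last by rewrite ltr_pdivrMr // ltr_pMr // ltr1n.
apply: mx_norm_le => [|k i]; first by rewrite divr_ge0 // ltW.
by rewrite ord1 !mxE distrC ler_distl; exact: yb.
Qed.

Lemma extrap_error f lam x : Q f -> cube l T x -> 0 < lam -> lam <= 1 ->
  `|f (pt T0 x) - extrap lam (f \o pt T0) x| <= 2 * gap_cst * ((lam * T) `^ (s%:R - gamma)).
Proof.
move=> Qf xT l0 l1; apply/ler_addgt0Pr => e e0.
have LL : 0 < Lam ^+ l by rewrite exprn_gt0 // (lt_le_trans ltr01).
have [n nP] := extrap_lim f xT l0 (divr_gt0 e0 LL).
rewrite [Lam ^+ l * _]mulrC divfK ?gt_eqF // in nP.
rewrite distrC -(subrKA (extrap (lam / 2 ^+ n) (f \o pt T0) x)).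
rewrite (le_trans (ler_normD _ _)) // lerD //.
apply: le_trans (extrap_pow2 n Qf xT l0 l1) _.
rewrite [leRHS](_ : _ = gap_cst * (lam * T) `^ (s%:R - gamma) * 2); last by ring.
apply: ler_wpM2l; first by rewrite mulr_ge0 ?gap_cst_ge0 ?powR_ge0.
by rewrite lerBlDr lerDl divr_ge0 ?exprn_ge0.
Qed.

(* Only the values of [F] on [{t_i >= lam * T / 2}] matter. *)
Lemma extrap_dist lam (F G : 'rV[R]_l -> R) x e : cube l T x -> 0 < lam -> lam <= 1 -> 0 <= e ->
  (forall y, in_box (fun=> lam * T / 2) (fun=> T) y -> `|F y - G y| <= e) ->
  `|extrap lam F x - extrap lam G x| <= Lam ^+ l * e.
Proof.
move=> xT l0 l1 e0 FG; pose z := \row_i enode lam x i j0.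
rewrite !(extrapE _ _ _ z) fapplyB -[X in Lam ^+ X](size_enum_ord l).
apply: (@fapply_bound _ _ _ (fun=> lam * T / 2) (fun=> T) _ Lam1) => //.
- split=> [i|i j]; first by apply: LamP; rewrite lexx ler01.
  exact: enode_low.
- by move=> i; rewrite mxE; exact: enode_low.
Qed.

End extrapolation.

(** * Graded covering and upper bound *)

Section cells.
Variables (l J : nat) (m : nat -> nat).

(** A common bound on the grid indices of all shells, which puts cells of different meshes into one
    finite type. *)
Definition max_index : nat := (\max_(j < J.+1) 2 ^ m j)%N.

(* The cell [(j, k)] is the grid cube of side [T / 2 ^ m j] with corner
   [k * T / 2 ^ m j]; it meets the shell [T / 2 ^ j.+1 <= min_i t_i <= T / 2 ^ j]. *)
Definition cells : {set 'I_J.+1 * {ffun 'I_l -> 'I_max_index.+1}} :=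
  [set c : 'I_J.+1 * {ffun 'I_l -> 'I_max_index.+1} | [forall i, 2 ^ (m c.1 - c.1.+1) <= c.2 i <= 2 ^ m c.1]%N &&
           [exists i, c.2 i <= 2 ^ (m c.1 - c.1)]%N].

Lemma card_ord_le n k : (#|[pred v : 'I_n | v <= k]%N| <= k.+1)%N.
Proof.
rewrite cardE -(size_map val) -[leqRHS](size_iota 0) uniq_leq_size //.
  by rewrite map_inj_uniq ?enum_uniq //; exact: val_inj.
by move=> _ /mapP[v + ->]; rewrite mem_enum mem_iota inE add0n ltnS.
Qed.

(** In each shell, choose one of the [l] directions with a small index; there the index has
    [(2 ^ (m j - j)).+1] possible values, in any other direction at most [(2 ^ m j).+1]. *)
Lemma card_cells :
  (#|cells| <= \sum_(j < J.+1) l * ((2 ^ (m j - j)).+1 * (2 ^ m j).+1 ^ l.-1))%N.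
Proof.
pose B (j : 'I_J.+1) (i0 i : 'I_l) : nat := (if i == i0 then 2 ^ (m j - j) else 2 ^ m j)%N.
pose F j i0 i : pred 'I_max_index.+1 := [pred v : 'I_max_index.+1 | v <= B j i0 i]%N.
rewrite -sum1_card big_mkcond /=.
rewrite (@leq_trans (\sum_(c : 'I_J.+1 * {ffun 'I_l -> 'I_max_index.+1})
   \sum_(i0 < l) (c.2 \in family (F c.1 i0)))%N) //.
  apply: leq_sum => -[j k] _; case: ifPn => //; rewrite inE /= => /andP[/forallP h /existsP[i0 k0]].
  rewrite (bigD1 i0) //= (_ : (k \in family (F j i0)) = true) //.
  apply/familyP => i; rewrite inE /= /B; case: eqP => [->//|_].
  by have /andP[] := h i.
rewrite -(pair_big xpredT xpredT (fun j k => \sum_(i0 < l) (k \in family (F j i0) : nat))%N) /=.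
apply: leq_sum => j _; rewrite exchange_big /=.
rewrite -[X in (_ <= X * _)%N](card_ord l) -sum_nat_const; apply: leq_sum => i0 _.
rewrite (_ : \sum_k _ = #|family (F j i0)|)%N; last first.
  by rewrite -sum1_card [RHS]big_mkcond; apply: eq_bigr => k _; case: ifP.
rewrite card_family foldrE big_map big_enum /= (bigD1 i0) //= leq_mul //.
  by rewrite /F /B eqxx; exact: card_ord_le.
rewrite -[X in (_ ^ X)%N](_ : #|[pred i : 'I_l | i != i0]| = l.-1); last first.
  by rewrite cardC1 card_ord.
rewrite -prod_nat_const; apply: leq_prod => i ii0.
by rewrite /F /B (negbTE ii0); exact: card_ord_le.
Qed.

End cells.

Lemma mx_norm_lt (R : realType) m n (x : 'M[R]_(m, n)) (e : R) : 0 < e ->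
  (forall i j, `|x i j| < e) -> `|x| < e.
Proof.
move=> e0 h; rewrite [ltLHS]/Num.norm /= mx_normrE.
by apply/bigmax_ltP; split => // -[i j] _ /=; exact: h.
Qed.

Lemma grid_pow (R : realType) (T : R) j m : (j <= m)%N ->
  (2 ^ (m - j))%:R * (T / 2 ^+ m) = T / 2 ^+ j.
Proof.
move=> jm; rewrite natrX -[in 2 ^+ m](subnK jm) exprD; field.
by rewrite !expf_neq0 // pnatr_eq0.
Qed.

Lemma exists_shell (R : realType) (T u : R) (J : nat) : T / 2 ^+ J.+1 <= u -> u <= T ->
  exists2 j, (j <= J)%N & T / 2 ^+ j.+1 <= u <= T / 2 ^+ j.
Proof.
elim: J => [|k IH] h uT; first by exists 0%N; rewrite // h expr0 divr1.
have [h'|h'] := leP (T / 2 ^+ k.+1) u.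
  by have [j jk jP] := IH h' uT; exists j; rewrite // ltnW.
by exists k.+1; rewrite // h ltW.
Qed.

Section continuous_at_big.
Variables (R : realType) (V : topologicalType) (I : Type) (w : seq I) (g : I -> V -> R).
Variable x : V.
Hypothesis cg : forall i, continuous_at x (g i).

Lemma prod_continuous_at : continuous_at x (fun y => \prod_(i <- w) g i y).
Proof.
elim: w => [|i w' IH].
  by rewrite (_ : (fun _ => _) = cst 1); [exact: cst_continuous | apply/funext => y; rewrite big_nil].
rewrite (_ : (fun _ => _) = (fun y => g i y * \prod_(j <- w') g j y)); last first.
  by apply/funext => y; rewrite big_cons.
by apply: (cvgM (F := nbhs x)); [exact: cg | exact: IH].
Qed.

Lemma sum_continuous_at : continuous_at x (fun y => \sum_(i <- w) g i y).
Proof.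
elim: w => [|i w' IH].
  by rewrite (_ : (fun _ => _) = cst 0); [exact: cst_continuous | apply/funext => y; rewrite big_nil].
rewrite (_ : (fun _ => _) = (fun y => g i y + \sum_(j <- w') g j y)); last first.
  by apply/funext => y; rewrite big_cons.
by apply: (cvgD (F := nbhs x)); [exact: cg | exact: IH].
Qed.

End continuous_at_big.

(** * Partition of unity on the cells and the approximation operator *)

Section shell_approximation.
Variables (R : realType) (l : nat) (T : R) (r : nat) (gamma M : R).
Hypotheses (T0 : 0 < T) (M0 : 0 < M) (r_ge1 : (1 <= r)%N) (gamma_gt0 : 0 < gamma).
Hypothesis (l0 : (0 < l)%N).
Local Notation s := (smoothness r gamma).
Local Notation Q := (Qstar (l := l) (T := T) r gamma M).
Variable (Lam : R).
Hypotheses (Lam1 : 1 <= Lam)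
  (LamP : forall u, 0 <= u <= 1 -> \sum_(j < s) `|(lag R j).[u]| <= Lam).
Variables (J : nat) (m : nat -> nat) (err : R).
Hypothesis mP : forall j, (j <= J)%N -> (j.+2 <= m j)%N.
Hypothesis errP : forall j, (j <= J)%N ->
  (2 * (T / 2 ^+ m j)) ^+ s / ((T / 2 ^+ j.+2) `^ gamma) <= err.

Local Notation cellT := {c | c \in cells l J m}.
Implicit Types (c : cellT) (x y : 'rV[R]_l) (f : C_cube l T) (i : 'I_l) (j : 'I_s).

Let s0 : (0 < s)%N. Proof. exact: leq_ltn_trans (r_lt_smoothness _ gamma_gt0). Qed.
Let j0 : 'I_s := Ordinal s0.

Definition shell c : nat := (val c).1.
Definition side c : R := T / 2 ^+ m (shell c).
Definition corner c : 'rV[R]_l := \row_i (((val c).2 i)%:R * side c).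
(** The box of a cell is centred at its grid corner and contains the part of the support of [hat c]
    in the cube; above it is cut at [T] to stay inside. *)
Definition lo c i : R := corner c ord0 i - side c.
Definition hi c i : R := Num.min T (corner c ord0 i + side c).
Definition hat c y : R := Num.max 0 (side c - `|y - corner c|).
Definition hats y : R := \sum_c hat c y.
Definition cnode c i j : R := lo c i + (hi c i - lo c i) * theta R j.
Definition cpos c i y : R := (y ord0 i - lo c i) / (hi c i - lo c i).
Definition cweight c (nu : {ffun 'I_l -> 'I_s}) y : R :=
  hat c y / hats y * \prod_i (lag R (nu i)).[cpos c i y].
Definition cpoint c (nu : {ffun 'I_l -> 'I_s}) : 'rV[R]_l := \row_i cnode c i (nu i).

Let shellP c : (shell c <= J)%N.
Proof. by rewrite -ltnS ltn_ord. Qed.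

Lemma side_gt0 c : 0 < side c.
Proof. by rewrite divr_gt0 // exprn_gt0. Qed.

Lemma corner_bounds c i : T / 2 ^+ (shell c).+1 <= corner c ord0 i <= T.
Proof.
have := valP c; rewrite inE => /andP[/forallP/(_ i)/andP[k1 k2] _].
have p0 n : 0 < 2 ^+ n :> R by rewrite exprn_gt0.
have sm : ((shell c).+1 <= m (shell c))%N by rewrite ltnW // mP.
rewrite mxE /side mulrCA; apply/andP; split.
  rewrite ler_wpM2l ?(ltW T0) // ler_pdivlMr // mulrC -exprB ?unitfE ?gt_eqF //.
  by rewrite -natrX ler_nat.
by rewrite ler_piMr ?(ltW T0) // ler_pdivrMr // mul1r -natrX ler_nat.
Qed.

Lemma side_le c : side c <= T / 2 ^+ (shell c).+2.
Proof.
rewrite ler_wpM2l ?(ltW T0) // lef_pV2 ?posrE ?exprn_gt0 //.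
by rewrite ler_weXn2l ?ler1n // mP.
Qed.

(** The margin [j.+2 <= m j] is spent here: the side is at most half of the distance from the corner
    of the cell to the faces. *)
Lemma lo_ge c i : T / 2 ^+ (shell c).+2 <= lo c i.
Proof.
have /andP[h _] := corner_bounds c i; have h2 := side_le c.
rewrite /lo lerBrDr; apply: le_trans h; apply: le_trans (lerD (lexx _) h2) _.
rewrite le_eqVlt; apply/orP; left; apply/eqP; rewrite !exprS; field.
by rewrite expf_neq0 // pnatr_eq0.
Qed.

Lemma lo_lt_hi c i : lo c i < hi c i.
Proof.
have /andP[_ h] := corner_bounds c i; have h2 := side_gt0 c.
by rewrite /lo /hi lt_min; apply/andP; split; lra.
Qed.

Lemma hi_le c i : hi c i <= T. Proof. by rewrite /hi ge_min lexx. Qed.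

Lemma hi_lo_le c i : hi c i - lo c i <= 2 * side c.
Proof.
have : hi c i <= corner c ord0 i + side c by rewrite /hi ge_min lexx orbT.
by rewrite /lo; lra.
Qed.

Lemma hat_ge0 c y : 0 <= hat c y. Proof. by rewrite /hat le_max lexx. Qed.

Lemma hat_support c y : cube l T y -> hat c y != 0 -> in_box (lo c) (hi c) y.
Proof.
move=> yT; rewrite /hat; have [h|h] := leP (side c - `|y - corner c|) 0; first by rewrite eqxx.
move=> _ i; have := coord_le_norm (y - corner c) ord0 i; rewrite !mxE => h1.
have /andP[_ h2] := yT i; rewrite subr_gt0 in h.
have := le_lt_trans h1 h; rewrite ltr_norml => /andP[h3 h4].
by rewrite /lo /hi le_min h2 mxE /=; apply/andP; split; lra.
Qed.

Lemma cpos_itv c y i : in_box (lo c) (hi c) y -> 0 <= cpos c i y <= 1.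
Proof.
move=> yb; have /andP[h1 h2] := yb i; have h := lo_lt_hi c i; rewrite /cpos.
have h0 : 0 < hi c i - lo c i by rewrite subr_gt0.
rewrite divr_ge0 ?subr_ge0 // ?(ltW h) //=.
by rewrite ler_pdivrMr // mul1r lerB.
Qed.

Definition local_cst : R := 2 * l%:R * Lam ^+ l * M.

Lemma local_error c f y : Q f -> in_box (lo c) (hi c) y ->
  `|f (pt T0 y) - \sum_(nu : {ffun 'I_l -> 'I_s}) (\prod_i (lag R (nu i)).[cpos c i y]) * f (pt T0 (cpoint c nu))| <=
    local_cst * err.
Proof.
move=> Qf yb; have d0 : 0 < T / 2 ^+ (shell c).+2 by rewrite divr_gt0 // exprn_gt0.
have np i : near_poly (lo c) (hi c) s i
    (M / ((T / 2 ^+ (shell c).+2) `^ gamma) * (2 * side c) ^+ s) (f \o pt T0).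
  apply: Qstar_near_poly => //.
  - by rewrite ler_piMr ?(ltW T0) // invf_le1 ?exprn_gt0 // exprn_ege1 // ler1n.
  - by move=> k; exact: lo_ge.
  - by move=> k; exact: hi_le.
  - by move=> k; exact: hi_lo_le.
pose co i j := (lag R j).[cpos c i y].
(* Evaluation at [y] as a tensor functional: all nodes are at [y] and the whole weight is on
   [j0]. *)
pose co' i j : R := (j == j0)%:R.
pose no' i j : R := y ord0 i.
have A1 : admissible (lo c) (hi c) Lam co (cnode c).
  split => [i|i j]; first by apply: LamP; exact: cpos_itv.
  have /andP[t0 t1] := theta_itv R j; have h := lo_lt_hi c i; rewrite -subr_gt0 in h.
  have t00 : 0 <= theta R j by apply: le_trans t0; rewrite invr_ge0.
  rewrite /cnode lerDl mulr_ge0 ?(ltW h) //=.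
  by rewrite -lerBrDl ler_piMr // ltW.
have A2 : admissible (lo c) (hi c) Lam co' no'.
  split => [i|i j]; last exact: yb.
  rewrite (bigD1 j0) //= big1 => [|j jj]; rewrite /co' ?eqxx ?normr1 ?addr0 //.
  by rewrite (negbTE jj) normr0.
have idE w : fapply co' no' w (f \o pt T0) y = f (pt T0 y).
  elim: w => //= i w IH; rewrite (bigD1 j0) //= big1 => [|j jj].
    by rewrite /co' eqxx mul1r addr0 /no' upd_id.
  by rewrite /co' (negbTE jj) mul0r.
have := fapply_diff Lam1 A1 A2 _ _ np (enum_uniq 'I_l) yb.
rewrite idE (fapply_enum _ _ _ _ [ffun=> j0]) size_enum_ord distrC => /(_ _ _)/le_trans; apply.
- move=> i p ps; rewrite [RHS](bigD1 j0) //= [X in _ + X]big1 => [|j jj]; last first.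
    by rewrite /co' (negbTE jj) mul0r.
  rewrite /co' eqxx mul1r addr0 lag_exact // /cpos mulrC divfK ?subrKC //.
  by rewrite gt_eqF // subr_gt0 lo_lt_hi.
- apply: mulr_ge0; first by apply: divr_ge0; [exact: ltW | exact: powR_ge0].
  by apply/exprn_ge0/mulr_ge0 => //; exact: ltW (side_gt0 c).
have LL : 0 <= Lam ^+ l by rewrite exprn_ge0 // (le_trans ler01).
have MM := ltW M0.
by rewrite /local_cst -!mulrA !ler_wpM2l // mulrC errP.
Qed.

(** The smallest coordinate of [y] selects the shell, and rounding all coordinates down selects a
    cell whose corner is closer to [y] than its side. *)
Lemma hats_gt0 y : in_box (fun=> T / 2 ^+ J.+1) (fun=> T) y -> 0 < hats y.
Proof.
move=> yb.
have [i0 _ i0P] : exists2 i0 : 'I_l, True & forall i, y ord0 i0 <= y ord0 i.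
  pose i1 : 'I_l := Ordinal l0.
  exists [arg min_(i < i1 | true) y ord0 i]%O => //.
  by case: Order.TotalTheory.arg_minP => // i _ h k; exact: h.
have /andP[y1 y2] := yb i0; have [j jJ /andP[yj1 yj2]] := exists_shell y1 y2.
have p0 n : 0 < 2 ^+ n :> R by rewrite exprn_gt0.
pose k i := Num.truncn (y ord0 i / (T / 2 ^+ m j)).
have sd0 : 0 < T / 2 ^+ m j by rewrite divr_gt0.
have kP i : (k i)%:R <= y ord0 i / (T / 2 ^+ m j) < (k i).+1%:R.
  apply: truncn_itv; rewrite divr_ge0 // ?(ltW sd0) //.
  by have /andP[h _] := yb i; apply: le_trans h; rewrite divr_ge0 ?ltW.
have k2 i : (k i <= 2 ^ m j)%N.
  have /andP[h _] := kP i; rewrite -(ler_nat R) natrX (le_trans h) //.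
  rewrite ler_pdivrMr // mulrC divfK ?gt_eqF //; by have /andP[] := yb i.
have kmax i : (k i < (max_index J m).+1)%N.
  rewrite ltnS (leq_trans (k2 i)) //.
  exact: (@leq_bigmax _ (fun j : 'I_J.+1 => (2 ^ m j)%N) (Ordinal (jJ : (j < J.+1)%N))).
pose c0 : 'I_J.+1 * {ffun 'I_l -> 'I_(max_index J m).+1} :=
  (Ordinal (jJ : (j < J.+1)%N), [ffun i => Ordinal (kmax i)]).
have c0P : c0 \in cells l J m.
  rewrite inE; apply/andP; split.
    apply/forallP => i; rewrite /= ffunE /= k2 andbT.
    rewrite -ltnS -(ltr_nat R); have /andP[_] := kP i; apply: le_lt_trans.
    rewrite ler_pdivlMr // grid_pow //; last by rewrite ltnW // mP.
    exact: le_trans yj1 (i0P i).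
  apply/existsP; exists i0; rewrite /= ffunE /=.
  rewrite -(ler_nat R); have /andP[+ _] := kP i0; move=> /le_trans; apply.
  by rewrite ler_pdivrMr // grid_pow // ltnW // ltnW // mP.
pose c : cellT := exist _ c0 c0P.
have c_pos : 0 < hat c y.
  rewrite /hat lt_max; apply/orP; right; rewrite subr_gt0; apply: mx_norm_lt.
    exact: side_gt0.
  move=> k' i; rewrite ord1 !mxE /= ffunE /= -/(shell c) /side /shell /=.
  have kS : (k i).+1%:R = (k i)%:R + 1 :> R by rewrite natr1.
  have /andP[] := kP i; rewrite ler_pdivlMr // ltr_pdivrMr // kS mulrDl mul1r => h1 h2.
  by rewrite ger0_norm ?subr_ge0 // ltrBlDl.
rewrite /hats (bigD1 c) //= ltr_wpDr //.
by apply: sumr_ge0 => c' _; exact: hat_ge0.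
Qed.

Lemma shell_error f y : Q f -> in_box (fun=> T / 2 ^+ J.+1) (fun=> T) y ->
  `|f (pt T0 y) - \sum_c \sum_(nu : {ffun 'I_l -> 'I_s}) cweight c nu y * f (pt T0 (cpoint c nu))| <=
    local_cst * err.
Proof.
move=> Qf yb; have h0 := hats_gt0 yb.
have yT : cube l T y.
  by move=> i; have /andP[h ->] := yb i; rewrite andbT (le_trans _ h) // divr_ge0 // ltW.
pose A c := \sum_(nu : {ffun 'I_l -> 'I_s}) (\prod_i (lag R (nu i)).[cpos c i y]) * f (pt T0 (cpoint c nu)).
have e1 : \sum_c hat c y / hats y = 1 by rewrite -mulr_suml divff // gt_eqF.
rewrite (_ : \sum_c _ = \sum_c hat c y / hats y * A c); last first.
  apply: eq_bigr => c _; rewrite /A mulr_sumr; apply: eq_bigr => nu _.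
  by rewrite /cweight mulrA.
rewrite -[X in X - _](mul1r (f _)) -[in X in X - _]e1 mulr_suml -sumrB.
rewrite (le_trans (ler_norm_sum _ _ _)) // -[leRHS]mul1r -[in leRHS]e1 mulr_suml.
apply: ler_sum => c _; rewrite -mulrBr normrM.
have h1 : 0 <= hat c y / hats y by rewrite divr_ge0 ?hat_ge0 // ltW.
rewrite (ger0_norm h1); have [->|hc] := eqVneq (hat c y) 0; first by rewrite !mul0r.
by rewrite ler_wpM2l //; apply: local_error => //; exact: hat_support.
Qed.

Lemma hat_continuous c : continuous (hat c).
Proof.
apply: (@lipschitz_continuous _ _ _ _ 1) => // x y; rewrite mul1r /hat.
have : `| `|x - corner c| - `|y - corner c| | <= `|x - y|.
  by rewrite (le_trans (ler_dist_dist _ _)) // opprB addrA subrK.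
move: `|x - corner c| `|y - corner c| => u v; move: `|x - y| => w.
rewrite !ler_norml /Num.max => /andP[h1 h2].
by case: ltP => h3; case: ltP => h4; apply/andP; split; lra.
Qed.

Lemma cweight_continuous c nu y : in_box (fun=> T / 2 ^+ J.+1) (fun=> T) y ->
  continuous_at y (cweight c nu).
Proof.
move=> /hats_gt0 h0; rewrite /cweight.
apply: (cvgM (F := nbhs y)).
  apply: (cvgM (F := nbhs y)); first exact: hat_continuous.
  apply: cvgV; first by rewrite gt_eqF.
  by apply: sum_continuous_at => c'; exact: hat_continuous.
apply: prod_continuous_at => i.
apply: (@continuous_comp _ _ _ (cpos c i) (horner (lag R (nu i)))); last exact: continuous_horner.
rewrite /cpos; apply: (cvgM (F := nbhs y)); last exact: cvg_cst.
apply: (cvgB (F := nbhs y)); last exact: cvg_cst.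
exact: coord_continuous.
Qed.

Let lam : R := 2^-1 ^+ J.

Lemma lam_gt0 : 0 < lam. Proof. by rewrite exprn_gt0 // invr_gt0. Qed.

Lemma lam_le1 : lam <= 1.
Proof. by rewrite exprn_ile1 ?invr_ge0 // invf_le1 // ler1n. Qed.

Lemma lam_half : lam * T / 2 = T / 2 ^+ J.+1.
Proof. by rewrite /lam exprVn exprS; field; rewrite expf_neq0 // pnatr_eq0. Qed.

Local Notation index := (cellT * {ffun 'I_l -> 'I_s})%type.

Definition enode_row (mu : {ffun 'I_l -> 'I_s}) x : 'rV[R]_l := \row_i @enode R l T r gamma lam x i (mu i).

Lemma enode_row_in mu x : cube l T x ->
  in_box (fun=> T / 2 ^+ J.+1) (fun=> T) (enode_row mu x).
Proof.
move=> xT i; rewrite mxE -lam_half.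
by apply: enode_low => //; [exact: lam_gt0 | exact: lam_le1].
Qed.

Lemma enode_row_continuous mu : continuous (enode_row mu).
Proof.
apply: (@lipschitz_continuous _ _ _ _ 2) => // x y.
apply: mx_norm_le => [|k i]; first by rewrite mulr_ge0.
rewrite !mxE /enode; have := coord_le_norm (x - y) ord0 i; rewrite !mxE.
have /andP[t0 t1] := theta_itv R (mu i).
set N := `|x - y|; move: (x ord0 i) (y ord0 i) => u v h.
have e : u + lam * (T - u) * theta R (mu i) - (v + lam * (T - v) * theta R (mu i)) =
   (1 - lam * theta R (mu i)) * (u - v) by ring.
rewrite e normrM ler_pM // ler_norml.
have l0' := lam_gt0; have l1' := lam_le1; move: (theta R _) t0 t1 => t t0 t1.
by apply/andP; split; nra.
Qed.

(** The weights are only continuous where [hats] is positive; evaluating them at extrapolation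
    nodes, which have all coordinates at least [T / 2 ^+ J.+1], yields functions continuous up to
    the faces. *)
Definition approx_fun (q : index) (t : cube l T) : R :=
  \sum_(mu : {ffun 'I_l -> 'I_s}) (\prod_i @ecoef R l r gamma i (mu i)) *
    cweight q.1 q.2 (enode_row mu (set_val t)).

Lemma approx_fun_continuous q : approx_fun q \in continuousb l T.
Proof.
apply/asboolP => t; apply: sum_continuous_at => mu.
apply: (cvgM (F := nbhs t)); first exact: cvg_cst.
apply: (@continuous_comp _ _ _ (enode_row mu \o set_val) (cweight q.1 q.2)).
  apply: continuous_comp; last exact: enode_row_continuous.
  exact: initial_continuous.
by apply: cweight_continuous; apply: enode_row_in; exact: (set_valP t).
Qed.

Definition approx (q : index) : C_cube l T := CCube (approx_fun_continuous q).

(** The first term compares [f] with its extrapolation, the second the extrapolations of [f] and of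
    its approximant on the shells. *)
Lemma approx_error f : Q f ->
  `|f - \sum_q f (pt T0 (cpoint q.1 q.2)) *: approx q| <=
    2 * gap_cst l gamma M Lam * ((lam * T) `^ (s%:R - gamma)) + Lam ^+ l * (local_cst * err).
Proof.
move=> Qf; have LL : 0 <= Lam ^+ l by rewrite exprn_ge0 // (le_trans ler01).
have err0 : 0 <= err.
  apply: le_trans (errP (leqnn J)); apply: divr_ge0; last exact: powR_ge0.
  by rewrite exprn_ge0 // mulr_ge0 // divr_ge0 ?ltW // exprn_gt0.
have lc : 0 <= local_cst * err.
  by apply: mulr_ge0 => //; rewrite /local_cst !mulr_ge0 // ltW.
apply: C_cube_norm_le.
  apply: addr_ge0; last exact: mulr_ge0.
  apply: mulr_ge0; last exact: powR_ge0.
  by rewrite /gap_cst !mulr_ge0 ?powR_ge0 // ltW.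
move=> t; rewrite C_cube_sum.
pose P y := \sum_c \sum_(nu : {ffun 'I_l -> 'I_s}) cweight c nu y * f (pt T0 (cpoint c nu)).
have -> : \sum_q f (pt T0 (cpoint q.1 q.2)) * approx q t = extrap T r gamma lam P (set_val t).
  rewrite /extrap; under eq_bigr do rewrite /approx /= /approx_fun mulr_sumr.
  rewrite exchange_big; apply: eq_bigr => mu _; rewrite /P.
  rewrite (pair_big xpredT xpredT (fun c (nu : {ffun 'I_l -> 'I_s}) =>
    cweight c nu (enode_row mu (set_val t)) * f (pt T0 (cpoint c nu)))) mulr_sumr.
  by apply: eq_bigr => q _; rewrite mulrCA [_ * f _]mulrC.
have tT := set_valP t.
rewrite -{1}(ptK T0 t) -(subrKA (extrap T r gamma lam (f \o pt T0) (set_val t))).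
rewrite (le_trans (ler_normD _ _)) // lerD //.
  by apply: extrap_error => //; [exact: lam_gt0 | exact: lam_le1].
apply: extrap_dist => //; [exact: lam_gt0 | exact: lam_le1 |].
by move=> y; rewrite lam_half => /(shell_error Qf).
Qed.

Lemma card_index : #|{: index}| = (#|cells l J m| * s ^ l)%N.
Proof. by rewrite card_prod card_sig card_ffun !card_ord; congr (_ * _)%N; exact: eq_card. Qed.

(** The approximant depends only on the sampled values, so two functions with equal samples lie
    within [E] of the same element. *)
Lemma babenko_width_Qstar n (E : R) : (#|cells l J m| * s ^ l <= n)%N ->
  2 * gap_cst l gamma M Lam * ((lam * T) `^ (s%:R - gamma)) + Lam ^+ l * (local_cst * err) <= E ->
  (babenko_width n Q <= (2 * E)%:E)%E.
Proof.
rewrite -card_index => In hE.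
apply: (babenko_width_points (p := fun q : index => pt T0 (cpoint q.1 q.2)) In) => f g Qf Qg fg.
have hf := le_trans (approx_error Qf) hE; have hg := le_trans (approx_error Qg) hE.
rewrite (eq_bigr (fun q => g (pt T0 (cpoint q.1 q.2)) *: approx q)) in hf; last first.
  by move=> q _; rewrite fg.
rewrite -(subrKA (\sum_q g (pt T0 (cpoint q.1 q.2)) *: approx q)) mulr2n mulrDl mul1r.
by rewrite (le_trans (ler_normD _ _)) // lerD // distrC.
Qed.

Lemma kolmogorov_width_Qstar n (E : R) : (#|cells l J m| * s ^ l <= n)%N ->
  2 * gap_cst l gamma M Lam * ((lam * T) `^ (s%:R - gamma)) + Lam ^+ l * (local_cst * err) <= E ->
  (forall n (e : 'I_n -> C_cube l T), exists u : C_cube l T,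
    forall a : 'I_n -> R, u <> \sum_i a i *: e i) ->
  (kolmogorov_width n Q <= E%:E)%E.
Proof.
rewrite -card_index => In hE inf_dim.
apply: (kolmogorov_width_le (g := approx) inf_dim In) => f Qf.
by exists (fun q => f (pt T0 (cpoint q.1 q.2))); exact: le_trans (approx_error Qf) hE.
Qed.

End shell_approximation.

(** * Bump functions *)

Section difference_quotients.
Variable R : realType.
Implicit Types (G : R -> R) (x d : R) (p : {poly R}).

Definition has_slope G x d := forall e, 0 < e -> exists2 r, 0 < r &
  forall h, h != 0 -> `|h| < r -> `|(G (h + x) - G x) / h - d| < e.

Lemma poly_slope p x : has_slope (horner p) x p^`().[x].
Proof.
move=> e e0; have [dp pE] := is_derive_poly p x.
have := dp; rewrite /derivable -/(derive _ _ _) pE => /cvgrPdist_lt/(_ _ e0).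
rewrite /dnbhs near_withinE => /nbhs_ballP[r /= r0 rP].
exists r => // h h0 hr; have := rP h; rewrite -ball_normE /= sub0r normrN => /(_ hr h0).
by rewrite distrC /= [h *: 1]mulr1 /GRing.scale /= mulrC.
Qed.

Lemma cst_slope c x : has_slope (fun=> c) x 0.
Proof. by move=> e e0; exists 1 => // h _ _; rewrite subrr mul0r subrr normr0. Qed.

Lemma eq_near_slope G G' x d r : 0 < r -> (forall h, `|h| < r -> G (h + x) = G' (h + x)) ->
  has_slope G x d -> has_slope G' x d.
Proof.
move=> r0 GG' Gd e /Gd[r' r'0 r'P]; exists (Num.min r r'); first by rewrite lt_min r0.
move=> h h0; rewrite lt_min => /andP[hr hr'].
have := GG' 0; rewrite add0r normr0 => /(_ r0) <-.
by rewrite -GG' // r'P.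
Qed.

Lemma slope_affine G z w c x d : w != 0 -> has_slope G ((x - z) / w) d ->
  has_slope (fun y => c * G ((y - z) / w)) x (c * (d / w)).
Proof.
move=> w0 Gd e e0; have k0 : 0 < `|c / w| + 1 by rewrite ltr_wpDl.
have [r r0 rP] := Gd _ (divr_gt0 e0 k0).
exists (r * `|w|) => [|h h0 hr]; first by rewrite mulr_gt0 // normr_gt0.
have hw : (h + x - z) / w = h / w + (x - z) / w by field.
have := rP (h / w); rewrite mulf_neq0 ?invr_eq0 // normrM normfV ltr_pdivrMr ?normr_gt0 // hw.
move=> /(_ isT hr) H.
rewrite (_ : _ - _ = c / w * ((G (h / w + (x - z) / w) - G ((x - z) / w)) / (h / w) - d)).
  rewrite normrM (@le_lt_trans _ _ (`|c / w| * (e / (`|c / w| + 1)))) //.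
    by rewrite ler_wpM2l // ltW.
  by rewrite mulrCA -[X in _ < X]mulr1 ltr_pM2l // ltr_pdivrMr // mul1r ltrDl.
by field; rewrite h0 w0.
Qed.

End difference_quotients.

Section bump.
Variables (R : realType) (s : nat).

(** The exponent [s.+1] makes all derivatives up to order [s] vanish at 0 and 1, so the polynomial
    can be continued by 0. *)
Definition bump_poly : {poly R} := ('X * (1 - 'X)) ^+ s.+1.

Definition bump (j : nat) (x : R) : R :=
  if (0 <= x <= 1) then bump_poly^`(j).[x] else 0.

Lemma derivn_exp_factor (q : {poly R}) n j : (j <= n)%N ->
  exists h, (q ^+ n)^`(j) = q ^+ (n - j) * h.
Proof.
elim: j => [|j IH] jn; first by exists 1; rewrite subn0 mulr1.
have [h hP] := IH (ltnW jn).
exists (q^`() *+ (n - j) * h + q * h^`()).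
rewrite derivnS hP derivM deriv_exp -(subnSK jn) /= exprS.
by rewrite mulrDr mulrA mulrnAr -mulrnAl; ring.
Qed.

Lemma bump_poly_edge j (x : R) : (j <= s)%N -> x = 0 \/ x = 1 -> bump_poly^`(j).[x] = 0.
Proof.
move=> js x01; have [h ->] := derivn_exp_factor ('X * (1 - 'X)) (leqW js).
rewrite subSn // exprS !hornerE.
by case: x01 => ->; rewrite ?subrr ?mul0r ?mulr0 ?mul0r.
Qed.

Lemma bump_support j x : (j <= s)%N -> bump j x != 0 -> 0 < x < 1.
Proof.
move=> js; rewrite /bump; case: ifP => [/andP[x0 x1] bx|_]; last by rewrite eqxx.
rewrite !lt_neqAle x0 x1 !andbT; apply/andP; split.
  by apply: contraNneq bx => <-; rewrite bump_poly_edge //; left.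
by apply: contraNneq bx => ->; rewrite bump_poly_edge //; right.
Qed.

Lemma bump_bounded : exists2 B : R, 1 <= B & forall j x, (j <= s)%N -> `|bump j x| <= B.
Proof.
pose N (j : 'I_s.+1) : R := \sum_(i < size bump_poly^`(j)) `|bump_poly^`(j)`_i|.
have N0 j : 0 <= N j by exact: sumr_ge0.
exists (1 + \sum_j N j) => [|j x js]; first by rewrite lerDl sumr_ge0.
rewrite /bump; case: ifP => [/andP[x0 x1]|_]; last by rewrite normr0 addr_ge0 ?sumr_ge0.
rewrite ler_wpDl // (bigD1 (Ordinal (js : (j < s.+1)%N))) //= ler_wpDr ?sumr_ge0 //.
rewrite horner_coef (le_trans (ler_norm_sum _ _ _)) // ler_sum // => i _.
by rewrite normrM ler_piMr // normrX exprn_ile1 // ger0_norm.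
Qed.

Lemma bump_mid : 0 < bump 0 2^-1.
Proof.
rewrite /bump ifT; last by rewrite invr_ge0 ler0n invf_le1 // ler1n.
by rewrite derivn0 horner_exp !hornerE exprn_gt0 //; lra.
Qed.

Lemma bump_slope j x : (j < s)%N -> has_slope (bump j) x (bump j.+1 x).
Proof.
move=> js; have pe := @poly_slope R bump_poly^`(j) x; rewrite -derivnS in pe.
(* At an end point the polynomial has value and slope 0, and cutting it off can only shrink the
   difference quotient. *)
have edge : x = 0 \/ x = 1 -> has_slope (bump j) x (bump j.+1 x).
  move=> x01; have bp := bump_poly_edge (ltnW js) x01; have bp' := bump_poly_edge js x01.
  have b0 k : bump_poly^`(k).[x] = 0 -> bump k x = 0.
    by move=> h; rewrite /bump h; case: ifP.
  rewrite (b0 _ bp'); rewrite bp' in pe => e /pe[r r0 rP]; exists r => // h h0 hr.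
  apply: le_lt_trans (rP h h0 hr); rewrite (b0 _ bp) bp !subr0 !normrM ler_wpM2r //.
  by rewrite /bump; case: ifP; rewrite ?normr0.
have [x0|x0|x0] := ltgtP x 0.
- rewrite {2}/bump leNgt x0 /=.
  apply: (@eq_near_slope _ (fun=> 0) _ _ _ (- x)) (cst_slope 0 x); first by rewrite oppr_gt0.
  move=> h; rewrite ltr_norml => /andP[h1 h2]; rewrite /bump ifF //.
  by apply/negbTE; rewrite negb_and -!ltNge; apply/orP; left; lra.
- have [x1|x1|x1] := ltgtP x 1.
  + rewrite {2}/bump (ltW x0) (ltW x1) /=.
    apply: (@eq_near_slope _ (horner bump_poly^`(j)) _ _ _ (Num.min x (1 - x))) pe.
      by rewrite lt_min x0 subr_gt0.
    move=> h; rewrite lt_min !ltr_norml => /andP[/andP[h1 h2] /andP[h3 h4]].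
    by rewrite /bump ifT //; apply/andP; split; lra.
  + rewrite {2}/bump [_ <= 1]leNgt x1 andbF.
    apply: (@eq_near_slope _ (fun=> 0) _ _ _ (x - 1)) (cst_slope 0 x); first by rewrite subr_gt0.
    move=> h; rewrite ltr_norml => /andP[h1 h2]; rewrite /bump ifF //.
    by apply/negbTE; rewrite negb_and -!ltNge; apply/orP; right; lra.
  + by apply: edge; right.
- by apply: edge; left.
Qed.

End bump.

(** * Limits along the axes and mixed partial derivatives *)

Section axis_limits.
Variables (R : realType) (l : nat) (T : R).
Hypothesis T0 : 0 < T.
Implicit Types (f : cube l T -> R) (t u : cube l T) (i : 'I_l).

Lemma axis_ball_near i t (P : cube l T -> Prop) r : 0 < r ->
  (forall u, u <> t -> (forall j, j != i -> coord u j = coord t j) ->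
    `|coord u i - coord t i| < r -> P u) -> \forall u \near axis_nbhs i t, P u.
Proof.
move=> r0 rP; apply/nbhs_ballP; exists r => // u.
rewrite -initial_ballE /= -ball_normE /= => tu [ut uj]; apply: rP => //.
apply: le_lt_trans tu; rewrite distrC.
by have := coord_le_norm (set_val t - set_val u) ord0 i; rewrite !mxE.
Qed.

Lemma axis_nbhs_proper i t : ProperFilter (axis_nbhs i t).
Proof.
have axis_filter := axis_nbhs_filter i t.
apply: Build_ProperFilter_ex => P /axis_near_ball[r r0 rP]; have /andP[c0 cT] := coord_itv t i.
(* Small enough to stay in the cube by moving up from the lower half of [[0, T]] and down from the
   upper half. *)
pose d := Num.min r T / 2; have d0 : 0 < d by rewrite divr_gt0 // lt_min r0.
have dr : d < r.
  by rewrite (@le_lt_trans _ _ (r / 2)) ?ler_wpM2r ?invr_ge0 ?ge_min ?lexx // ltr_pdivrMr // ltr_pMr // ltr1n.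
have dT : d <= T / 2 by rewrite ler_wpM2r ?invr_ge0 // ge_min lexx orbT.
have [c [cc cT' cr]] : exists c, [/\ c != coord t i, 0 <= c <= T & `|c - coord t i| < r].
  have [h|h] := leP (coord t i) (T / 2).
    exists (coord t i + d); split; first by rewrite -subr_eq0 addrC addKr gt_eqF.
      by apply/andP; split; lra.
    by rewrite addrC addKr gtr0_norm.
  exists (coord t i - d); split; first by rewrite -subr_eq0 addrC addKr oppr_eq0 gt_eqF.
    by apply/andP; split; lra.
  by rewrite addrC addKr normrN gtr0_norm.
exists (pt T0 (upd (set_val t) i c)); apply: rP.
- by move=> h; move/eqP: cc; apply; rewrite -h coord_upd eqxx clip_id.
- by move=> j ji; rewrite coord_upd (negbTE ji) ptK.
- by rewrite coord_upd eqxx clip_id.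
Qed.

Lemma axis_cvg_slope f i t (psi : R -> R) d :
  (forall u, (forall j, j != i -> coord u j = coord t j) -> f u = psi (coord u i)) ->
  has_slope psi (coord t i) d -> diff_quotient i f t @ axis_nbhs i t --> d.
Proof.
move=> fpsi dpsi; have axis_filter := axis_nbhs_filter i t.
apply/cvgrPdist_lt => e /dpsi[r r0 rP]; apply: (axis_ball_near r0) => u ut uj ui.
rewrite distrC /diff_quotient !fpsi //.
have := rP (coord u i - coord t i); rewrite subrK; apply => //.
rewrite subr_eq0; apply/eqP => h; apply: ut; apply: cube_eqP => j.
by have [->//|/uj] := eqVneq j i.
Qed.

Lemma axis_cvg_sum (I : finType) (a : I -> R) (g : I -> cube l T -> R) (d : I -> R) i t :
  (forall c, diff_quotient i (g c) t @ axis_nbhs i t --> d c) ->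
  diff_quotient i (fun u => \sum_c a c * g c u) t @ axis_nbhs i t --> \sum_c a c * d c.
Proof.
move=> gd; have axis_filter := axis_nbhs_filter i t.
rewrite (_ : diff_quotient _ _ _ = (fun u => \sum_c a c * diff_quotient i (g c) t u)); last first.
  apply/funext => u; rewrite /diff_quotient -sumrB mulr_suml; apply: eq_bigr => c _.
  by rewrite -mulrBr mulrA.
elim: (index_enum I) => [|c w IH].
  rewrite big_nil (_ : (fun _ => _) = cst 0); first exact: cvg_cst.
  by apply/funext => u; rewrite big_nil.
rewrite big_cons (_ : (fun _ => _) = (fun u => a c * diff_quotient i (g c) t u +
    \sum_(c <- w) a c * diff_quotient i (g c) t u)); last first.
  by apply/funext => u; rewrite big_cons.
apply: (cvgD (F := axis_nbhs i t)) IH; apply: (cvgM (F := axis_nbhs i t)); last exact: gd.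
exact: cvg_cst.
Qed.

Lemma partial_eq f i t d : diff_quotient i f t @ axis_nbhs i t --> d ->
  partial_derivable i f t /\ partial i f t = d.
Proof.
move=> fd; have axis_filter := axis_nbhs_proper i t.
by split; [apply/cvg_ex; exists d | exact: cvg_lim].
Qed.

(** [F k] is a candidate for the mixed derivative of multi-order [k]. If it is closed under one more
    derivative, induction on [w] shows that only the multiplicities of the directions matter. *)
Lemma iter_partialE s (F : ('I_l -> nat) -> cube l T -> R) :
  (forall k i t, (k i < s)%N ->
    diff_quotient i (F k) t @ axis_nbhs i t --> F (fun j => k j + (j == i))%N t) ->
  forall A w, (forall i, (count_mem i w <= s)%N) ->
    iter_partial_derivable A w (F (fun=> 0%N)) /\
    iter_partial w (F (fun=> 0%N)) = F (fun i => count_mem i w).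
Proof.
move=> Fd A; elim=> [_|i w IH ws]; first by split.
have [|dw ew] := IH.
  by move=> j; rewrite (leq_trans _ (ws j)) //= leq_addl.
have iw : (count_mem i w < s)%N by have := ws i; rewrite /= eqxx.
have e : (fun j => count_mem j w + (j == i))%N = (fun j => count_mem j (i :: w)).
  by apply/funext => j; rewrite /= addnC eq_sym.
split.
  by split=> // t _; rewrite ew; have [] := partial_eq (Fd (fun j => count_mem j w) i t iw).
apply/funext => t /=; rewrite -/(iter_partial _ _) ew.
by have [_ ->] := partial_eq (Fd (fun j => count_mem j w) i t iw); rewrite e.
Qed.

Lemma count_directions (k : 'I_l -> nat) i : count_mem i (directions k) = k i.
Proof.
rewrite /directions count_flatten -map_comp sumnE big_map big_enum /=.
rewrite (bigD1 i) //= big1 => [|j ji]; rewrite count_nseq /= ?eqxx ?mul1n ?addn0 //.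
by rewrite (negbTE ji).
Qed.

Lemma multi_partialE s (F : ('I_l -> nat) -> cube l T -> R) :
  (forall k i t, (k i < s)%N ->
    diff_quotient i (F k) t @ axis_nbhs i t --> F (fun j => k j + (j == i))%N t) ->
  forall A k, (mi_order k <= s)%N ->
    multi_derivable_on A k (F (fun=> 0%N)) /\ multi_partial k (F (fun=> 0%N)) = F k.
Proof.
move=> Fd A k ks; have [|d e] := iter_partialE Fd A (w := directions k).
  move=> i; rewrite count_directions (leq_trans _ ks) // /mi_order (bigD1 i) //=.
  exact: leq_addr.
split=> //; rewrite /multi_partial e; congr F.
by apply/funext => i; exact: count_directions.
Qed.

End axis_limits.

(** * Disjoint bumps and lower bound *)

Section blocks.
Variables (l J : nat) (m : nat -> nat) (l0 : (0 < l)%N).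
Let i0 : 'I_l := Ordinal l0.

(* The block [(j, k)] is the grid cube of side [T / 2 ^ m j] with corner
   [k * T / 2 ^ m j]; it lies in the slab [T / 2 ^ j.+1 <= t_0 <= T / 2 ^ j]. *)
Definition blocks : {set 'I_J.+1 * {ffun 'I_l -> 'I_(max_index J m)}} :=
  [set c : 'I_J.+1 * {ffun 'I_l -> 'I_(max_index J m)} |
    [forall i, c.2 i < 2 ^ m c.1]%N && (2 ^ (m c.1 - c.1.+1) <= c.2 i0 < 2 ^ (m c.1 - c.1))%N].

Lemma card_ord_itv n a b : (b <= n)%N -> (b - a <= #|[pred v : 'I_n | a <= v < b]%N|)%N.
Proof.
move=> bn; rewrite cardE -(size_map val) -[X in (X <= _)%N](size_iota a) uniq_leq_size ?iota_uniq //.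
move=> v; rewrite mem_iota => /andP[av vb].
have vb' : (v < b)%N.
  have [ab|ba] := leqP a b; first by rewrite subnKC // in vb.
  by move: vb; rewrite (eqP (ltnW ba : (b - a == 0)%N)) addn0 ltnNge av.
apply/mapP; exists (Ordinal (leq_trans vb' bn)) => //.
by rewrite mem_enum inE /= av.
Qed.

Lemma card_blocks : (forall j, (j <= J)%N -> (j.+1 <= m j)%N) ->
  (\sum_(j < J.+1) 2 ^ (m j - j.+1) * (2 ^ m j) ^ l.-1 <= #|blocks|)%N.
Proof.
move=> mP; have maxP (j : 'I_J.+1) : (2 ^ m j <= max_index J m)%N.
  exact: (@leq_bigmax _ (fun j : 'I_J.+1 => (2 ^ m j)%N) j).
pose F (j : 'I_J.+1) i : pred 'I_(max_index J m) :=
  if i == i0 then [pred v : 'I_(max_index J m) | 2 ^ (m j - j.+1) <= v < 2 ^ (m j - j)]%N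
  else [pred v : 'I_(max_index J m) | 0 <= v < 2 ^ m j]%N.
rewrite -sum1_card [X in (_ <= X)%N]big_mkcond /=.
rewrite [X in (_ <= X)%N](eq_bigr (fun c : 'I_J.+1 * {ffun 'I_l -> 'I_(max_index J m)} =>
  if (c.1, c.2) \in blocks then 1 else 0)%N); last by case.
rewrite -(pair_big xpredT xpredT (fun j k => if (j, k) \in blocks then 1 else 0)%N) /=.
apply: leq_sum => j _.
have jm : (j.+1 <= m j)%N by apply: mP; rewrite -ltnS.
have e2 : (2 ^ (m j - j) = 2 ^ (m j - j.+1) + 2 ^ (m j - j.+1))%N.
  by rewrite addnn -mul2n -expnS -subSn.
rewrite (@leq_trans #|family (F j)|) //.
  rewrite card_family foldrE big_map big_enum /= (bigD1 i0) //= leq_mul //.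
    rewrite /F eqxx (leq_trans _ (card_ord_itv _ _)) //.
      by rewrite e2 addnK.
    by rewrite (leq_trans _ (maxP j)) // leq_exp2l // leq_subr.
  rewrite -[X in (_ ^ X <= _)%N](_ : #|[pred i : 'I_l | i != i0]| = l.-1); last first.
    by rewrite cardC1 card_ord.
  rewrite -prod_nat_const; apply: leq_prod => i ii0.
  by rewrite /F (negbTE ii0) -[X in (X <= _)%N]subn0 card_ord_itv ?maxP.
rewrite -sum1_card big_mkcond /=; apply: leq_sum => k _.
case: ifP => // /familyP kF; rewrite inE /= ifT //; apply/andP; split.
  apply/forallP => i; have := kF i; rewrite /F; case: eqP => [->|_]; rewrite inE //.
  by move=> /andP[_ h]; apply: leq_trans h _; rewrite leq_exp2l // leq_subr.
by have := kF i0; rewrite /F eqxx inE.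
Qed.

End blocks.

Lemma slope_continuous (R : realType) (G : R -> R) x d :
  has_slope G x d -> continuous_at x G.
Proof.
move=> Gd; apply/cvgrPdist_lt => e e0; have [r r0 rP] := Gd _ ltr01.
have L0 : 0 < `|d| + 1 by rewrite ltr_wpDl.
have eL : 0 < e / (`|d| + 1) by rewrite divr_gt0.
near=> y; have [->|yx] := eqVneq y x; first by rewrite subrr normr0.
have h0 : y - x != 0 by rewrite subr_eq0.
have yr : `|y - x| < r by rewrite distrC; near: y; exact: cvgr_dist_lt.
have ye : `|y - x| < e / (`|d| + 1) by rewrite distrC; near: y; exact: cvgr_dist_lt.
have := rP _ h0 yr; rewrite subrK => h.
rewrite distrC -(divfK h0 (G y - G x)) normrM.
rewrite (@le_lt_trans _ _ ((`|d| + 1) * `|y - x|)) //; last by rewrite mulrC -ltr_pdivlMr.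
rewrite ler_wpM2r // -[X in `|X|](subrK d) (le_trans (ler_normD _ _)) // addrC lerD2l.
exact: ltW.
Unshelve. all: by end_near.
Qed.

Section bump_family.
Variables (R : realType) (l : nat) (T : R) (r : nat) (gamma M : R).
Hypotheses (T0 : 0 < T) (M0 : 0 < M) (r_ge1 : (1 <= r)%N) (gamma_gt0 : 0 < gamma).
Hypothesis (l0 : (0 < l)%N).
Local Notation s := (smoothness r gamma).
Local Notation Q := (Qstar (l := l) (T := T) r gamma M).
Variables (B : R).
Hypotheses (B1 : 1 <= B) (BP : forall j x, (j <= s)%N -> `|@bump R s j x| <= B).
Variables (J : nat) (m : nat -> nat).
Hypothesis mP : forall j, (j <= J)%N -> (j.+1 <= m j)%N.
Let i0 : 'I_l := Ordinal l0.

Local Notation blockT := {c | c \in blocks J m l0}.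
Implicit Types (c : blockT) (t : cube l T) (i : 'I_l) (k : 'I_l -> nat).

Definition slab c : nat := (val c).1.
Definition bside c : R := T / 2 ^+ m (slab c).
Definition bcorner c i : R := ((val c).2 i)%:R * bside c.
(** The derivative of multi-order [k] of the bump on the block, in closed form; [block_bump_cvg]
    justifies it one derivative at a time. *)
Definition block_bump c k t : R :=
  \prod_i (@bump R s (k i) ((coord t i - bcorner c i) / bside c) / bside c ^+ k i).

Lemma bside_gt0 c : 0 < bside c.
Proof. by rewrite divr_gt0 // exprn_gt0. Qed.

Lemma slabP c : (slab c <= J)%N. Proof. by rewrite -ltnS ltn_ord. Qed.

Definition in_block c t := forall i, bcorner c i < coord t i < bcorner c i + bside c.

Lemma block_bump_support c k t : (forall i, (k i <= s)%N) -> block_bump c k t != 0 ->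
  in_block c t.
Proof.
move=> ks /prodf_neq0 h i.
have := h i isT; rewrite mulf_eq0 negb_or => /andP[/bump_support bi _].
have /andP[] := bi (ks i); rewrite pmulr_lgt0 ?invr_gt0 ?bside_gt0 // subr_gt0 => -> /=.
by rewrite ltr_pdivrMr ?bside_gt0 // mul1r ltrBlDl.
Qed.

Lemma block_slab c t : in_block c t -> T / 2 ^+ (slab c).+1 < coord t i0 < T / 2 ^+ slab c.
Proof.
move=> /(_ i0)/andP[h1 h2]; have := valP c; rewrite inE => /andP[_ /andP[k1 k2]].
have sm : ((slab c).+1 <= m (slab c))%N by apply: mP; exact: slabP.
apply/andP; split.
  apply: le_lt_trans h1; rewrite -(grid_pow _ sm) ler_wpM2r ?(ltW (bside_gt0 c)) //.
  by rewrite ler_nat.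
apply: lt_le_trans h2 _; rewrite -(grid_pow _ (ltnW sm)) /bcorner.
rewrite -[X in _ + X]mul1r -mulrDl ler_wpM2r ?(ltW (bside_gt0 c)) //.
by rewrite -(natrD _ _ 1) addn1 ler_nat.
Qed.

(** Open slabs of different index are disjoint in the coordinate [i0], and within a slab the blocks
    are open cubes of a single grid. *)
Lemma in_block_inj c c' t : in_block c t -> in_block c' t -> c = c'.
Proof.
move=> tc tc'; have key c1 c2 : in_block c1 t -> in_block c2 t -> ~~ (slab c1 < slab c2)%N.
  move=> t1 t2; apply/negP => lt12.
  have /andP[h1 _] := block_slab t1; have /andP[_ h2] := block_slab t2.
  have : T / 2 ^+ slab c2 <= T / 2 ^+ (slab c1).+1.
    rewrite ler_wpM2l ?(ltW T0) // lef_pV2 ?posrE ?exprn_gt0 //.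
    by rewrite ler_weXn2l ?ler1n.
  by move=> h; have := lt_trans h1 (lt_le_trans h2 h); rewrite ltxx.
have es : slab c = slab c'.
  by apply/eqP; rewrite eqn_leq; apply/andP; split; rewrite leqNgt; exact: key.
have eside : bside c = bside c' by rewrite /bside es.
apply: val_inj; apply: injective_projections; first exact: val_inj es.
apply/ffunP => i; apply: val_inj => /=.
have aux c1 c2 : bside c1 = bside c2 -> in_block c1 t -> in_block c2 t ->
    ((val c1).2 i <= (val c2).2 i)%N.
  move=> e /(_ i)/andP[h1 _] /(_ i)/andP[_ h2].
  have := lt_trans h1 h2; rewrite /bcorner e -[X in _ + X]mul1r -mulrDl ltr_pM2r ?bside_gt0 //.
  by rewrite -(natrD _ _ 1) addn1 ltr_nat ltnS.
by apply/eqP; rewrite eqn_leq !aux.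
Qed.

Lemma block_bump_bound c k t : (forall i, (k i <= s)%N) ->
  `|block_bump c k t| <= B ^+ l / bside c ^+ mi_order k.
Proof.
move=> ks; rewrite /block_bump normr_prod.
have -> : B ^+ l / bside c ^+ mi_order k = \prod_(i < l) (B / bside c ^+ k i).
  rewrite big_split /= prodr_const card_ord; congr (_ * _).
  by rewrite prodfV /mi_order expr_sum.
apply: ler_prod => i _; rewrite normr_ge0 /= normrM ler_pM // ?BP //.
by rewrite normfV ger0_norm // exprn_ge0 // ltW // bside_gt0.
Qed.

Lemma block_bump_cvg c k i t : (k i < s)%N ->
  diff_quotient i (block_bump c k) t @ axis_nbhs i t -->
    block_bump c (fun j => k j + (j == i))%N t.
Proof.
move=> ks; pose K := \prod_(j | j != i)
  (@bump R s (k j) ((coord t j - bcorner c j) / bside c) / bside c ^+ k j).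
have w0 : bside c != 0 by rewrite gt_eqF // bside_gt0.
have := slope_affine (K / bside c ^+ k i) w0 (bump_slope ((coord t i - bcorner c i) / bside c) ks).
rewrite (_ : _ * (_ / _) = block_bump c (fun j => k j + (j == i))%N t); last first.
  rewrite /block_bump (bigD1 i) //= eqxx addn1 exprS.
  rewrite (_ : \prod_(j | j != i) _ = K); last first.
    by apply: eq_bigr => j ji; rewrite (negbTE ji) addn0.
  by field; rewrite expf_neq0.
apply: axis_cvg_slope => // u uj; rewrite /block_bump (bigD1 i) //=.
rewrite (_ : \prod_(j | j != i) _ = K); last by apply: eq_bigr => j ji; rewrite uj.
by field; rewrite expf_neq0.
Qed.

Definition bump_comb (a : blockT -> R) k t : R := \sum_c a c * block_bump c k t.

Lemma bump_comb_bound a k t (E : R) : 0 <= E -> (mi_order k <= s)%N ->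
  (forall c, in_block c t -> `|a c| * (B ^+ l / bside c ^+ mi_order k) <= E) ->
  `|bump_comb a k t| <= E.
Proof.
move=> E0 ks aE; have ki i : (k i <= s)%N.
  by rewrite (leq_trans _ ks) // /mi_order (bigD1 i) //= leq_addr.
have [[c cn]|no] := pselect (exists c, block_bump c k t != 0).
  have tc := block_bump_support ki cn.
  rewrite /bump_comb (bigD1 c) //= big1 ?addr0 => [|c' c'c].
    rewrite normrM (le_trans _ (aE _ tc)) // ler_wpM2l //.
    exact: block_bump_bound.
  apply/eqP; rewrite mulf_eq0; apply/orP; right; apply: contraNT c'c => c'n.
  by rewrite (in_block_inj (block_bump_support ki c'n) tc).
rewrite /bump_comb big1 ?normr0 // => c _; apply/eqP; rewrite mulf_eq0; apply/orP; right.
by apply: contrapT => /negP h; apply: no; exists c.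
Qed.

Lemma bump_comb_cvg a k i t : (k i < s)%N ->
  diff_quotient i (bump_comb a k) t @ axis_nbhs i t -->
    bump_comb a (fun j => k j + (j == i))%N t.
Proof. by move=> ks; apply: axis_cvg_sum => c; exact: block_bump_cvg. Qed.

Lemma block_bump_continuous c : block_bump c (fun=> 0%N) \in continuousb l T.
Proof.
apply/asboolP => t; apply: prod_continuous_at => i.
have s0 : (0 < s)%N by exact: leq_ltn_trans (r_lt_smoothness _ gamma_gt0).
rewrite expr0; apply: (cvgM (F := nbhs t)); last exact: cvg_cst.
apply: (@continuous_comp _ _ _ (fun u : cube l T => (coord u i - bcorner c i) / bside c)
  (@bump R s 0)); last exact: slope_continuous (bump_slope _ s0).
apply: (cvgM (F := nbhs t)); last exact: cvg_cst.
apply: (cvgB (F := nbhs t)); last exact: cvg_cst.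
apply: (@continuous_comp _ _ _ set_val (fun x : 'rV[R]_l => x ord0 i)).
  exact: initial_continuous.
exact: coord_continuous.
Qed.

Definition bump_elt c : C_cube l T := CCube (block_bump_continuous c).

Definition center c : cube l T := pt T0 (\row_i (bcorner c i + bside c / 2)).

Lemma bcorner_bound c i : 0 <= bcorner c i /\ bcorner c i + bside c <= T.
Proof.
have bs := bside_gt0 c; split; first by rewrite mulr_ge0 // ltW.
have := valP c; rewrite inE => /andP[/forallP/(_ i) ki _].
rewrite /bcorner -[X in _ + X]mul1r -mulrDl -(natrD _ _ 1) addn1.
rewrite /bside -/(slab c) mulrCA ler_piMr ?(ltW T0) // ler_pdivrMr ?exprn_gt0 // mul1r.
by rewrite -natrX ler_nat.
Qed.

Lemma coord_center c i : coord (center c) i = bcorner c i + bside c / 2.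
Proof.
rewrite coord_pt mxE clip_id //; have [h1 h2] := bcorner_bound c i.
by have bs := bside_gt0 c; apply/andP; split; lra.
Qed.

Lemma bump_elt_center c c' :
  bump_elt c (center c') = @bump R s 0 2^-1 ^+ l * (c == c')%:R.
Proof.
rewrite /bump_elt /=; have [->|cc'] := eqVneq c c'.
  rewrite mulr1 (_ : _ ^+ l = \prod_(i < l) @bump R s 0 2^-1); last first.
    by rewrite prodr_const card_ord.
  apply: eq_bigr => i _.
  rewrite expr0 divr1 coord_center addrC addKr mulrC mulKf // gt_eqF //.
  exact: bside_gt0.
rewrite mulr0; apply/eqP; apply: contraNT cc' => h; apply/eqP.
apply: (@in_block_inj _ _ (center c')); first exact: block_bump_support h.
by move=> i; rewrite coord_center; have bs := bside_gt0 c'; apply/andP; split; lra.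
Qed.

Section amplitude.
Variable A : R.
Hypotheses (A0 : 0 < A)
  (A_low : forall j (k : nat), (j <= J)%N -> (k <= r)%N ->
     A * (B ^+ l / (T / 2 ^+ m j) ^+ k) <= M)
  (A_high : forall j (k : nat), (j <= J)%N -> (r < k <= s)%N ->
     A * (B ^+ l / (T / 2 ^+ m j) ^+ k) <=
       M / ((T / 2 ^+ j) `^ (k%:R - r%:R - zeta gamma))).

Lemma bump_comb_Qstar (a : blockT -> R) : (forall c, `|a c| <= 1) ->
  Q (\sum_c a c *: (A *: bump_elt c)).
Proof.
move=> a1; pose b c := a c * A.
have fE : (\sum_c a c *: (A *: bump_elt c) : C_cube l T) = bump_comb b (fun=> 0%N) :> (cube l T -> R).
  apply/funext => t; rewrite C_cube_sum; apply: eq_bigr => c _.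
  by rewrite /b -mulrA.
have bA c : `|b c| <= A by rewrite normrM (gtr0_norm A0) ler_piMl // ltW.
have BB c n : 0 <= B ^+ l / bside c ^+ n.
  apply: divr_ge0; apply: exprn_ge0; first exact: le_trans ler01 B1.
  exact: ltW (bside_gt0 c).
have cvg k i t := @bump_comb_cvg b k i t.
split => k; rewrite fE.
  move=> kr; have ks : (mi_order k <= s)%N by rewrite ltnW // (leq_ltn_trans kr) // r_lt_smoothness.
  have [d ->] := multi_partialE T0 cvg setT ks; split => // t.
  apply: bump_comb_bound => //; first exact: ltW.
  move=> c _; rewrite (le_trans _ (A_low (slabP c) kr)) // ler_wpM2r //.
move=> /andP[rk ks]; have [d ->] := multi_partialE T0 cvg [set t | ~ Gamma0 T (set_val t)] ks.
split => // t _; apply: bump_comb_bound => //.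
  by rewrite divr_ge0 ?powR_ge0 // ltW.
move=> c tc; rewrite (@le_trans _ _ (A * (B ^+ l / bside c ^+ mi_order k))) ?ler_wpM2r //.
have rk' : (r < mi_order k <= s)%N by rewrite rk.
apply: le_trans (A_high (slabP c) rk') _.
have rho0 : 0 < rho t.
  apply: lt_bigmin => // i _; rewrite normr_gt0 gt_eqF //.
  by have /andP[+ _] := tc i; apply: le_lt_trans; have [] := bcorner_bound c i.
(* A slab in one coordinate is enough: small values of the other coordinates only decrease [rho] and
   thereby relax the bound of the class. *)
have rhoT : rho t <= T / 2 ^+ slab c.
  have h0 : rho t <= `|coord t i0| by exact: bigmin_le.
  apply: le_trans h0 _; have /andP[_ /ltW h] := block_slab tc.
  by rewrite ger0_norm //; have /andP[] := coord_itv t i0.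
have T2 : 0 < T / 2 ^+ slab c by rewrite divr_gt0 // exprn_gt0.
rewrite ler_wpM2l ?(ltW M0) // lef_pV2 ?posrE ?powR_gt0 //.
apply: ge0_ler_powR; rewrite ?nnegrE ?(ltW rho0) ?(ltW T2) //.
have /andP[_ z1] := zeta_itv gamma_gt0.
have : r%:R + 1 <= (mi_order k)%:R :> R by rewrite natr1 ler_nat.
by move=> h; lra.
Qed.

Lemma le_widths_bump n : (n < #|blocks J m l0|)%N ->
  ((A * @bump R s 0 2^-1 ^+ l)%:E <= kolmogorov_width n Q)%E /\
  ((A * @bump R s 0 2^-1 ^+ l)%:E <= babenko_width n Q)%E.
Proof.
move=> nN; have N : #|{: blockT}| = #|blocks J m l0| by rewrite card_sig; exact: eq_card.
pose Phi (i : 'I_#|{: blockT}|) : C_cube l T := A *: bump_elt (enum_val i).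
pose z (i : 'I_#|{: blockT}|) := center (enum_val i).
have b0 : 0 < A * @bump R s 0 2^-1 ^+ l by rewrite mulr_gt0 // exprn_gt0 // bump_mid.
have PhiP (i j : 'I_#|{: blockT}|) : Phi i (z j) = A * @bump R s 0 2^-1 ^+ l * (i == j)%:R.
  by rewrite [LHS](_ : _ = A * bump_elt (enum_val i) (z j)) // bump_elt_center mulrA (inj_eq enum_val_inj).
have PhiQ (a : 'I_#|{: blockT}| -> R) : (forall q, `|a q| <= 1) -> Q (\sum_q a q *: Phi q).
  move=> a1; rewrite (reindex enum_rank) /=; last exact: onW_bij (enum_rank_bij _).
  under eq_bigr do rewrite /Phi enum_rankK.
  by apply: (@bump_comb_Qstar (fun c => a (enum_rank c))) => c.
rewrite -N in nN; split.
  exact: (le_kolmogorov_width_bumps PhiP PhiQ nN).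
exact: (le_babenko_width_bumps b0 PhiP PhiQ nN).
Qed.

End amplitude.

Lemma blocks_infinite_dim n (e : 'I_n -> C_cube l T) : (n < #|blocks J m l0|)%N ->
  exists u : C_cube l T, forall a : 'I_n -> R, u <> \sum_i a i *: e i.
Proof.
move=> nN; have N : #|{: blockT}| = #|blocks J m l0| by rewrite card_sig; exact: eq_card.
rewrite -N in nN.
apply: (@bump_infinite_dim _ _ _ _ (fun q => bump_elt (enum_val q)) (fun q => center (enum_val q))
  (@bump R s 0 2^-1 ^+ l)) nN; first by rewrite exprn_gt0 // bump_mid.
by move=> i j; rewrite bump_elt_center (inj_eq enum_val_inj).
Qed.

End bump_family.

(** * Counting cells *)

Section geometric_sums.
Variable R : realType.
Implicit Types (a b p : R).

Lemma geometric_bounded b n : 0 <= b -> b < 1 ->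
  1 <= \sum_(j < n.+1) b ^+ j <= (1 - b)^-1.
Proof.
move=> b0 b1; apply/andP; split.
  by rewrite big_ord_recl expr0 lerDl sumr_ge0 // => j _; rewrite exprn_ge0.
have c0 : 0 < 1 - b by rewrite subr_gt0.
have := subrX1 b n.+1; set S := \sum_(_ < _) _ => h.
rewrite -[leRHS]mul1r ler_pdivlMr // mulrC.
have -> : (1 - b) * S = 1 - b ^+ n.+1 by rewrite -[1 - b]opprB mulNr -h opprB.
by rewrite gerBl exprn_ge0.
Qed.

Lemma geometric_dominated b n : 1 < b ->
  b ^+ n <= \sum_(j < n.+1) b ^+ j <= b / (b - 1) * b ^+ n.
Proof.
move=> b1; have b0 : 0 <= b by rewrite ltW // (lt_trans ltr01).
have c0 : 0 < b - 1 by rewrite subr_gt0.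
apply/andP; split.
  by rewrite big_ord_recr lerDr sumr_ge0 // => j _; rewrite exprn_ge0.
rewrite mulrAC ler_pdivlMr // mulrC -subrX1 -exprS.
by rewrite gerBl.
Qed.

Lemma bracket a C x (w : nat -> R) : 1 < a -> 0 < C -> (forall J, 1 <= w J) -> C * w 0%N <= x ->
  exists J, C * (a ^+ J * w J) <= x < C * (a ^+ J.+1 * w J.+1).
Proof.
move=> a1 C0 w1 x0; pose f J := C * (a ^+ J * w J).
have [K xK] : exists K, x < f K.
  pose K := (Num.truncn (x / C / (a - 1))).+1; exists K.
  have a10 : 0 < a - 1 by rewrite subr_gt0.
  have Ka : x / C < K%:R * (a - 1) by rewrite -ltr_pdivrMr // truncnS_gt.
  have aK : K%:R * (a - 1) <= a ^+ K.
    elim: (K) => [|k IH]; first by rewrite mul0r expr0.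
    rewrite -natr1 mulrDl mul1r exprS.
    have ak : 1 <= a ^+ k by rewrite exprn_ege1 // ltW.
    by nra.
  rewrite /f mulrC -ltr_pdivrMr // (lt_le_trans Ka) // (le_trans aK) //.
  by rewrite ler_peMr // exprn_ge0 // (le_trans ler01) // ltW.
elim: K xK => [|K IH] xK.
  by move: xK; rewrite /f expr0 mul1r ltNge x0.
by have [/IH//|h] := ltP x (f K); exists K; rewrite h.
Qed.

(* [w J] is [1] or [J + 1]; the latter produces the logarithm. *)
Section rates.
Variables (a p : R) (w : nat -> R) (d : nat -> \bar R).
Hypotheses (a1 : 1 < a) (p0 : 0 < p).
Variables (Cu CE cl cA : R).
Hypotheses (Cu1 : 1 <= Cu) (CE0 : 0 < CE) (cl0 : 0 < cl) (cl1 : cl <= 1) (cA0 : 0 < cA).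
Hypothesis w1 : forall J, 1 <= w J.
Hypothesis d_upper : forall J n, Cu * (a ^+ J * w J) <= n%:R ->
  (d n <= (CE * (a ^+ J) `^ (- p))%:E)%E.
Hypothesis d_lower : forall J n, n%:R < cl * (a ^+ J * w J) ->
  ((cA * (a ^+ J) `^ (- p))%:E <= d n)%E.

Let a0 : 0 < a. Proof. exact: lt_trans a1. Qed.

(* [g n] is [1] or [ln n]. *)
Variables (g : nat -> R) (ku kl : R).
Hypotheses (ku0 : 0 < ku) (kl0 : 0 < kl).
Hypothesis w_upper : \forall n \near \oo, forall J, Cu * (a ^+ J * w J) <= n%:R -> w J.+1 <= ku * g n.
Hypothesis w_lower : \forall n \near \oo, forall J, n%:R < cl * (a ^+ J.+1 * w J.+1) -> kl * g n <= w J.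
Hypothesis g0 : \forall n \near \oo, 0 <= g n.

(** Bracketing [n] between consecutive values of a multiple of [a ^+ J * w J] makes [a ^+ J]
    comparable to [n / g n], and the error is its power [- p]. The upper bound uses [J], the lower
    one [J.+1], hence the factors [a]. *)
Lemma rate_bounds : exists c1 c2 : R, [/\ 0 < c1, 0 < c2 &
  \forall n \near \oo, ((c1 * (n%:R `^ (- p) * g n `^ p))%:E <= d n <=
     (c2 * (n%:R `^ (- p) * g n `^ p))%:E)%E].
Proof.
exists (cA * (cl * kl / a) `^ p), (CE * (Cu * a * ku) `^ p); split.
- by rewrite mulr_gt0 // powR_gt0 // divr_gt0 // mulr_gt0.
- by rewrite mulr_gt0 // powR_gt0 // !mulr_gt0 // (lt_le_trans ltr01).
have Cu0 : 0 < Cu by apply: lt_le_trans Cu1.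
near=> n.
have gn : 0 <= g n by near: n.
have n_ge : Cu * w 0%N <= n%:R.
  near: n; exists (Num.truncn (Cu * w 0%N)).+1 => // n /= nN.
  by rewrite (le_trans (ltW (truncnS_gt _))) // ler_nat.
have wu : forall J, Cu * (a ^+ J * w J) <= n%:R -> w J.+1 <= ku * g n by near: n.
have wl : forall J, n%:R < cl * (a ^+ J.+1 * w J.+1) -> kl * g n <= w J by near: n.
have n0 : 0 < n%:R :> R by apply: lt_le_trans n_ge; rewrite mulr_gt0 // (lt_le_trans ltr01).
have aJ J : 0 < a ^+ J by rewrite exprn_gt0.
have combine k : 0 <= k -> k `^ p * (n%:R `^ (- p) * g n `^ p) = (k * g n / n%:R) `^ p.
  move=> k0; rewrite powRM ?mulr_ge0 ?invr_ge0 // powRM // powRV ?ler0n // -powRN.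
  by rewrite -mulrA [_ `^ (- p) * _]mulrC.
have powN x : 0 < x -> x `^ (- p) = x^-1 `^ p by move=> x0; rewrite powRV ?ltW // powRN.
apply/andP; split.
  have [|J /andP[h1 h2]] := bracket a1 cl0 w1 (x := n%:R).
    by apply: le_trans n_ge; rewrite ler_wpM2r ?(le_trans cl1) // (le_trans ler01).
  apply: le_trans (d_lower h2); rewrite lee_fin -mulrA combine; last first.
    by rewrite divr_ge0 ?mulr_ge0 // ltW.
  rewrite ler_wpM2l ?(ltW cA0) // powN // ge0_ler_powR ?(ltW p0) ?nnegrE //.
  - by rewrite !mulr_ge0 ?invr_ge0 // ltW.
  - by rewrite invr_ge0 ltW.
  rewrite ler_pdivrMr // [leRHS]mulrC ler_pdivlMr //.
  apply: le_trans h1; rewrite exprS (_ : _ * (a * _) = cl * (a ^+ J * (kl * g n))).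
    by rewrite !ler_wpM2l ?(ltW cl0) ?(ltW (aJ J)) // wl.
  by field; rewrite gt_eqF.
have [J /andP[h1 h2]] := bracket a1 Cu0 w1 n_ge.
apply: le_trans (d_upper h1) _; rewrite lee_fin -[leRHS]mulrA combine; last first.
  by rewrite !mulr_ge0 // ltW.
rewrite ler_wpM2l ?(ltW CE0) // powN // ge0_ler_powR ?(ltW p0) ?nnegrE //.
- by rewrite invr_ge0 ltW.
- by rewrite divr_ge0 ?mulr_ge0 // ltW.
rewrite ler_pdivlMr // mulrC ler_pdivrMr //.
apply: le_trans (ltW h2) _; rewrite exprS.
rewrite (_ : Cu * a * ku * g n * _ = Cu * (a * a ^+ J * (ku * g n))); last by ring.
by rewrite !ler_wpM2l ?(ltW Cu0) ?mulr_ge0 ?(ltW (aJ J)) ?(ltW a0) // wu.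
Unshelve. all: by end_near.
Qed.

End rates.

(** From [a ^+ J <= n] one gets [J <= ln n / ln a]; the summand 2 absorbs the shift once
    [ln n >= 1]. *)
Lemma log_upper a Cu : 1 < a -> 1 <= Cu ->
  \forall n \near \oo, forall J, Cu * (a ^+ J * J.+1%:R) <= n%:R ->
    J.+2%:R <= ((ln a)^-1 + 2) * ln (n%:R : R).
Proof.
move=> a1 Cu1; have la : 0 < ln a by rewrite ln_gt0.
exists (Num.truncn (expR 1 : R)).+1 => // n /= nN J h.
have ne : expR 1 <= n%:R :> R by rewrite (le_trans (ltW (truncnS_gt _))) // ler_nat.
have n0 : 0 < n%:R :> R by rewrite (lt_le_trans (expR_gt0 1)).
have ln1 : 1 <= ln (n%:R : R) by rewrite -[leLHS]expRK ler_ln ?posrE ?expR_gt0.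
have aJ : 0 < a ^+ J by rewrite exprn_gt0 // (lt_trans ltr01).
have an : a ^+ J <= n%:R.
  apply: le_trans h; rewrite -[leLHS]mul1r ler_pM ?(ltW aJ) //.
  by rewrite ler_peMr ?(ltW aJ) // ler1n.
have : J%:R * ln a <= ln (n%:R : R).
  by rewrite mulr_natl -lnXn ?(lt_trans ltr01) // ler_ln ?posrE.
rewrite -ler_pdivlMr // mulrC mulrDl => hJ.
by rewrite -addn2 natrD lerD // ler_peMr.
Qed.

(** Taking logarithms leaves [ln J.+2], which is at most [J.+1]. *)
Lemma log_lower a cl : 1 < a -> 0 < cl -> cl <= 1 ->
  \forall n \near \oo, forall J, n%:R < cl * (a ^+ J.+1 * J.+2%:R) ->
    (ln a + 1)^-1 * ln (n%:R : R) <= J.+1%:R.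
Proof.
move=> a1 cl0 cl1; have la : 0 < ln a by rewrite ln_gt0.
have a0 : 0 < a by rewrite (lt_trans ltr01).
exists 1%N => // n /= n1 J h; have n0 : 0 < n%:R :> R by rewrite ltr0n.
have aJ : 0 < a ^+ J.+1 by rewrite exprn_gt0.
rewrite mulrC ler_pdivrMr ?addr_gt0 //.
have : ln n%:R <= ln (a ^+ J.+1 * J.+2%:R).
  rewrite ler_ln ?posrE ?mulr_gt0 // (le_trans (ltW h)) // ler_piMl //.
  by rewrite mulr_ge0 ?ltW.
rewrite lnM ?posrE // lnXn // => /le_trans; apply.
rewrite mulrDr mulr1 mulr_natl lerD2l -natr1 addrC.
by rewrite le_ln1Dx // (lt_le_trans (ltrN10 R)).
Qed.

End geometric_sums.

Section counting.
Variables (R : realType) (l : nat) (T : R) (r : nat) (gamma M : R).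
Hypotheses (T0 : 0 < T) (M0 : 0 < M) (r_ge1 : (1 <= r)%N) (gamma_gt0 : 0 < gamma).
Hypothesis (l0 : (0 < l)%N).
Local Notation s := (smoothness r gamma).
Local Notation Q := (Qstar (l := l) (T := T) r gamma M).
Let sigma : R := s%:R - gamma.

(* In the [j]-th shell the grid size [2 ^ - m] is such that
   [2 ^ - m s] times the size [2 ^ (j gamma)] of the derivatives is [2 ^ - (J sigma)]. *)
Definition level (J j : nat) : R := (J%:R * sigma + j%:R * gamma) / s%:R.
(** The two extra levels secure [j.+2 <= mesh J j]; [2 ^ mesh] exceeds [2 ^ level] by a factor of at
    most 4. *)
Definition mesh (J j : nat) : nat := (Num.truncn (level J j)).+2.
Definition eps (J : nat) : R := 2 `^ (- (J%:R * sigma)).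
Definition volume (J : nat) : R := \sum_(j < J.+1) 2 `^ (l%:R * level J j - j%:R).

Let sigma1 : 1 <= sigma. Proof. exact: smoothness_gap_ge1. Qed.
Let s0 : 0 < s%:R :> R.
Proof. by rewrite ltr0n (leq_ltn_trans _ (r_lt_smoothness _ gamma_gt0)). Qed.
Let sE : s%:R = sigma + gamma. Proof. by rewrite /sigma subrK. Qed.

(** As [s = sigma + gamma], [level J j] is a weighted mean of [J] and [j]. *)
Lemma level_ge J j : (j <= J)%N -> j%:R <= level J j.
Proof.
move=> jJ; rewrite /level ler_pdivlMr // sE mulrDr lerD2r ler_wpM2r ?ler_nat //.
exact: le_trans sigma1.
Qed.

Lemma mesh_ge J j : (j <= J)%N -> (j.+2 <= mesh J j)%N.
Proof. by move=> jJ; rewrite /mesh !ltnS truncn_ge_nat // ?level_ge // (le_trans _ (level_ge jJ)). Qed.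

Lemma pow_mesh J j : (j <= J)%N ->
  2 `^ level J j <= 2 ^+ mesh J j <= 4 * 2 `^ level J j.
Proof.
move=> jJ; have h := level_ge jJ; have h0 : 0 <= level J j by apply: le_trans h.
have /andP[t1 t2] := truncn_itv h0.
rewrite -powR_mulrn // /mesh; apply/andP; split.
  by apply: ler_powR; rewrite ?ler1n // (le_trans (ltW t2)) // ler_nat.
rewrite (_ : 4 = 2 `^ 2%:R); last by rewrite powR_mulrn //; lra.
rewrite -powRD; last by rewrite pnatr_eq0 implybT.
by apply: ler_powR; rewrite ?ler1n // -addn2 natrD addrC lerD2l.
Qed.

Lemma volume_term J j : 2 `^ (l%:R * level J j - j%:R) = (2 `^ level J j) ^+ l / 2 ^+ j.
Proof.
rewrite powRB ?pnatr_eq0 ?implybT // [l%:R * _]mulrC.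
by rewrite powRrM powR_mulrn ?powR_ge0 // powR_mulrn.
Qed.

(** Each cell carries [s ^ l] nodes. The 8 is 4 from rounding the level times 2 from bounding
    [2 ^ k + 1] by [2 * 2 ^ k]. *)
Lemma card_cells_le J :
  (#|cells l J (mesh J)| * s ^ l)%:R <= (s%:R ^+ l * l%:R * 8 ^+ l) * volume J.
Proof.
rewrite natrM natrX mulrC -!mulrA ler_wpM2l ?exprn_ge0 //.
apply: le_trans (_ : _ <= (\sum_(j < J.+1) l * ((2 ^ (mesh J j - j)).+1 * (2 ^ mesh J j).+1 ^ l.-1))%N%:R) _.
  by rewrite ler_nat card_cells.
rewrite natr_sum /volume mulrA mulr_sumr ler_sum // => -[j jJ] _ /=.
rewrite ltnS in jJ; have jm : (j <= mesh J j)%N by rewrite ltnW // ltnW // mesh_ge.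
rewrite natrM -mulrA ler_wpM2l // natrM natrX volume_term.
have /andP[_ h] := pow_mesh jJ.
have p1 k : (2 ^ k).+1%:R <= 2 * 2 ^+ k :> R.
  by rewrite -natrX -natrM ler_nat mul2n -addnn -[X in (X <= _)%N]addn1 leq_add2l expn_gt0.
apply: le_trans (_ : _ <= (2 * 2 ^+ (mesh J j - j)) * (2 * 2 ^+ mesh J j) ^+ l.-1) _.
  apply: ler_pM; rewrite ?exprn_ge0 ?p1 //.
  by apply: lerXn2r; rewrite ?nnegrE ?p1 // mulr_ge0 // exprn_ge0.
have -> : (2 * 2 ^+ (mesh J j - j)) * (2 * 2 ^+ mesh J j) ^+ l.-1 = (2 * 2 ^+ mesh J j) ^+ l / 2 ^+ j :> R.
  rewrite -[in RHS](prednK l0) exprS exprB ?unitfE ?pnatr_eq0 //.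
  by rewrite mulrA mulrAC.
rewrite mulrA ler_wpM2r ?invr_ge0 ?exprn_ge0 // -exprMn.
have u0 : 0 <= 2 ^+ mesh J j :> R by rewrite exprn_ge0.
have v0 := powR_ge0 2 (level J j).
move: (2 ^+ mesh J j : R) (2 `^ level J j) u0 v0 h => u v u0 v0 h.
by apply: lerXn2r; rewrite ?nnegrE; lra.
Qed.

Lemma card_blocks_ge J : volume J <= 2 * (#|blocks J (mesh J) l0|)%:R.
Proof.
have h := card_blocks l0 (fun j jJ => ltnW (mesh_ge jJ) : (j.+1 <= mesh J j)%N) (J := J).
have : 2 * (\sum_(j < J.+1) 2 ^ (mesh J j - j.+1) * (2 ^ mesh J j) ^ l.-1)%N%:R <=
    2 * (#|blocks J (mesh J) l0|)%:R :> R by rewrite ler_wpM2l // ler_nat.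
apply: le_trans; rewrite natr_sum mulr_sumr /volume ler_sum // => -[j jJ] _ /=.
rewrite ltnS in jJ; have jm : (j.+1 <= mesh J j)%N by rewrite ltnW // mesh_ge.
have /andP[h1 _] := pow_mesh jJ.
rewrite natrM !natrX volume_term.
have -> : 2 * (2 ^+ (mesh J j - j.+1) * (2 ^+ mesh J j) ^+ l.-1) = (2 ^+ mesh J j) ^+ l / 2 ^+ j :> R.
  rewrite -[in RHS](prednK l0) [in RHS]exprS exprB ?unitfE ?pnatr_eq0 // exprS.
  by field; rewrite expf_neq0 // pnatr_eq0.
by rewrite ler_wpM2r ?invr_ge0 ?exprn_ge0 // lerXn2r ?nnegrE ?powR_ge0 ?exprn_ge0.
Qed.


Lemma level_mulr_s J j : level J j * s%:R = J%:R * sigma + j%:R * gamma.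
Proof. by rewrite /level divfK // gt_eqF. Qed.

Definition err_cst : R := (2 * T) ^+ s * 4 `^ gamma / T `^ gamma.

Lemma err_cst_ge0 : 0 <= err_cst.
Proof.
by rewrite /err_cst !mulr_ge0 ?invr_ge0 ?powR_ge0 // exprn_ge0 // mulr_ge0 // ltW.
Qed.

Lemma err_bound J j : (j <= J)%N ->
  (2 * (T / 2 ^+ mesh J j)) ^+ s / ((T / 2 ^+ j.+2) `^ gamma) <= err_cst * eps J.
Proof.
move=> jJ; have /andP[h _] := pow_mesh jJ.
have v0 : 0 < 2 `^ level J j :> R by rewrite powR_gt0.
have u0 : 0 < 2 ^+ mesh J j :> R by rewrite exprn_gt0.
have p0 k : 0 < 2 ^+ k :> R by rewrite exprn_gt0.
have -> : (T / 2 ^+ j.+2) `^ gamma = T `^ gamma / (4 `^ gamma * 2 `^ (j%:R * gamma)).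
  rewrite powRM ?invr_ge0 ?(ltW T0) ?(ltW (p0 _)) // powRV ?(ltW (p0 _)) //.
  rewrite (_ : 2 ^+ j.+2 = 4 * 2 ^+ j :> R); last by rewrite !exprS mulrA; congr (_ * _); lra.
  by rewrite powRM ?(ltW (p0 _)) // -(powR_mulrn j) // -powRrM.
have -> : err_cst * eps J = (2 * T / 2 `^ level J j) ^+ s /
    (T `^ gamma / (4 `^ gamma * 2 `^ (j%:R * gamma))).
  rewrite /err_cst /eps expr_div_n -(powR_mulrn s (ltW v0)) -powRrM level_mulr_s.
  rewrite powRD ?pnatr_eq0 ?implybT // powRN.
  have g1 : T `^ gamma != 0 by rewrite gt_eqF // powR_gt0.
  have g2 : 4 `^ gamma != 0 :> R by rewrite gt_eqF // powR_gt0.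
  have g3 : 2 `^ (j%:R * gamma) != 0 :> R by rewrite gt_eqF // powR_gt0.
  have g4 : 2 `^ (J%:R * sigma) != 0 :> R by rewrite gt_eqF // powR_gt0.
  by move: g1 g2 g3 g4; move: (_ `^ gamma) (4 `^ gamma) (2 `^ _) (2 `^ _) => x1 x2 x3 x4 *; field; rewrite ?x1 ?x2 ?x3 ?x4 //; apply/and4P.
rewrite ler_wpM2r ?invr_ge0 ?divr_ge0 ?mulr_ge0 ?powR_ge0 //.
have T2 : 0 <= 2 * T by rewrite mulr_ge0 // ltW.
apply: lerXn2r; rewrite ?nnegrE ?mulrA ?divr_ge0 ?(ltW u0) ?(ltW v0) //.
by rewrite ler_wpM2l // lef_pV2 ?posrE.
Qed.

Lemma extrap_bound J : (2^-1 ^+ J * T) `^ sigma = T `^ sigma * eps J.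
Proof.
rewrite powRM ?exprn_ge0 ?invr_ge0 ?(ltW T0) // mulrC; congr (_ * _).
by rewrite exprVn powRV ?exprn_ge0 // -powR_mulrn // -powRrM /eps powRN.
Qed.

Lemma upper_bound (inf_dim : forall n (e : 'I_n -> C_cube l T), exists u : C_cube l T,
    forall a : 'I_n -> R, u <> \sum_i a i *: e i) :
  exists2 E : R, 0 < E & forall J n, (s%:R ^+ l * l%:R * 8 ^+ l) * volume J <= n%:R ->
    (kolmogorov_width n Q <= (E * eps J)%:E)%E /\
    (babenko_width n Q <= (E * eps J)%:E)%E.
Proof.
have [Lam Lam1 LamP] := lag_bounded R s.
pose E0 := 2 * gap_cst l gamma M Lam * T `^ sigma + Lam ^+ l * (local_cst l M Lam * err_cst).
have LL : 0 <= Lam ^+ l by rewrite exprn_ge0 // (le_trans ler01).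
have lc : 0 <= local_cst l M Lam by rewrite /local_cst !mulr_ge0 // ltW.
have gc := gap_cst_ge0 l gamma M0 Lam1.
have E00 : 0 <= E0.
  apply: addr_ge0; apply: mulr_ge0 => //; first exact: mulr_ge0.
    exact: powR_ge0.
  by rewrite mulr_ge0 // err_cst_ge0.
exists (2 * (E0 + 1)) => [|J n hn]; first by rewrite mulr_gt0 // ltr_wpDl.
have cn : (#|cells l J (mesh J)| * s ^ l <= n)%N.
  by rewrite -(ler_nat R) (le_trans (card_cells_le J)).
have ep : 0 < eps J by rewrite powR_gt0.
have hE : 2 * gap_cst l gamma M Lam * ((2^-1 ^+ J * T) `^ (s%:R - gamma)) +
    Lam ^+ l * (local_cst l M Lam * (err_cst * eps J)) <= (E0 + 1) * eps J.
  rewrite extrap_bound (_ : _ + _ = E0 * eps J); last by rewrite /E0; ring.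
  by rewrite ler_wpM2r ?(ltW ep) // lerDl.
split.
  apply: (le_trans (kolmogorov_width_Qstar T0 M0 r_ge1 gamma_gt0 l0 Lam1 LamP
    (@mesh_ge J) (@err_bound J) cn hE inf_dim)).
  by rewrite lee_fin ler_wpM2r ?(ltW ep) //; lra.
apply: (le_trans (babenko_width_Qstar T0 M0 r_ge1 gamma_gt0 l0 Lam1 LamP
    (@mesh_ge J) (@err_bound J) cn hE)).
by rewrite lee_fin mulrA.
Qed.

Lemma lower_bound : exists2 A : R, 0 < A & forall J n, n%:R < 2^-1 * volume J ->
    ((A * eps J)%:E <= kolmogorov_width n Q)%E /\
    ((A * eps J)%:E <= babenko_width n Q)%E.
Proof.
have [B B1 BP] := bump_bounded R s.
have B0 : 0 < B by apply: lt_le_trans B1.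
(* [w k] is the amplitude, in units of [eps J], that the derivatives of order [k] allow; the minimum
   covers the orders up to [r] and those above at once. The bumps get the least of these amplitudes,
   capped by 1. *)
pose w (k : 'I_s.+1) : R := T ^+ k / (B ^+ l * 4 ^+ k) * Num.min M (M / T `^ (k%:R - sigma)).
pose c : R := \big[Num.min/1]_k w k.
have c0 : 0 < c.
  apply: lt_bigmin => // k _; rewrite mulr_gt0 ?divr_gt0 ?mulr_gt0 ?exprn_gt0 //.
  by rewrite lt_min M0 divr_gt0 // powR_gt0.
have cw (k : nat) : (k <= s)%N -> c * (B ^+ l * 4 ^+ k / T ^+ k) <= Num.min M (M / T `^ (k%:R - sigma)).
  move=> ks; have : c <= w (Ordinal (ks : (k < s.+1)%N)) by exact: bigmin_le.
  rewrite /w /=; set mm := Num.min _ _ => h.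
  have x0 : 0 < B ^+ l * 4 ^+ k / T ^+ k by rewrite divr_gt0 ?mulr_gt0 ?exprn_gt0.
  by rewrite -ler_pdivlMr // invf_div mulrC.
have key J j k : (j <= J)%N -> (k <= s)%N ->
    c * eps J * (B ^+ l / (T / 2 ^+ mesh J j) ^+ k) <=
    Num.min M (M / T `^ (k%:R - sigma)) * 2 `^ (j%:R * (k%:R - sigma)).
  move=> jJ ks; have /andP[_ h] := pow_mesh jJ.
  have v0 := powR_ge0 2 (level J j).
  have e1 : c * eps J * (B ^+ l / (T / 2 ^+ mesh J j) ^+ k) =
      c * (B ^+ l / T ^+ k) * ((2 ^+ mesh J j) ^+ k * eps J).
    by rewrite expr_div_n invf_div; ring.
  have e2 : (2 ^+ mesh J j) ^+ k <= 4 ^+ k * 2 `^ (level J j * k%:R) :> R.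
    rewrite powRrM powR_mulrn // -exprMn.
    by apply: lerXn2r; rewrite ?nnegrE ?exprn_ge0 // mulr_ge0.
  (* The levels balance order [s] exactly; for order [k] the exponents differ by
     [(J - j) * sigma * (s - k) / s], which is nonnegative. *)
  have e3 : 2 `^ (level J j * k%:R) * eps J <= 2 `^ (j%:R * (k%:R - sigma)).
    rewrite /eps -powRD ?pnatr_eq0 ?implybT //; apply: ler_powR; rewrite ?ler1n //.
    rewrite /level mulrAC -subr_ge0.
    have -> : j%:R * (k%:R - sigma) - ((J%:R * sigma + j%:R * gamma) * k%:R / s%:R - J%:R * sigma) =
       (J%:R - j%:R) * sigma * (s%:R - k%:R) / s%:R.
      have := gt_eqF s0; rewrite sE => h0; field.
      by rewrite h0.
    rewrite divr_ge0 ?(ltW s0) // !mulr_ge0 ?subr_ge0 ?ler_nat //.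
    by rewrite -subr_ge0; exact: le_trans ler01 sigma1.
  have BT : 0 <= B ^+ l / T ^+ k by rewrite divr_ge0 ?exprn_ge0 ?ltW.
  rewrite e1 (@le_trans _ _ (c * (B ^+ l / T ^+ k) * (4 ^+ k * 2 `^ (j%:R * (k%:R - sigma))))) //.
    apply: ler_wpM2l; first exact: mulr_ge0 (ltW c0) BT.
    have ep : 0 <= eps J by exact: powR_ge0.
    apply: le_trans (ler_wpM2r ep e2) _.
    by rewrite -mulrA ler_wpM2l // exprn_ge0.
  rewrite mulrA (_ : _ * 4 ^+ k = c * (B ^+ l * 4 ^+ k / T ^+ k)); last by ring.
  by rewrite ler_wpM2r ?powR_ge0 // cw.
exists (c * @bump R s 0 2^-1 ^+ l) => [|J n hn]; first by rewrite mulr_gt0 // exprn_gt0 // bump_mid.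
have nb : (n < #|blocks J (mesh J) l0|)%N.
  rewrite -(ltr_nat R) (lt_le_trans hn) // mulrC ler_pdivrMr // mulrC.
  exact: card_blocks_ge.
have ep : 0 < eps J by rewrite powR_gt0.
rewrite mulrAC.
apply: (@le_widths_bump R l T r gamma M T0 M0 gamma_gt0 l0 B B1 BP J (mesh J) _ (c * eps J)) nb.
- by move=> j jJ; rewrite ltnW // mesh_ge.
- by rewrite mulr_gt0.
- move=> j k jJ kr; have ks : (k <= s)%N by rewrite (leq_trans kr) // ltnW // r_lt_smoothness.
  apply: le_trans (key _ _ _ jJ ks) _.
  rewrite -[leRHS]mulr1 ler_pM ?powR_ge0 ?ge_min ?lexx //.
    by rewrite le_min (ltW M0) divr_ge0 ?powR_ge0 // ltW.
  rewrite -[leRHS](powRr0 2); apply: ler_powR; first by rewrite ler1n.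
  rewrite mulr_ge0_le0 // subr_le0 /sigma smoothness_gap; have /andP[z0 _] := zeta_itv gamma_gt0.
  by rewrite (@le_trans _ _ r%:R) ?ler_nat // lerDl.
- move=> j k jJ /andP[rk ks]; apply: le_trans (key _ _ _ jJ ks) _.
  have -> : k%:R - r%:R - zeta gamma = k%:R - sigma.
    by rewrite /sigma smoothness_gap opprD addrA.
  rewrite powRM ?invr_ge0 ?exprn_ge0 ?(ltW T0) // powRV ?exprn_ge0 //.
  rewrite -(powR_mulrn j) // -powRrM invfM invrK mulrA ler_wpM2r ?powR_ge0 //.
  by rewrite ge_min lexx orbT.
Qed.

End counting.

(** * Rates *)

(** One shell with grid exponent [n.+1] already holds more than [n] disjoint bumps; the parameters
    [r = 1] and [gamma = 1] are an arbitrary choice. *)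
Lemma C_cube_infinite_dim (R : realType) (l : nat) (T : R) : 0 < T -> (0 < l)%N ->
  forall n (e : 'I_n -> C_cube l T), exists u : C_cube l T,
    forall a : 'I_n -> R, u <> \sum_i a i *: e i.
Proof.
move=> T0 l0 n e.
have mP j : (j <= 0)%N -> (j.+1 <= n.+1)%N by rewrite leqn0 => /eqP ->.
apply: (@blocks_infinite_dim R l T 1 1 T0 ltr01 l0 0 (fun=> n.+1) mP).
apply: leq_trans (card_blocks l0 mP).
rewrite big_ord1 subSS subn0 (leq_trans (ltn_expl n (ltnSn 1))) // leq_pmulr //.
by rewrite !expn_gt0.
Qed.

Section rate_cases.
Variables (R : realType) (l : nat) (r : nat) (gamma : R).
Hypotheses (r_ge1 : (1 <= r)%N) (gamma_gt0 : 0 < gamma) (l0 : (0 < l)%N).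
Local Notation s := (smoothness r gamma).
Let sigma : R := s%:R - gamma.

Variables (d : nat -> \bar R) (Ku E A : R).
Hypotheses (Ku0 : 0 <= Ku) (E0 : 0 < E) (A0 : 0 < A).
Hypothesis d_upper : forall J n, Ku * volume l r gamma J <= n%:R ->
  (d n <= (E * eps r gamma J)%:E)%E.
Hypothesis d_lower : forall J n, n%:R < 2^-1 * volume l r gamma J ->
  ((A * eps r gamma J)%:E <= d n)%E.

Let s0 : 0 < s%:R :> R.
Proof. by rewrite ltr0n (leq_ltn_trans _ (r_lt_smoothness _ gamma_gt0)). Qed.
Let sigma0 : 0 < sigma.
Proof. by apply: lt_le_trans ltr01 _; exact: smoothness_gap_ge1. Qed.
Let lR : 0 < l%:R :> R. Proof. by rewrite ltr0n. Qed.

Let base : R := 2 `^ (l%:R * sigma / s%:R).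
(** The binary logarithm of the ratio of consecutive terms of [volume]; its sign decides which shell
    dominates. *)
Let alpha : R := l%:R * gamma / s%:R - 1.

Lemma powR_gt1 (x : R) : 0 < x -> 1 < 2 `^ x.
Proof.
move=> x0; rewrite /powR pnatr_eq0 /= -[ltLHS]expR0 ltr_expR mulr_gt0 //.
by rewrite ln_gt0 // ltr1n.
Qed.

Lemma volumeE J : volume l r gamma J = base ^+ J * \sum_(j < J.+1) (2 `^ alpha) ^+ j.
Proof.
rewrite /volume mulr_sumr; apply: eq_bigr => j _.
rewrite -!powR_mulrn ?powR_ge0 // -!powRrM -powRD ?pnatr_eq0 ?implybT //.
by congr (_ `^ _); rewrite /level -/sigma /alpha; field; rewrite gt_eqF.
Qed.

Lemma epsE x p J : x * p = sigma -> eps r gamma J = ((2 `^ x) ^+ J) `^ (- p).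
Proof.
move=> e; rewrite -powR_mulrn ?powR_ge0 // -!powRrM /eps -/sigma; congr (_ `^ _).
by rewrite -e; ring.
Qed.

Let bounds_of (rate : nat -> R) := exists c1 c2 : R, [/\ 0 < c1, 0 < c2 &
  \forall n \near \oo, ((c1 * rate n)%:E <= d n <= (c2 * rate n)%:E)%E].

Lemma rate_of_volume x p (w g : nat -> R) (C ku kl : R) : 0 < x -> 0 < p -> x * p = sigma ->
  0 <= C -> (forall J, 1 <= w J) ->
  (forall J, (2 `^ x) ^+ J * w J <= volume l r gamma J <= C * ((2 `^ x) ^+ J * w J)) ->
  0 < ku -> 0 < kl ->
  (\forall n \near \oo, forall J,
    (1 + Ku * C) * ((2 `^ x) ^+ J * w J) <= n%:R -> w J.+1 <= ku * g n) ->
  (\forall n \near \oo, forall J,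
    n%:R < 2^-1 * ((2 `^ x) ^+ J.+1 * w J.+1) -> kl * g n <= w J) ->
  (\forall n \near \oo, 0 <= g n) ->
  bounds_of (fun n => n%:R `^ (- p) * g n `^ p).
Proof.
move=> x0 p0 xp C0 w1 vol ku0 kl0 wu wl g0.
have aw J : 0 <= (2 `^ x) ^+ J * w J.
  by rewrite mulr_ge0 ?exprn_ge0 ?powR_ge0 // (le_trans ler01).
apply: (@rate_bounds R (2 `^ x) p w d (powR_gt1 x0) p0 (1 + Ku * C) E 2^-1 A _ E0 _ _ A0
  w1 _ _ g ku kl ku0 kl0 wu wl g0).
- by rewrite lerDl mulr_ge0.
- by rewrite invr_gt0.
- by rewrite invf_le1 // ler1n.
- move=> J n h; rewrite -(epsE _ xp); apply: d_upper; apply: le_trans h.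
  have /andP[_ v] := vol J; rewrite mulrDl mul1r -mulrA ler_wpDl ?ler_wpM2l //.
- move=> J n h; rewrite -(epsE _ xp); apply: d_lower; apply: lt_le_trans h _.
  by have /andP[v _] := vol J; rewrite ler_wpM2l // invr_ge0.
Qed.

Let base_x : l%:R * sigma / s%:R * (s%:R / l%:R) = sigma.
Proof. by field; rewrite !gt_eqF. Qed.

Lemma rate_neg : alpha < 0 -> bounds_of (fun n => n%:R `^ (- (s%:R / l%:R))).
Proof.
move=> al; have b1 : 2 `^ alpha < 1.
  by rewrite /powR pnatr_eq0 /= -[ltRHS]expR0 ltr_expR nmulr_rlt0 // ln_gt0 // ltr1n.
have [||||||||||c1 [c2 [h1 h2 h]]] := @rate_of_volume (l%:R * sigma / s%:R) (s%:R / l%:R)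
  (fun=> 1) (fun=> 1) (1 - 2 `^ alpha)^-1 1 1 _ _ base_x.
- by rewrite divr_gt0 // mulr_gt0.
- by rewrite divr_gt0.
- by rewrite invr_ge0 subr_ge0 ltW.
- by [].
- move=> J; have /andP[g1 g2] := geometric_bounded J (powR_ge0 2 alpha) b1.
  have B0 : 0 <= base ^+ J by rewrite exprn_ge0 // powR_ge0.
  rewrite volumeE mulr1; apply/andP; split; last by rewrite mulrC ler_wpM2r.
  by rewrite -[leLHS]mulr1 ler_wpM2l.
- by [].
- by [].
- by near=> n => J _; rewrite mulr1.
- by near=> n => J _; rewrite mulr1.
- by near=> n.
exists c1, c2; split => //; apply: filterS h => n.
by rewrite powR1 mulr1.
Unshelve. all: by end_near.
Qed.

Lemma rate_pos : 0 < alpha -> bounds_of (fun n => n%:R `^ (- (sigma / (l%:R - 1)))).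
Proof.
move=> al; have b1 := powR_gt1 al.
(* A positive [alpha] excludes [l = 1], because [gamma < s]. *)
have l1 : 0 < l%:R - 1 :> R.
  rewrite subr_gt0 ltNge; apply/negP => l_le1.
  have : s%:R < l%:R * gamma by rewrite -[ltLHS]mul1r -ltr_pdivlMr // -subr_gt0.
  rewrite ltNge => /negP; apply; apply: le_trans (ler_wpM2r (ltW gamma_gt0) l_le1) _.
  by rewrite mul1r ltW // -subr_gt0.
(* The last shell dominates: its cells have side about [2 ^ - J], and about [2 ^ (J * (l - 1))] of
   them cover the layer along the faces. *)
have ab : base * 2 `^ alpha = 2 `^ (l%:R - 1).
  rewrite /base -powRD ?pnatr_eq0 ?implybT //; congr (_ `^ _).
  by rewrite /alpha /sigma; field; rewrite gt_eqF.
have [|||||||||||c1 [c2 [h1 h2 h]]] := @rate_of_volume (l%:R - 1) (sigma / (l%:R - 1))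
  (fun=> 1) (fun=> 1) (2 `^ alpha / (2 `^ alpha - 1)) 1 1.
- by [].
- by rewrite divr_gt0.
- by rewrite mulrC divfK // gt_eqF.
- by rewrite divr_ge0 ?powR_ge0 // subr_ge0 ltW.
- by [].
- move=> J; have /andP[g1 g2] := geometric_dominated J b1.
  have B0 : 0 <= base ^+ J by rewrite exprn_ge0 // powR_ge0.
  rewrite volumeE mulr1 -ab exprMn; apply/andP; split; first exact: ler_wpM2l.
  by rewrite mulrCA ler_wpM2l.
- by [].
- by [].
- by near=> n => J _; rewrite mulr1.
- by near=> n => J _; rewrite mulr1.
- by near=> n.
exists c1, c2; split => //; apply: filterS h => n.
by rewrite powR1 mulr1.
Unshelve. all: by end_near.
Qed.

Lemma rate_zero : alpha = 0 ->
  bounds_of (fun n => n%:R `^ (- (s%:R / l%:R)) * ln n%:R `^ (s%:R / l%:R)).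
Proof.
move=> al; have x0 : 0 < l%:R * sigma / s%:R by rewrite divr_gt0 // mulr_gt0.
have a1 := powR_gt1 x0; have la : 0 < ln (2 `^ (l%:R * sigma / s%:R) : R) by rewrite ln_gt0.
apply: (@rate_of_volume (l%:R * sigma / s%:R) (s%:R / l%:R) (fun J => J.+1%:R)
  (fun n => ln n%:R) 1 ((ln (2 `^ (l%:R * sigma / s%:R)))^-1 + 2)
  (ln (2 `^ (l%:R * sigma / s%:R)) + 1)^-1 x0 _ base_x) => //.
- by rewrite divr_gt0.
- by move=> J; rewrite ler1n.
- move=> J; rewrite volumeE al powRr0 mul1r.
  rewrite (_ : \sum_(j < _) _ = J.+1%:R); first by rewrite lexx.
  by under eq_bigr do rewrite expr1n; rewrite sumr_const card_ord.
- by rewrite addr_gt0 // invr_gt0.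
- by rewrite invr_gt0 addr_gt0.
- by apply: log_upper => //; rewrite lerDl mulr_ge0.
- by apply: log_lower => //; rewrite ?invr_gt0 // invf_le1 // ler1n.
- by exists 1%N => // n /= n1; rewrite ln_ge0 // ler1n.
Qed.

Lemma width_rate_bounds : bounds_of (width_rate l s gamma).
Proof.
have gs : gamma < s%:R by rewrite -subr_gt0.
rewrite /width_rate -/sigma; have [l1|l_neq1] := eqVneq l 1%N.
  have := rate_neg; rewrite l1 divr1; apply.
  by rewrite /alpha l1 mul1r subr_lt0 ltr_pdivrMr ?mul1r.
have l1 : 0 < l%:R - 1 :> R by rewrite subr_gt0 ltr1n ltn_neqAle eq_sym l_neq1.
(* So [v - l / (l - 1)] has the sign of [alpha]; the case [l = 1], where [alpha] is negative, has
   been settled before. *)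
have vE : s%:R / sigma - l%:R / (l%:R - 1) = s%:R / (sigma * (l%:R - 1)) * alpha.
  by rewrite /alpha /sigma; field; rewrite !gt_eqF.
have c0 : 0 < s%:R / (sigma * (l%:R - 1)) by rewrite divr_gt0 // mulr_gt0.
have [h|h|h] := ltgtP _ (s%:R / sigma).
- by apply: rate_pos; rewrite -(pmulr_rgt0 _ c0) -vE subr_gt0.
- by apply: rate_neg; rewrite -(pmulr_rlt0 _ c0) -vE subr_lt0.
- by apply: rate_zero; apply: (mulfI (lt0r_neq0 c0)); rewrite -vE h subrr mulr0.
Qed.

End rate_cases.

Theorem theorem2p1 (R : realType) (T M : R) (l r : nat) (gamma : R)
    (T_gt0 : 0 < T) (M_gt0 : 0 < M) (l_ge1 : (1 <= l)%N) (r_ge1 : (1 <= r)%N)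
    (gamma_gt0 : 0 < gamma) :
  let s := smoothness r gamma in
  let Q := Qstar (l := l) (T := T) r gamma M in
  asymp (fun n => kolmogorov_width n Q) (fun n => babenko_width n Q) /\
  asymp (fun n => babenko_width n Q) (fun n => (width_rate l s gamma n)%:E).
Proof.
move=> s Q.
have [E E0 up] := upper_bound T_gt0 M_gt0 r_ge1 gamma_gt0 l_ge1
  (C_cube_infinite_dim T_gt0 l_ge1).
have [A A0 low] := lower_bound T_gt0 M_gt0 r_ge1 gamma_gt0 l_ge1.
have Ku0 : 0 <= s%:R ^+ l * l%:R * 8 ^+ l :> R by rewrite !mulr_ge0 ?exprn_ge0.
have [k1 [k2 [k10 k20 hk]]] := @width_rate_bounds R l r gamma r_ge1 gamma_gt0 l_ge1
  (fun n => kolmogorov_width n Q) _ E A Ku0 E0 A0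
  (fun J n h => (up J n h).1) (fun J n h => (low J n h).1).
have [b1 [b2 [b10 b20 hb]]] := @width_rate_bounds R l r gamma r_ge1 gamma_gt0 l_ge1
  (fun n => babenko_width n Q) _ E A Ku0 E0 A0
  (fun J n h => (up J n h).2) (fun J n h => (low J n h).2).
split; last first.
  by exists b1, b2; split => //; apply: filterS hb => n; rewrite !EFinM.
(* The common rate is eliminated between the two pairs of bounds, hence the quotients. *)
exists (k1 / b2), (k2 / b1); split; [by rewrite divr_gt0..|].
near=> n.
have /andP[kl ku] : ((k1 * width_rate l s gamma n)%:E <= kolmogorov_width n Q
  <= (k2 * width_rate l s gamma n)%:E)%E by near: n.
have /andP[bl bu] : ((b1 * width_rate l s gamma n)%:E <= babenko_width n Q
  <= (b2 * width_rate l s gamma n)%:E)%E by near: n.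
apply/andP; split.
- apply: le_trans kl; apply: le_trans (lee_wpmul2l _ bu) _.
    by rewrite lee_fin ltW // divr_gt0.
  by rewrite -EFinM mulrA divfK // gt_eqF.
- apply: le_trans ku _; apply: le_trans (lee_wpmul2l _ bl).
    by rewrite -EFinM mulrA divfK // gt_eqF.
  by rewrite lee_fin ltW // divr_gt0.
Unshelve. all: by end_near.
Qed.
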